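(* Let $d,L,N,n\ge 1$ and $p\ge 1$ be integers, let $R>0$, and let $\mu^1,\dots,\mu^L\in\mathcal M_1(\mathbb B_R)$. For each $\ell\in\{1,\dots,L\}$ let $X_1^\ell,\dots,X_n^\ell$ be i.i.d. random variables with law $\mu^\ell$, and let $\mu_n^\ell=\frac1n\sum_{i=1}^n\delta_{X_i^\ell}$ be the associated empirical measure. Let $\mathbb D$ be one of $W_p^p$, $W_{\epsilon,p}^p$ (for some $\epsilon>0$), $SW_p^p$, $\text{max-}SW_p^p$. Then $$\mathbb E\left[\sup_{(Y,\pi)\in\mathbb B_R^N\times\Delta_N}\left|F_{\mathbb D}\Big(\mu^1,\dots,\mu^L,\sum_{i=1}^N\pi_i\delta_{y_i}\Big)-F_{\mathbb D}\Big(\mu^1_n,\dots,\mu^L_n,\sum_{i=1}^N\pi_i\delta_{y_i}\Big)\right|\right]\le C_{p,R}\sqrt{\frac{C_{d,N}}{n}},$$ where $Y=(y_1,\dots,y_N)$ and the finite constants $C_{p,R}$, $C_{d,N}$ are as follows. (i) If $\mathbb D=W_p^p$: $C_{p,R}=8\sqrt2\int_0^{2(2R)^p}\sqrt{\log\left(2+\frac{32pR^p}{\tau}\right)}\,d\tau$ and $C_{d,N}=N(d+1)$. (ii) If $\mathbb D=SW_p^p$ or $\mathbb D=\text{max-}SW_p^p$: $C_{p,R}=8\sqrt2\int_0^{2(2R)^p}\sqrt{\log\left(2+\frac{48pR^p}{\tau}\right)}\,d\tau$ and $C_{d,N}=N(d+1)+d$. (iii) If $\mathbb D=W_{\epsilon,p}^p$: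 $C_{p,R}=8\sqrt2\int_0^{(4p+1)(2R)^p}\sqrt{\log\left(2+\frac{64p(2R)^p}{\tau}\right)}\,d\tau$ and $C_{d,N}=N(d+1)$.
   Context: $\|\cdot\|$ is the Euclidean norm on $\mathbb R^d$, $\mathbb B_R$ is the closed ball of $\mathbb R^d$ centered at $0$ with radius $R$, $\mathcal M_1(\Omega)$ is the set of probability measures on $\Omega\subset\mathbb R^d$, $\Delta_N=\{\pi\in[0,1]^N:\sum_i\pi_i=1\}$ is the probability simplex, and $\mathbb S^{d-1}$ is the unit sphere of $\mathbb R^d$. $\Pi(\mu,\nu)$ denotes the set of probability measures on $\mathbb R^d\times\mathbb R^d$ with marginals $\mu,\nu$. Divergences, for $\mu,\nu\in\mathcal M_1(\mathbb R^d)$: - $W_p^p(\mu,\nu)=\inf_{\gamma\in\Pi(\mu,\nu)}\int\|x-y\|^p\,d\gamma(x,y)$ (and likewise on $\mathbb R$, with cost $|x-y|^p$). - $W_{\epsilon,p}^p(\mu,\nu)=\inf_{\gamma\in\Pi(\mu,\nu)}\int\|x-y\|^p\,d\gamma(x,y)+\epsilon\,\mathrm{KL}(\gamma|\mu\otimes\nu)$, where $\mathrm{KL}(\gamma|\xi)=\int_{\mathbb R^d\times\mathbb R^d}\left(\log\left(\frac{d\gamma}{d\xi}(x,y)\right)-1\right)d\gamma(x,y)$ if $\gamma\ll\xi$ and $+\infty$ otherwise. - With $P_\theta(x)=\langle\theta,x\rangle$, $P_{\theta\sharp}\mu$ the pushforward, and $\sigma$ the uniform probability measure on $\mathbb S^{d-1}$: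 $SW_p^p(\mu,\nu)=\int_{\mathbb S^{d-1}}W_p^p(P_{\theta\sharp}\mu,P_{\theta\sharp}\nu)\,d\sigma(\theta)$ and $\text{max-}SW_p^p(\mu,\nu)=\max_{\theta\in\mathbb S^{d-1}}W_p^p(P_{\theta\sharp}\mu,P_{\theta\sharp}\nu)$. Barycenter functional: $F_{\mathbb D}(\mu^1,\dots,\mu^L,\nu)=\frac1L\sum_{\ell=1}^L\mathbb D(\mu^\ell,\nu)$. *)

(* Defs.v *)
From HB Require Import structures.
From mathcomp Require Import all_boot all_order all_algebra.
From mathcomp Require Import all_classical all_reals all_analysis.
From mathcomp Require Import measurable_realfun.

Set Implicit Arguments.
Unset Strict Implicit.
Unset Printing Implicit Defensive.

Import Order.TTheory GRing.Theory Num.Theory.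
Import numFieldNormedType.Exports.

Local Open Scope classical_set_scope.
Local Open Scope ring_scope.

(* Borel sigma-algebra of 'rV[R]_d.  The library topology (and norm) of
   'rV[R]_d comes from the sup norm; [enorm] below is the Euclidean norm, which
   induces the same topology. *)
HB.instance Definition _ (R : realType) (d : nat) :=
  @isMeasurable.Build (sigma_display (@open 'rV[R]_d)) 'rV[R]_d
    <<s (@open 'rV[R]_d) >> (@sigma_algebra0 _ setT _) (@sigma_algebraC _ _)
    (@sigma_algebra_bigcup _ setT _).

Section euclidean.
Context (R : realType) (d : nat).
Implicit Types x y theta : 'rV[R]_d.

Definition edot x y : R := \sum_(j < d) x 0 j * y 0 j.

Definition enorm x : R := Num.sqrt (edot x x).

Definition eball (r : R) : set 'rV[R]_d := [set x | enorm x <= r].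

Definition esphere : set 'rV[R]_d := [set x | enorm x = 1].

Lemma continuous_edot theta : continuous (edot theta : 'rV[R]_d -> R).
Proof.
have addc : continuous (fun z : R * R => z.1 + z.2) by exact: add_continuous.
move=> x; apply: (@cvg_big _ _ _ _ _ addc _ (nbhs x)) => j _.
by apply: cvgM; [exact: cvg_cst | exact: coord_continuous].
Qed.

Lemma measurable_edot theta :
  measurable_fun [set: 'rV[R]_d] (edot theta : 'rV[R]_d -> R).
Proof.
apply: (measurability _ (RGenOInfty.measurableE R)) => _ [_ [a ->] <-].
rewrite setTI; apply: sub_sigma_algebra.
apply: open_comp => [x _|]; first exact: continuous_edot.
exact: interval_open.
Qed.

HB.instance Definition _ theta :=
  isMeasurableFun.Build _ _ _ _ (edot theta) (measurable_edot theta).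

End euclidean.

Section discrete_probability.
Context (R : realType).

Record simplex (N : nat) := Simplex {
  weight :> 'I_N -> R ;
  weight01 : forall i, 0 <= weight i <= 1 ;
  weight_sum1 : \sum_(i < N) weight i = 1 }.

Context d (T : measurableType d) (N : nat).
Variables (w : simplex N) (y : 'I_N -> T).
Local Open Scope ereal_scope.

Definition discrete_prob (A : set T) : \bar R :=
  \sum_(i < N) (w i)%:E * \d_(y i) A.

Let w_ge0 i : (0 <= w i)%R. Proof. by case/andP: (weight01 w i). Qed.

Let discrete_prob0 : discrete_prob set0 = 0.
Proof. by rewrite /discrete_prob big1 // => i _; rewrite measure0 mule0. Qed.

Let discrete_prob_ge0 A : 0 <= discrete_prob A.
Proof.
by apply: sume_ge0 => i _; rewrite mule_ge0 ?lee_fin ?w_ge0 ?measure_ge0.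
Qed.

Let discrete_prob_sigma_additive : semi_sigma_additive discrete_prob.
Proof.
move=> F mF tF mUF; rewrite [X in _ --> X](_ : _ =
    lim ((fun n => \sum_(0 <= i < n) discrete_prob (F i))%E @ \oo)).
  by apply: is_cvg_ereal_nneg_natsum => k _; exact: discrete_prob_ge0.
rewrite nneseries_sum; last first.
  by move=> i j _; rewrite mule_ge0 ?lee_fin ?w_ge0 ?measure_ge0.
apply: eq_bigr => /= i _.
rewrite nneseriesZl ?lee_fin ?w_ge0; last by move=> *; exact: measure_ge0.
by congr (_ * _); exact: measure_semi_bigcup.
Qed.

HB.instance Definition _ := isMeasure.Build _ _ _ discrete_prob
  discrete_prob0 discrete_prob_ge0 discrete_prob_sigma_additive.

Let discrete_prob_setT : discrete_prob setT = 1.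
Proof.
rewrite /discrete_prob; under eq_bigr do rewrite diracT mule1.
by rewrite sumEFin weight_sum1.
Qed.

HB.instance Definition _ :=
  Measure_isProbability.Build _ _ _ discrete_prob discrete_prob_setT.

End discrete_probability.

Section empirical.
Context (R : realType) (n : nat).
Hypothesis n_gt0 : (0 < n)%N.

Lemma uniform_weight01 (i : 'I_n) : 0 <= (n%:R^-1 : R) <= 1.
Proof. by rewrite invr_ge0 ler0n /= invf_le1 ?ltr0n // ler1n. Qed.

Lemma uniform_weight_sum1 : \sum_(i < n) (n%:R^-1 : R) = 1.
Proof.
by rewrite sumr_const card_ord -[RHS](@mulfV _ n%:R) ?pnatr_eq0 -?lt0n//
           mulr_natl.
Qed.

Definition uniform_weights : simplex R n :=
  Simplex uniform_weight01 uniform_weight_sum1.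

Definition empirical d (T : measurableType d) (x : 'I_n -> T) :
  probability T R := discrete_prob uniform_weights x.

End empirical.

Section transport.
Context (R : realType).
Local Open Scope ereal_scope.

(* Note the shift by -1 in the integrand: this is the convention of entropic
   optimal transport, and differs from the usual one by the constant 1. *)
Definition KL d (S : measurableType d) (g xi : probability S R) : \bar R :=
  if `[< g `<< xi >] then
    \int[g]_z (lne (Radon_Nikodym (charge_of_finite_measure g) xi z) - 1)
  else +oo.

Context d (T : measurableType d).
Implicit Types (mu nu : probability T R) (c : T -> T -> R).

Definition coupling mu nu : set (probability (T * T)%type R) :=
  [set g | (forall A, measurable A -> g (A `*` setT) = mu A) /\
           (forall A, measurable A -> g (setT `*` A) = nu A)].

Definition ot_cost c mu nu : \bar R :=
  ereal_inf [set \int[g]_z (c z.1 z.2)%:E | g in coupling mu nu].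

Definition entropic_ot_cost (eps : R) c mu nu : \bar R :=
  ereal_inf [set \int[g]_z (c z.1 z.2)%:E + eps%:E * KL g (mu \x nu)
            | g in coupling mu nu].

End transport.

Section divergences.
Context (R : realType) (d p : nat).
Implicit Types (mu nu : probability 'rV[R]_d R) (theta : 'rV[R]_d).
Local Open Scope ereal_scope.

Definition ecost (x y : 'rV[R]_d) : R := (enorm (x - y) ^+ p)%R.

Definition Wpp mu nu : \bar R := ot_cost ecost mu nu.

Definition Wpp_eps (eps : R) mu nu : \bar R := entropic_ot_cost eps ecost mu nu.

Definition Wpp_proj mu nu theta : \bar R :=
  ot_cost (fun s t : R => (`|s - t| ^+ p)%R)
    (distribution mu (edot theta)) (distribution nu (edot theta)).

(* The uniform probability measure on the sphere, seen as a measure on the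
   ambient space: the (unique) rotation-invariant probability measure that is
   carried by the sphere. *)
Definition uniform_on_sphere (sigma : probability 'rV[R]_d R) : Prop :=
  sigma (@esphere R d) = 1 /\
  forall (U : 'M[R]_d) (A : set 'rV[R]_d),
    (U *m U^T = 1%:M)%R -> measurable A ->
    sigma [set x | A (x *m U)%R] = sigma A.

Definition SWpp (sigma : probability 'rV[R]_d R) mu nu : \bar R :=
  \int[sigma]_(theta in @esphere R d) Wpp_proj mu nu theta.

(* The maximum over the sphere, rendered as a supremum in \bar R. *)
Definition maxSWpp mu nu : \bar R :=
  ereal_sup [set Wpp_proj mu nu theta | theta in @esphere R d].

End divergences.

Section barycenter.
Context (R : realType) (d L : nat).
Local Open Scope ereal_scope.
Variable D : probability 'rV[R]_d R -> probability 'rV[R]_d R -> \bar R.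

Definition bary_obj (mu : 'I_L -> probability 'rV[R]_d R)
    (nu : probability 'rV[R]_d R) : \bar R :=
  (L%:R^-1)%:E * \sum_(l < L) D (mu l) nu.

Definition sup_gap (N : nat) (r : R)
    (mu mu' : 'I_L -> probability 'rV[R]_d R) : \bar R :=
  ereal_sup [set `| bary_obj mu (discrete_prob q.2 q.1)
                    - bary_obj mu' (discrete_prob q.2 q.1) |
            | q in [set q : ('I_N -> 'rV[R]_d) * simplex R N
                   | forall i, eball r (q.1 i)]].

End barycenter.

Section iid.
Context d (T : measurableType d) d' (T' : measurableType d') (R : realType).
Local Open Scope ereal_scope.

Definition mutually_independent (P : probability T R) (n : nat)
    (X : 'I_n -> {RV P >-> T'}) : Prop :=
  forall (J : {set 'I_n}) (A : 'I_n -> set T'),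
    (forall i, measurable (A i)) ->
    P (\big[setI/setT]_(i in J) (X i @^-1` A i)) =
    \prod_(i in J) P (X i @^-1` A i).

Definition iid_with_law (P : probability T R) (n : nat)
    (X : 'I_n -> {RV P >-> T'}) (mu : probability T' R) : Prop :=
  mutually_independent X /\
  forall i A, measurable A -> distribution P (X i) A = mu A.

End iid.

(* At the (null) endpoint t = 0 the library reads a / t as 0. *)
Definition entropy_const (R : realType) (a M : R) : \bar R :=
  ((8 * Num.sqrt 2)%:E *
   \int[lebesgue_measure]_(t in `[0%R, M]) (Num.sqrt (ln (2 + a / t)))%:E)%E.

(* Main.v *)
(** By duality, the transport cost from [mu] to a measure with [N] atoms is a
    supremum, over prices [psi] on the atoms, of integrals against [mu] of the
    potential [x |-> min_a (c x y_a - psi_a)] (a soft minimum in the entropic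
    case).  The optimal potential for one source measure is admissible for any
    other, so all the gaps between [mu^l] and [mu^l_n] are bounded by the
    deviation of the empirical process over one class of potentials; the sliced
    costs lead to the potentials of the projected points, uniformly in the
    direction.  Symmetrization and chaining bound this deviation by Rademacher
    averages.

    For [c = |x - y|^p] normalised to [0, 1], a uniform cover would have a
    scale growing with [p].  But [1 - (|x - y| / 2r)^2] is half a squared
    Euclidean distance [|xi - beta|^2], up to terms depending on [x] or [y]
    only, so at resolution [sigma] the atoms that matter satisfy
    [|xi - beta|^2 <= 4 ln (1 / sigma) / p]: localising there compensates the
    Lipschitz constant [p], and the average is at most [9 sqrt (N (d + 1) / n)],
    which is below the entropy integral since [ln 2 >= 16 / 25]. *)

Require Import Defs.
From HB Require Import structures.
From mathcomp Require Import all_boot all_order all_algebra.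
From mathcomp Require Import all_classical all_reals all_analysis.
From mathcomp Require Import measurable_realfun ring lra.

Set Implicit Arguments.
Unset Strict Implicit.
Unset Printing Implicit Defensive.

Import Order.TTheory GRing.Theory Num.Theory.
Import numFieldNormedType.Exports.

Local Open Scope classical_set_scope.
Local Open Scope ring_scope.

(** * The Euclidean norm *)

(** Symmetrization costs a factor 2, which turns [9 * (2 r)^p] into [9 * (2 (2 r)^p)]; the bracket
    is the upper limit of the entropy integral, and [9 <= 8 sqrt (2 ln 2)]. Hence the Rademacher
    constant must be at most 9 for every [p], which a uniform cover cannot give. For a fixed sample
    only one potential per sign vector matters, so each class becomes a finite family and covers are
    obtained by counting labels. In the sliced case the direction takes the place of the positions
    of the atoms in the lattice, so it adds no parameter. Optimal prices come from the entropic
    problem alone: its dual is continuous on a compact box, a Sinkhorn step extends the maximiser to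
    prices on the whole space, and the plain cost is reached by letting the strength of the
    regularisation tend to 0. The supremum over target measures and the projected cost as a function
    of the direction are not known to be measurable; both are handled by comparisons of integrals
    valid for arbitrary functions. *)

Lemma ler_sum_const (R : realType) n (F : 'I_n -> R) a :
  (forall i, F i <= a) -> \sum_i F i <= n%:R * a.
Proof.
move=> h; apply: (@le_trans _ _ (\sum_(i < n) a)); first exact: ler_sum.
by rewrite sumr_const card_ord mulr_natl.
Qed.

Section euclidean_norm.
Context {R : realType} {d : nat}.
Implicit Types x y z : 'rV[R]_d.

Lemma edotC x y : edot x y = edot y x.
Proof. by apply: eq_bigr => i _; rewrite mulrC. Qed.

Lemma edotDl x y z : edot (x + y) z = edot x z + edot y z.
Proof. by rewrite /edot -big_split; apply: eq_bigr => i _; rewrite mxE mulrDl. Qed.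

Lemma edotZl a x y : edot (a *: x) y = a * edot x y.
Proof. by rewrite /edot mulr_sumr; apply: eq_bigr => i _; rewrite mxE mulrA. Qed.

Lemma edotDr x y z : edot x (y + z) = edot x y + edot x z.
Proof. by rewrite !(edotC x) edotDl. Qed.

Lemma edotZr a x y : edot x (a *: y) = a * edot x y.
Proof. by rewrite !(edotC x) edotZl. Qed.

Lemma edotNl x y : edot (- x) y = - edot x y.
Proof. by rewrite -scaleN1r edotZl mulN1r. Qed.

Lemma edotNr x y : edot x (- y) = - edot x y.
Proof. by rewrite !(edotC x) edotNl. Qed.

Definition edotE := (edotDl, edotDr, edotNl, edotNr, edotZl, edotZr).

Lemma edot_ge0 x : 0 <= edot x x.
Proof. by apply: sumr_ge0 => i _; rewrite -expr2 sqr_ge0. Qed.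

Lemma enorm_ge0 x : 0 <= enorm x.
Proof. exact: sqrtr_ge0. Qed.

Lemma sqr_enorm x : enorm x ^+ 2 = edot x x.
Proof. by rewrite sqr_sqrtr // edot_ge0. Qed.

Lemma enorm_le x a : 0 <= a -> (enorm x <= a) = (edot x x <= a ^+ 2).
Proof. by move=> a0; rewrite -sqr_enorm ler_pXn2r // nnegrE enorm_ge0. Qed.

Lemma cauchy_schwarz x y : edot x y <= enorm x * enorm y.
Proof.
have h : edot x y ^+ 2 <= edot x x * edot y y.
  have := edot_ge0 (edot y y *: x - edot x y *: y).
  rewrite !edotE (edotC y x) => h.
  have [y0|y0] := eqVneq (edot y y) 0.
    have [->|a0] := eqVneq (edot x y) 0; first by rewrite expr0n mulr_ge0 ?edot_ge0.
    (* With [edot y y = 0] the squared norm of [x - t y] is affine in [t]; this [t] would make it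
       -1. *)
    have := edot_ge0 (x - (edot x x + 1) / (2 * edot x y) *: y).
    rewrite !edotE (edotC y x) y0.
    have -> : (edot x x + 1) / (2 * edot x y) * edot x y = (edot x x + 1) / 2 by field.
    lra.
  have yy : 0 < edot y y by rewrite lt_neqAle eq_sym y0 edot_ge0.
  by rewrite -(ler_pM2l yy); lra.
apply: le_trans (ler_norm _) _; rewrite -[X in X <= _]sqrtr_sqr.
by rewrite -sqrtrM ?edot_ge0 // ler_wsqrtr.
Qed.

Lemma ler_enormD x y : enorm (x + y) <= enorm x + enorm y.
Proof.
rewrite enorm_le ?addr_ge0 ?enorm_ge0 // !edotE (edotC y x) -!sqr_enorm.
have := cauchy_schwarz x y; lra.
Qed.

Lemma enormN x : enorm (- x) = enorm x.
Proof. by rewrite /enorm !edotE opprK. Qed.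

Lemma sqr_enormD x y : enorm (x + y) ^+ 2 = enorm x ^+ 2 + 2 * edot x y + enorm y ^+ 2.
Proof. by rewrite !sqr_enorm !edotE (edotC y x); ring. Qed.

Lemma enormZ a x : enorm (a *: x) = `|a| * enorm x.
Proof.
by rewrite /enorm !edotE mulrA -expr2 sqrtrM ?sqr_ge0 // sqrtr_sqr.
Qed.

Lemma enorm_distC x y : enorm (x - y) = enorm (y - x).
Proof. by rewrite -enormN opprB. Qed.

Lemma enorm_dist_triangle x y z : enorm (x - z) <= enorm (x - y) + enorm (y - z).
Proof. by rewrite -[x - z](subrKA y) ler_enormD. Qed.

Lemma norm_edot_le x y : `|edot x y| <= enorm x * enorm y.
Proof.
have [_|_] := ger0P; first exact: cauchy_schwarz.
by rewrite -edotNl -(enormN x) cauchy_schwarz.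
Qed.

Lemma coord_le_enorm x k : `|x 0 k| <= enorm x.
Proof.
rewrite -sqrtr_sqr ler_wsqrtr // /edot (bigD1 k) //= -expr2 lerDl.
by apply: sumr_ge0 => i _; rewrite -expr2 sqr_ge0.
Qed.

Lemma sum_norm_le_enorm x : \sum_k `|x 0 k| <= Num.sqrt d%:R * enorm x.
Proof.
pose s : 'rV[R]_d := \row_k Num.sg (x 0 k).
have -> : \sum_k `|x 0 k| = edot s x.
  by apply: eq_bigr => k _; rewrite mxE normrEsg.
apply: (le_trans (cauchy_schwarz _ _)); rewrite ler_wpM2r ?enorm_ge0 //.
rewrite ler_wsqrtr //; apply: (@le_trans _ _ (\sum_(k < d) 1)).
  by apply: ler_sum => k _; rewrite mxE -expr2 sqr_sg; case: (_ != _).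
by rewrite sumr_const card_ord.
Qed.

Lemma enorm_le_coord x g : 0 <= g -> (forall k, `|x 0 k| <= g) ->
  enorm x <= Num.sqrt d%:R * g.
Proof.
move=> g0 h; rewrite enorm_le ?mulr_ge0 // exprMn sqr_sqrtr ?ler0n //.
apply: (@le_trans _ _ (\sum_(k < d) g ^+ 2)).
  by apply: ler_sum => k _; rewrite -expr2 -real_normK ?num_real // lerXn2r ?nnegrE.
by rewrite sumr_const card_ord -[X in X <= _]mulr_natl.
Qed.

End euclidean_norm.

(** * Rademacher averages and chaining *)

Section rademacher.
Context {R : realType}.

(** Compares the Taylor coefficients of [cosh x] with those of [exp (x^2 / 2)]. *)
Lemma double_factorial_ge k : (2 ^ k * k`! <= k.*2`!)%N.
Proof.
elim: k => // k IH; rewrite doubleS !factS expnS.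
have -> : (2 * 2 ^ k * (k.+1 * k`!) = (2 * k.+1) * (2 ^ k * k`!))%N by ring.
rewrite mul2n doubleS; apply: leq_mul => //.
by apply: (leq_trans IH); rewrite leq_pmull.
Qed.

(** The odd terms of the two series cancel and the even ones compare term by term; this is the
    subgaussian bound for one fair sign. *)
Lemma expR_addN_le (x : R) : expR x + expR (- x) <= 2 * expR (x ^+ 2 / 2).
Proof.
pose S n := series (exp_coeff x) n + series (exp_coeff (- x)) n.
have expRE y : series (exp_coeff y) @ \oo --> expR y.
  exact: is_cvg_series_exp_coeff.
have cS : S @ \oo --> expR x + expR (- x) by apply: cvgD; exact: expRE.
have termE n : exp_coeff x n + exp_coeff (- x) n =
    if odd n then 0 else 2 * (x ^+ n / n`!%:R).
  rewrite /exp_coeff /= exprNn -signr_odd; case: (odd n) => /=.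
    by rewrite expr1 mulN1r mulNr subrr.
  by rewrite expr0 mul1r mulr2n mulrDl mul1r.
have SE n : S n = \sum_(0 <= i < n) (exp_coeff x i + exp_coeff (- x) i).
  by rewrite /S /series /= big_split.
have S2 m : S m.*2 <= 2 * series (exp_coeff (x ^+ 2 / 2)) m.
  elim: m => [|m IH].
    by rewrite SE /series /= !big_geq // mulr0.
  rewrite SE doubleS !big_nat_recr //= -SE /series /= big_nat_recr //= mulrDr.
  rewrite -addrA; apply: lerD; first exact: IH.
  rewrite !termE /= odd_double /= addr0 ler_pM2l // /exp_coeff /=.
  rewrite expr_div_n -exprM mul2n -mulrA ler_wpM2l //.
    by rewrite -mul2n exprM exprn_ge0 // sqr_ge0.
  rewrite -invfM lef_pV2 ?posrE ?mulr_gt0 ?exprn_gt0 ?ltr0n ?fact_gt0 //.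
  by rewrite -natrX -natrM ler_nat double_factorial_ge.
rewrite -(cvg_lim (@norm_hausdorff _ _) cS); apply: limr_le; first exact: cvgP cS.
apply: nearW => n.
apply: (@le_trans _ _ (S n.*2)).
  rewrite !SE (@big_cat_nat _ _ _ n 0 n.*2) //= ?lerDl.
    by apply: sumr_ge0 => i _; rewrite termE; case: ifPn => // ei;
      rewrite mulr_ge0 // divr_ge0 // -(odd_double_half i) (negbTE ei) add0n
              -mul2n exprM exprn_ge0 // sqr_ge0.
  by rewrite -addnn leq_addr.
apply: (le_trans (S2 n)); rewrite ler_pM2l //.
have nd : nondecreasing_seq (series (exp_coeff (x ^+ 2 / 2))).
  by apply: nondecreasing_series => k _ _; rewrite exp_coeff_ge0 // divr_ge0 // sqr_ge0.
exact: (nondecreasing_cvgn_le nd (is_cvg_series_exp_coeff _)).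
Qed.

Definition sgb (b : bool) : R := if b then 1 else -1.

(** Rademacher expectations are finite averages, so that no measure theory enters before the
    empirical process. *)
Definition avg_signs n (F : {ffun 'I_n -> bool} -> R) : R :=
  (2 ^+ n)^-1 * \sum_s F s.

Definition signed_sum n (v : 'I_n -> R) (s : {ffun 'I_n -> bool}) : R :=
  \sum_i sgb (s i) * v i.

Lemma le_avg_signs n (F G : {ffun 'I_n -> bool} -> R) :
  (forall s, F s <= G s) -> avg_signs F <= avg_signs G.
Proof.
by move=> FG; rewrite ler_wpM2l ?invr_ge0 ?exprn_ge0 //; apply: ler_sum.
Qed.

Lemma avg_signsD n (F G : {ffun 'I_n -> bool} -> R) :
  avg_signs (fun s => F s + G s) = avg_signs F + avg_signs G.
Proof. by rewrite /avg_signs big_split mulrDr. Qed.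

Lemma avg_signsZ n (F : {ffun 'I_n -> bool} -> R) a :
  avg_signs (fun s => a * F s) = a * avg_signs F.
Proof. by rewrite /avg_signs -mulr_sumr mulrCA. Qed.

Lemma avg_signs_cst n a : avg_signs (fun _ : {ffun 'I_n -> bool} => a) = a.
Proof.
rewrite /avg_signs sumr_const card_ffun card_bool card_ord -[a *+ _]mulr_natl natrX.
by rewrite mulrA mulVf ?mul1r // expf_neq0.
Qed.

Lemma avg_signs_sum n (I : finType) (P : pred I) (F : I -> {ffun 'I_n -> bool} -> R) :
  avg_signs (fun s => \sum_(i | P i) F i s) = \sum_(i | P i) avg_signs (F i).
Proof. by rewrite /avg_signs exchange_big -mulr_sumr. Qed.

(** Independence of the signs is here the distributivity of a product over sums. *)
Lemma mgf_signed_sum n (v : 'I_n -> R) (l : R) :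
  avg_signs (fun s => expR (l * signed_sum v s)) <=
  expR (l ^+ 2 * (\sum_i v i ^+ 2) / 2).
Proof.
have -> : avg_signs (fun s => expR (l * signed_sum v s)) =
    \prod_i ((expR (l * v i) + expR (- (l * v i))) / 2).
  rewrite prodf_div prodr_const card_ord /avg_signs mulrC; congr (_ / _).
  transitivity (\sum_(s : {ffun 'I_n -> bool}) \prod_i expR (l * (sgb (s i) * v i))).
    apply: eq_bigr => s _; rewrite /signed_sum mulr_sumr.
    by rewrite (big_morph _ (@expRD R) (@expR0 R)).
  rewrite -(bigA_distr_bigA (fun i b => expR (l * (sgb b * v i)))).
  by apply: eq_bigr => i _; rewrite big_bool /= mul1r mulN1r mulrN.
rewrite mulr_sumr mulr_suml (big_morph _ (@expRD R) (@expR0 R)).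
apply: ler_prod => i _; rewrite divr_ge0 ?addr_ge0 ?expR_ge0 //=.
by rewrite ler_pdivrMr // [_ * 2]mulrC -exprMn expR_addN_le.
Qed.

(* Massart's finite class lemma; the maximum over [A] is expressed by an
   arbitrary choice of an element of [A] for each sign vector. *)
Lemma massart n (V : finType) (A : {set V}) (v : V -> 'I_n -> R) (r : R)
    (sel : {ffun 'I_n -> bool} -> V) :
  0 <= r -> (forall s, sel s \in A) ->
  (forall k, k \in A -> \sum_i v k i ^+ 2 <= r ^+ 2) ->
  avg_signs (fun s => `|signed_sum (v (sel s)) s|) <=
  r * Num.sqrt (2 * ln (2 * #|A|%:R)).
Proof.
move=> r0 selA hr.
have A1 : (1 <= #|A|)%N by apply/card_gt0P; exists (sel [ffun=> true]).
set lA := ln _.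
have A1R : 1 <= #|A|%:R :> R by rewrite ler1n.
have lA0 : 0 < lA by rewrite ln_gt0 //; lra.
have key l : 0 < l -> avg_signs (fun s => `|signed_sum (v (sel s)) s|) <=
    lA / l + l * r ^+ 2 / 2.
  move=> l0.
  have -> : lA / l + l * r ^+ 2 / 2 = (lA + l ^+ 2 * r ^+ 2 / 2) / l.
    by field; rewrite gt_eqF.
  rewrite ler_pdivlMr // mulrC -avg_signsZ.
  set a := lA + _.
  (* The tangent line of the exponential at [a] replaces Jensen's inequality. *)
  apply: (@le_trans _ _ (avg_signs (fun s => (a - 1) +
      expR (- a) * expR (l * `|signed_sum (v (sel s)) s|)))).
    apply: le_avg_signs => s; rewrite -expRD.
    have := expR_ge1Dx (- a + l * `|signed_sum (v (sel s)) s|); lra.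
  rewrite avg_signsD avg_signs_cst avg_signsZ.
  suff : avg_signs (fun s => expR (l * `|signed_sum (v (sel s)) s|)) <= expR a.
    move=> h; have : expR (- a) * expR a = 1 by rewrite -expRD addNr expR0.
    have := expR_ge0 (- a); nra.
  apply: (@le_trans _ _ (avg_signs (fun s => \sum_(k in A)
      (expR (l * signed_sum (v k) s) + expR (- l * signed_sum (v k) s))))).
    apply: le_avg_signs => s; rewrite (bigD1 (sel s)) //=.
    have h0 : 0 <= \sum_(i in A | i != sel s)
       (expR (l * signed_sum (v i) s) + expR (- l * signed_sum (v i) s)).
      by apply: sumr_ge0 => i _; rewrite addr_ge0 ?expR_ge0.
    have := expR_ge0 (l * signed_sum (v (sel s)) s).
    have := expR_ge0 (- l * signed_sum (v (sel s)) s).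
    case: (ger0P (signed_sum (v (sel s)) s)) => _; rewrite ?mulrN ?mulNr; lra.
  rewrite avg_signs_sum.
  apply: (@le_trans _ _ (\sum_(k in A) (2 * expR (l ^+ 2 * r ^+ 2 / 2)))).
    apply: ler_sum => k kA; rewrite avg_signsD mulr2n mulrDl mul1r.
    by apply: lerD; apply: (le_trans (mgf_signed_sum _ _)); rewrite ler_expR ?sqrrN;
      rewrite ler_pM2r // ler_wpM2l ?sqr_ge0 ?hr.
  rewrite sumr_const -[_ *+ _]mulr_natl mulrA /a expRD lnK ?posrE; last lra.
  by rewrite [_ * 2]mulrC.
case: (ltrgtP r 0) r0 => // [r_gt0|r_eq0] _; last first.
  rewrite r_eq0 in key *.
  rewrite mul0r; apply/ler_addgt0Pr => e e0; rewrite add0r.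
  (* For [r = 0] no [l] is optimal; this one makes the bound equal to [e]. *)
  apply: (le_trans (key (lA / e) _)); first by rewrite divr_gt0.
  by rewrite expr0n mulr0 mul0r addr0 invf_div mulrCA divff ?mulr1 // gt_eqF.
set q := Num.sqrt _.
have q0 : 0 < q by rewrite sqrtr_gt0 mulr_gt0.
have q2 : lA = q ^+ 2 / 2.
  by rewrite sqr_sqrtr ?mulr_ge0 // ?(ltW lA0) // mulrAC divff ?mul1r.
(* The optimal parameter: both terms of [key] become [r * q / 2]. *)
have := key (q / r) (divr_gt0 q0 r_gt0); rewrite q2.
by have -> : q ^+ 2 / 2 / (q / r) + q / r * r ^+ 2 / 2 = r * q
  by field; rewrite !gt_eqF.
Qed.

Lemma signed_sumB n (v w : 'I_n -> R) s :
  signed_sum (fun i => v i - w i) s = signed_sum v s - signed_sum w s.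
Proof. by rewrite /signed_sum -sumrB; apply: eq_bigr => i _; rewrite mulrBr. Qed.

(** AM-GM on each term. It bounds, for every sign vector, the remainder of a chain stopped at a
    finite level, which is only known to be small in mean square. *)
Lemma ler_norm_signed_sum n (v : 'I_n -> R) s t : 0 < t ->
  \sum_i v i ^+ 2 <= n%:R * t ^+ 2 -> `|signed_sum v s| <= n%:R * t.
Proof.
move=> t0 hv.
have h (e : R) : `|e| = 1 -> e * signed_sum v s <= n%:R * t.
  move=> e1; apply: (@le_trans _ _ (\sum_i (v i ^+ 2 / t + t) / 2)).
    rewrite mulr_sumr; apply: ler_sum => i _; rewrite mulrA.
    set f := e * _; have f2 : f ^+ 2 = 1.
      rewrite exprMn -(real_normK (num_real e)) e1 expr1n mul1r.
      by rewrite /sgb; case: (s i); rewrite ?sqrrN expr1n.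
    have -> : (v i ^+ 2 / t + t) / 2 = f * v i + (f * v i - t) ^+ 2 / t / 2.
      by have -> : v i ^+ 2 = (f * v i) ^+ 2; [rewrite exprMn f2 mul1r | field; rewrite gt_eqF].
    by rewrite lerDl !divr_ge0 ?sqr_ge0 // ltW.
  rewrite -mulr_suml big_split /= -mulr_suml sumr_const card_ord -[t *+ n]mulr_natl.
  have : (\sum_i v i ^+ 2) / t <= n%:R * t.
    by rewrite ler_pdivrMr // -mulrA.
  lra.
have [_|_] := ger0P; first by rewrite -[signed_sum _ _]mul1r h ?normr1.
by rewrite -mulN1r h ?normrN1.
Qed.

Lemma geometric_chain_sum (A B : R) K :
  A / 2 + \sum_(k < K) 2^-1 ^+ k.+1 * (A + B * k.+1%:R) =
  3 / 2 * A + 2 * B - 2^-1 ^+ K * (A + B * (K%:R + 2)).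
Proof.
elim: K => [|K IH]; first by rewrite big_ord0 expr0; lra.
by rewrite big_ord_recr /= addrA IH exprS -natr1; field.
Qed.

(** A link joins [u] in the net of level [K + 1] to [rep K u], so it is determined by its finer end:
    Massart's lemma pays for one net per link, and the nets need not be nested. Radii halve while
    the root entropy [A + B k] grows linearly, so the sum converges to [3/2 A + 2 B]. *)
Lemma chaining n (V : finType) (v : V -> 'I_n -> R) (D A B : R)
    (rep : nat -> V -> V) (sel : {ffun 'I_n -> bool} -> V) : (0 < n)%N ->
  0 <= D -> 0 <= A -> 0 <= B ->
  (forall u i, `|v u i| <= 1 / 2) ->
  (forall k u, \sum_i (v u i - v (rep k u) i) ^+ 2 <=
     n%:R * (2^-1 ^+ k.+1) ^+ 2) ->
  (forall k, ln (2 * #|[set rep k u | u : V]|%:R) <= D * (A + B * k%:R) ^+ 2 / 2) ->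
  avg_signs (fun s => n%:R^-1 * `|signed_sum (v (sel s)) s|) <=
  (3 / 2 * A + 2 * B) * Num.sqrt (D / n%:R).
Proof.
move=> n0 D0 A0 B0 v1 hrep hN.
have nR : 0 < n%:R :> R by rewrite ltr0n.
have sn : 0 < Num.sqrt n%:R :> R by rewrite sqrtr_gt0.
set q := Num.sqrt (D / n%:R).
have qE : Num.sqrt n%:R * Num.sqrt D = n%:R * q.
  rewrite /q sqrtrM // sqrtrV ?ler0n //.
  by rewrite -{2}(@sqr_sqrtr _ n%:R) ?ler0n //; field; rewrite gt_eqF.
have mas k (w : V -> 'I_n -> R) (r : R) (sl : {ffun 'I_n -> bool} -> V) : 0 <= r ->
    (forall s, sl s \in [set rep k u | u : V]%SET) ->
    (forall u, \sum_i w u i ^+ 2 <= n%:R * r ^+ 2) ->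
    avg_signs (fun s => n%:R^-1 * `|signed_sum (w (sl s)) s|) <=
    r * (A + B * k%:R) * q.
  move=> r0 hsl hw; rewrite avg_signsZ mulrC ler_pdivrMr //.
  apply: (le_trans (@massart _ _ _ w (Num.sqrt n%:R * r) sl _ hsl _)).
  - by rewrite mulr_ge0 // ltW.
  - by move=> u _; rewrite exprMn sqr_sqrtr ?ler0n.
  have -> : r * (A + B * k%:R) * q * n%:R = Num.sqrt n%:R * r * (Num.sqrt D * (A + B * k%:R)).
    by rewrite [RHS]mulrACA qE; ring.
  rewrite ler_wpM2l ?mulr_ge0 ?(ltW sn) //.
  have ABk : 0 <= A + B * k%:R by rewrite addr_ge0 ?mulr_ge0.
  rewrite -[X in _ <= _ * X]ger0_norm // -sqrtr_sqr -sqrtrM // ler_wsqrtr //.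
  by have := hN k; lra.
have main K : forall sl, (forall s, sl s \in [set rep K u | u : V]%SET) ->
    avg_signs (fun s => n%:R^-1 * `|signed_sum (v (sl s)) s|) <=
    (A / 2 + \sum_(k < K) 2^-1 ^+ k.+1 * (A + B * k.+1%:R)) * q.
  elim: K => [|K IH] sl hsl.
    rewrite big_ord0 addr0; apply: (le_trans (mas 0 v (1/2) sl _ hsl _)) => //.
      move=> u; apply: (@le_trans _ _ (\sum_(i < n) (1 / 2) ^+ 2)).
        by apply: ler_sum => i _; rewrite -real_normK ?num_real // lerXn2r ?nnegrE.
      by rewrite sumr_const card_ord -[_ *+ n]mulr_natl.
    by rewrite mulr0 addr0 [1 / 2 * A]mulrC mul1r.
  rewrite big_ord_recr /= addrA mulrDl.
  apply: (@le_trans _ _ (avg_signs (fun s =>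
    n%:R^-1 * `|signed_sum (v (rep K (sl s))) s| +
    n%:R^-1 * `|signed_sum (fun i => v (sl s) i - v (rep K (sl s)) i) s|))).
    apply: le_avg_signs => s; rewrite -mulrDr ler_wpM2l ?invr_ge0 ?ler0n //.
    by rewrite signed_sumB; apply: le_trans (ler_normD _ _); rewrite addrC subrK.
  rewrite avg_signsD lerD //.
    by apply: IH => s; apply: imset_f.
  apply: (mas K.+1 (fun u i => v u i - v (rep K u) i) (2^-1 ^+ K.+1) sl _ hsl) => //.
(* [sel] need not take its values in any net, so one uncounted link of size [2^-(K+1)] is added,
   which vanishes as [K] grows. *)
have {main} h : forall K, avg_signs (fun s => n%:R^-1 * `|signed_sum (v (sel s)) s|) <=
    (3 / 2 * A + 2 * B) * q + 2^-1 ^+ K.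
  move=> K; apply: (@le_trans _ _ (avg_signs (fun s : {ffun 'I_n -> bool} =>
    n%:R^-1 * `|signed_sum (v (rep K (sel s))) s| + 2^-1 ^+ K.+1))).
    apply: le_avg_signs => s.
    apply: (@le_trans _ _ (n%:R^-1 * `|signed_sum (v (rep K (sel s))) s| +
       n%:R^-1 * `|signed_sum (fun i => v (sel s) i - v (rep K (sel s)) i) s|)).
      rewrite -mulrDr ler_wpM2l ?invr_ge0 ?ler0n //.
      by rewrite signed_sumB; apply: le_trans (ler_normD _ _); rewrite addrC subrK.
    rewrite lerD2l mulrC ler_pdivrMr // mulrC ler_norm_signed_sum //.
  rewrite avg_signsD avg_signs_cst lerD //.
    apply: (le_trans (main K _ _)); first by move=> s; apply: imset_f.
    rewrite geometric_chain_sum ler_wpM2r ?sqrtr_ge0 // gerBl.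
    by rewrite mulr_ge0 ?exprn_ge0 ?addr_ge0 ?mulr_ge0 ?addr_ge0 ?ler0n.
  by rewrite exprS ler_piMl ?exprn_ge0 // invf_le1 // ler1n.
apply/ler_addgt0Pr => e e0.
have [K hK] : exists K, 2^-1 ^+ K <= e :> R.
  have h2 : `|2^-1 : R| < 1 by rewrite ger0_norm // invf_lt1 // ltr1n.
  have [K _ hK] : \forall k \near \oo, `|(2^-1 : R) ^+ k| <= e.
    by apply: cvgr0_norm_le e0; exact: cvg_expr.
  by exists K; have := hK K (leqnn K); rewrite ger0_norm // exprn_ge0.
by apply: (le_trans (h K)); rewrite lerD2l.
Qed.
End rademacher.

(** * Covering the local class of transport potentials *)

Section label_counting.
Context {R : realType}.

(** Turns a labelling into a cover: one element is elected per label that occurs, so counting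
    centres is counting labels. *)
Lemma exists_representative (V : finType) (K : eqType) (lab : V -> K) :
  exists rep : V -> V, (forall v, lab (rep v) = lab v) /\
    {in [set rep v | v : V]%SET &, injective lab}.
Proof.
exists (fun v => odflt v [pick u | lab u == lab v]).
have repE v : lab (odflt v [pick u | lab u == lab v]) = lab v.
  by case: pickP => //= u /eqP.
split=> // u v /imsetP[u' _ ->] /imsetP[v' _ ->]; rewrite !repE => E.
rewrite E; case: pickP => //= /(_ u'); by rewrite E eqxx.
Qed.

(* Each coordinate [(b, k)] of a label gets the weight
   [1/2 * 1/(1+s) * (s/(1+s))^k]; these weights sum to at most 1 and every label
   in [A] weighs at least the inverse of the bound. *)
Lemma card_lattice_labels (V J : finType) (A : {set V})
    (lab : V -> {ffun J -> bool * nat}) (s : J -> R) :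
  (forall j, 0 < s j) -> {in A &, injective lab} ->
  (forall u, u \in A -> \sum_j (lab u j).2%:R / s j <= #|J|%:R) ->
  #|A|%:R <= \prod_j (2 * expR 1 * (1 + s j)).
Proof.
move=> s0 injA hA.
pose w j (b : bool * nat) : R := (2 * (1 + s j))^-1 * (s j / (1 + s j)) ^+ b.2.
have s1 j : 0 < 1 + s j by rewrite addr_gt0.
have w0 j b : 0 <= w j b.
  by rewrite mulr_ge0 ?exprn_ge0 ?divr_ge0 ?invr_ge0 ?mulr_ge0 // ltW.
(* The labels that occur are bounded, so the weights can be summed over a finite type. *)
have [B hB] : exists B, forall u j, ((lab u j).2 < B)%N.
  exists (\max_(uj : V * J) (lab uj.1 uj.2).2).+1 => u j.
  by rewrite ltnS (leq_bigmax (u, j)).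
pose lb u : {ffun J -> bool * 'I_B} := [ffun j => ((lab u j).1, Ordinal (hB u j))].
have lbI : {in A &, injective lb}.
  move=> u v uA vA E; apply: injA => //; apply/ffunP => j.
  move/ffunP: E => /(_ j); rewrite !ffunE => -[]; case: (lab u j) (lab v j) => a b [a' b'] /=.
  by move=> -> ->.
have sumw j : \sum_(b : bool * 'I_B) w j (b.1, val b.2) <= 1.
  rewrite -(pair_big xpredT xpredT (fun b (k : 'I_B) => w j (b, val k))) /= big_bool /=.
  rewrite -mulr2n -mulr_natl -mulr_sumr mulrA.
  set q := s j / (1 + s j).
  have q1 : 1 - q = (1 + s j)^-1 by rewrite /q; field; rewrite gt_eqF.
  have -> : 2 / (2 * (1 + s j)) = 1 - q by rewrite q1; field; rewrite gt_eqF.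
  rewrite -opprB mulNr -subrX1 opprB lerBlDr lerDl exprn_ge0 // divr_ge0 // ltW //.
(* Since [(1 + 1/s)^k <= exp (k/s)], and the budget bounds the sum of the [k/s] by [#|J|], the
   geometric factors cost at most one factor [e] per coordinate. *)
have lowb u : u \in A -> (\prod_j (2 * expR 1 * (1 + s j)))^-1 <= \prod_j w j (lab u j).
  move=> uA; rewrite -prodfV.
  apply: (@le_trans _ _ (\prod_j ((2 * (1 + s j))^-1 * expR (- ((lab u j).2%:R / s j))))).
    rewrite big_split /= -(big_morph _ (@expRD R) (@expR0 R)) sumrN.
    rewrite (eq_bigr (fun j => (expR 1)^-1 * (2 * (1 + s j))^-1)); last first.
      by move=> j _; rewrite mulrAC invfM mulrC.
    rewrite big_split /= mulrC ler_wpM2l ?prodr_ge0 // => [j _|].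
      by rewrite invr_ge0 mulr_ge0 // ltW.
    by rewrite prodr_const exprVn -expRM_natr mul1r -expRN ler_expR lerN2 hA.
  apply: ler_prod => j _; rewrite mulr_ge0 ?invr_ge0 ?expR_ge0 ?mulr_ge0 ?(ltW (s1 j)) //=.
  rewrite ler_wpM2l ?invr_ge0 ?mulr_ge0 ?(ltW (s1 j)) //.
  rewrite -mulrN mulrC expRM_natr lerXn2r ?nnegrE ?expR_ge0 ?divr_ge0 ?(ltW (s1 j)) ?(ltW (s0 j)) //.
  rewrite expRN -[X in _ <= X]invf_div lef_pV2 ?posrE ?expR_gt0 ?divr_gt0 //.
  by rewrite mulrDl mul1r divff ?gt_eqF // addrC expR_ge1Dx.
have Wgt0 : 0 < \prod_j (2 * expR 1 * (1 + s j)).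
  by apply: prodr_gt0 => j _; rewrite !mulr_gt0 ?expR_gt0.
rewrite -[leRHS]mul1r -ler_pdivrMr //.
apply: (@le_trans _ _ (\sum_(u in A) \prod_j w j (lab u j))).
  set W := \prod_j _ in lowb *.
  have -> : #|A|%:R / W = \sum_(u in A) W^-1 by rewrite sumr_const mulr_natl.
  by apply: ler_sum => u; exact: lowb.
apply: (@le_trans _ _ (\sum_(u in A) \prod_j w j ((lb u j).1, val (lb u j).2))).
  apply: ler_sum => u _; apply: ler_prod => j _.
  by rewrite w0 /= ffunE /=; case: (lab u j).
rewrite -(big_imset (fun l : {ffun J -> bool * 'I_B} => \prod_j w j ((l j).1, val (l j).2)) lbI).
apply: (@le_trans _ _ (\sum_(l : {ffun J -> bool * 'I_B})
    \prod_j w j ((l j).1, val (l j).2))).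
  rewrite [leRHS](bigID (fun l => l \in (lb @: A)%SET)) /= lerDl.
  by apply: sumr_ge0 => l _; apply: prodr_ge0.
rewrite -(bigA_distr_bigA (fun j (b : bool * 'I_B) => w j (b.1, val b.2))) /=.
apply: prodr_ile1 => j _; rewrite sumw andbT.
by apply: sumr_ge0.
Qed.
End label_counting.

(** * Lattice cells for vectors *)

Section cells.
Context {R : realType}.

Lemma truncn_eq_dist (x y h : R) : 0 < h -> 0 <= x -> 0 <= y ->
  Num.truncn (x / h) = Num.truncn (y / h) -> `|x - y| <= h.
Proof.
move=> h0 x0 y0 E.
have /andP[] := truncn_itv (divr_ge0 x0 (ltW h0)).
have /andP[] := truncn_itv (divr_ge0 y0 (ltW h0)).
rewrite E -!natr1 ler_pdivlMr // ltr_pdivrMr // ler_pdivlMr // ltr_pdivrMr // => *.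
rewrite ler_norml; lra.
Qed.

(** The sign is kept apart so that the integer is at most [|t| / g], the quantity charged to the
    label budget. *)
Definition signed_label (g t : R) : bool * nat := (0 <= t, Num.truncn (`|t| / g)).

Lemma signed_label_dist (x y g : R) : 0 < g ->
  signed_label g x = signed_label g y -> `|x - y| <= g.
Proof.
move=> g0 [sE tE].
have := truncn_eq_dist g0 (normr_ge0 x) (normr_ge0 y) tE.
move: sE; case: (ger0P x) => x0; case: (ger0P y) => y0; rewrite ?x0 ?y0 // => _.
by rewrite -opprD normrN.
Qed.

Lemma truncn_le_id (x : R) : 0 <= x -> (Num.truncn x)%:R <= x.
Proof. by rewrite truncn_le. Qed.

(** The step [rho / sqrt d] gives cells of diameter [rho]. The [sqrt d] lost there and the one from
    comparing the two norms multiply to [d]: the charge is [enorm x / rho] per coordinate, in every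
    dimension. *)
Lemma sum_signed_label d (x : 'rV[R]_d) (rho : R) : 0 < rho -> (0 < d)%N ->
  \sum_k (signed_label (rho / Num.sqrt d%:R) (x 0 k)).2%:R <= d%:R * (enorm x / rho).
Proof.
move=> rho0 d0; have sd : 0 < Num.sqrt d%:R :> R by rewrite sqrtr_gt0 ltr0n.
apply: (@le_trans _ _ (\sum_k `|x 0 k| / (rho / Num.sqrt d%:R))).
  by apply: ler_sum => k _; rewrite /= truncn_le_id // !divr_ge0 // ltW.
rewrite -mulr_suml invf_div !mulrA ler_pM2r ?invr_gt0 // mulrC.
rewrite -{2}(@sqr_sqrtr _ d%:R) ?ler0n // expr2 -mulrA ler_pM2l //.
exact: sum_norm_le_enorm.
Qed.

Lemma signed_label_enorm d (x y : 'rV[R]_d) (rho : R) : 0 < rho -> (0 < d)%N ->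
  (forall k, signed_label (rho / Num.sqrt d%:R) (x 0 k) =
             signed_label (rho / Num.sqrt d%:R) (y 0 k)) ->
  enorm (x - y) <= rho.
Proof.
move=> rho0 d0 E; have sd : 0 < Num.sqrt d%:R :> R by rewrite sqrtr_gt0 ltr0n.
have g0 : 0 < rho / Num.sqrt d%:R by rewrite divr_gt0.
have := @enorm_le_coord R d (x - y) (rho / Num.sqrt d%:R) (ltW g0).
have -> : Num.sqrt d%:R * (rho / Num.sqrt d%:R) = rho by rewrite mulrC divfK ?gt_eqF.
apply => k.
by rewrite !mxE; exact: signed_label_dist (E k).
Qed.

End cells.

(** * Cover of the local class at one resolution *)

Section local_cover.
Context {R : realType}.
Variables (V : finType) (N d n : nat) (p : R).
Variables (xi : 'I_n -> 'rV[R]_d) (beta : V -> 'I_N -> 'rV[R]_d).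
Variables (e psi : V -> 'I_N -> R) (j : V -> 'I_N).
Variables (c : V -> 'I_N -> 'I_n -> R) (f : V -> 'I_n -> R) (sigma : R).

Hypothesis n_gt0 : (0 < n)%N.
Hypothesis d_gt0 : (0 < d)%N.
Hypothesis p_ge1 : 1 <= p.
Hypothesis sigma_gt0 : 0 < sigma.
Hypothesis sigma_le : sigma <= 1 / 4.
Hypothesis c01 : forall v a i, 0 <= c v a i <= 1.
Hypothesis psi_bd : forall v a, -1 <= psi v a <= 0.
Hypothesis psi_j : forall v, psi v (j v) = 0.
Hypothesis f_le : forall v a i, f v i <= c v a i - psi v a.
Hypothesis f_att : forall v i, exists a, f v i = c v a i - psi v a.
Hypothesis e_ge0 : forall v a, 0 <= e v a.

Let L : R := - ln sigma.

Hypothesis localized : forall v a i, sigma <= c v (j v) i -> sigma <= c v a i ->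
  enorm (xi i - beta v a) ^+ 2 <= 4 * L / p /\ e v a <= 2 * L / p.
Hypothesis lipschitz : forall u v a i, sigma <= c u a i \/ sigma <= c v a i ->
  `|c u a i - c v a i| <= p / sigma * (`|e u a - e v a| +
    `|enorm (xi i - beta u a) ^+ 2 - enorm (xi i - beta v a) ^+ 2| / 2).

Let S v : {set 'I_n} := [set i | sigma <= c v (j v) i]%SET.
(** Chosen so that [sigma^2 + 2 m = (2 sigma)^2]: two light potentials differ by at most [sigma] off
    their sets [S], and by at most 1 on them. *)
Let m : R := 3 / 2 * sigma ^+ 2.
Let heavy v := m * n%:R <= #|S v|%:R.
Let r : R := Num.sqrt (4 * L / p).
(** A cost may move by [sigma / 2], so the parameters by [sigma^2 / (2 p)] in all. With these steps
    [he], [r rho] and [rho^2 / 2] use at most the shares 1/8, 1/3 and 1/24 of [sigma^2 / p], of sum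
    1/2. The ratio [r / rho = 12 L / sigma^2] is free of [p]. *)
Let rho : R := sigma ^+ 2 / (3 * p * r).
Let he : R := sigma ^+ 2 / (8 * p).
Let hpsi : R := sigma / 2.
(** Only for these atoms does localisation bound the parameters; any other atom costs less than
    [sigma] all over [S v], so its position need not be recorded. *)
Let rel v a := [exists i in S v, sigma <= c v a i].
Let b0 v := beta v (j v).

Let p0 : 0 < p. Proof. exact: lt_le_trans p_ge1. Qed.

Let L_ge : 3 / 4 <= L.
Proof.
rewrite /L lerNr.
have := @le_ln1Dx R (sigma - 1); rewrite subrKC => h.
by apply: (le_trans (h _)); move: sigma_le sigma_gt0; lra.
Qed.

Let r_gt0 : 0 < r.
Proof. by rewrite sqrtr_gt0 divr_gt0 // mulr_gt0 //; move: L_ge; lra. Qed.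

Let rr : r ^+ 2 = 4 * L / p.
Proof. by rewrite sqr_sqrtr // ltW // -sqrtr_gt0. Qed.

Let rho_gt0 : 0 < rho.
Proof. by rewrite divr_gt0 ?exprn_gt0 // !mulr_gt0. Qed.
Let he_gt0 : 0 < he.
Proof. by rewrite divr_gt0 ?exprn_gt0 // !mulr_gt0. Qed.
Let hpsi_gt0 : 0 < hpsi.
Proof. by rewrite divr_gt0. Qed.
Let m_gt0 : 0 < m.
Proof. by rewrite mulr_gt0 ?exprn_gt0. Qed.

Let S_neq0 v : heavy v -> exists i, i \in S v.
Proof.
move=> hv; apply/finset.set0Pn; rewrite -card_gt0 -(ltr0n R).
by apply: lt_le_trans hv; rewrite mulr_gt0 // ltr0n.
Qed.

Let close v a i : i \in S v -> sigma <= c v a i -> enorm (xi i - beta v a) <= r.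
Proof.
rewrite inE => h1 h2; rewrite enorm_le ?(ltW r_gt0) // -sqr_enorm rr.
by have [] := localized h1 h2.
Qed.

Let f_ge0 v i : 0 <= f v i.
Proof.
have [a ->] := f_att v i; have /andP[? _] := c01 v a i; have /andP[_ ?] := psi_bd v a; lra.
Qed.

Let f_le1 v i : f v i <= 1.
Proof. by apply: (le_trans (f_le v (j v) i)); rewrite psi_j subr0; case/andP: (c01 v (j v) i). Qed.

Let f_small v i : i \notin S v -> f v i <= sigma.
Proof.
rewrite inE -ltNge => h; apply: (le_trans (f_le v (j v) i)).
by rewrite psi_j subr0 ltW.
Qed.

Let close_costs u v a i : i \in S u -> sigma <= c u a i ->
  `|e u a - e v a| <= he -> enorm (beta u a - beta v a) <= rho ->
  `|c u a i - c v a i| <= sigma / 2.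
Proof.
move=> iS cs ee bb.
apply: (le_trans (lipschitz (or_introl cs))).
have xr := close iS cs.
have : `|enorm (xi i - beta u a) ^+ 2 - enorm (xi i - beta v a) ^+ 2| / 2 <=
    r * rho + rho ^+ 2 / 2.
  set A := xi i - beta u a; set B := beta u a - beta v a.
  have -> : xi i - beta v a = A + B by rewrite /A /B subrKA.
  have -> : enorm A ^+ 2 - enorm (A + B) ^+ 2 = - (2 * edot A B + enorm B ^+ 2).
    by rewrite sqr_enormD; ring.
  rewrite normrN.
  have AB : `|edot A B| <= r * rho.
    by apply: (le_trans (norm_edot_le _ _)); rewrite ler_pM ?enorm_ge0.
  have BB : enorm B ^+ 2 <= rho ^+ 2 by rewrite lerXn2r ?nnegrE ?enorm_ge0 // ltW.
  have BB0 := sqr_ge0 (enorm B).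
  have : `|2 * edot A B + enorm B ^+ 2| <= 2 * (r * rho) + rho ^+ 2.
    apply: (le_trans (ler_normD _ _)); rewrite normrM (ger0_norm (ler0n _ 2)) (ger0_norm BB0).
    by apply: lerD => //; rewrite ler_pM2l.
  lra.
set t := _ / 2 => ht.
rewrite -ler_pdivlMl ?divr_gt0 //.
have -> : (p / sigma)^-1 * (sigma / 2) = sigma ^+ 2 / (2 * p).
  by field; rewrite !gt_eqF.
have rrho : r * rho = sigma ^+ 2 / (3 * p).
  by rewrite /rho; field; rewrite !gt_eqF.
have rho2 : rho ^+ 2 = sigma ^+ 2 / p * (sigma ^+ 2 / (36 * L)).
  rewrite /rho expr_div_n !exprMn rr; field.
  by rewrite !gt_eqF //; move: L_ge; lra.
have : rho ^+ 2 <= sigma ^+ 2 / p * (1 / 12).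
  rewrite rho2 ler_wpM2l ?divr_ge0 ?sqr_ge0 ?(ltW p0) //.
  rewrite ler_pdivrMr; last by move: L_ge; lra.
  by move: L_ge sigma_le sigma_gt0; nra.
have -> : sigma ^+ 2 / (2 * p) = sigma ^+ 2 / p * (1 / 2) by field; rewrite gt_eqF.
move: ht ee; rewrite rrho /he.
have -> : sigma ^+ 2 / (3 * p) = sigma ^+ 2 / p * (1 / 3) by field; rewrite gt_eqF.
have -> : sigma ^+ 2 / (8 * p) = sigma ^+ 2 / p * (1 / 8) by field; rewrite gt_eqF.
lra.
Qed.

Let heavy_close u v : heavy u -> heavy v ->
  (forall a, rel u a = rel v a) ->
  (forall a, rel u a -> rel v a -> `|e u a - e v a| <= he /\ enorm (beta u a - beta v a) <= rho) ->
  (forall a, `|psi u a - psi v a| <= hpsi) ->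
  forall i, f u i - f v i <= 2 * sigma.
Proof.
move=> hu hv relE eb pp i.
have ppE a : - hpsi <= psi u a - psi v a <= hpsi by rewrite -ler_norml.
have [iu|iu] := boolP (i \in S u); last first.
  have := f_small iu; have := f_ge0 v i; have := sigma_gt0; lra.
have cmp a : sigma <= c u a i -> rel v a -> c u a i - c v a i <= sigma / 2.
  move=> cs rv; have ru : rel u a by apply/existsP; exists i; rewrite iu.
  have [h1 h2] := eb a ru rv.
  exact: le_trans (ler_norm _) (close_costs iu cs h1 h2).
have [iv|iv] := boolP (i \in S v).
  have [a fE] := f_att v i.
  have := f_le u a i; rewrite fE; have /andP[h1 h2] := ppE a; move: h1 h2; rewrite /hpsi => h1 h2.
  have /andP[cv0 _] := c01 v a i.
  have [cs|cs] := leP sigma (c u a i); last by move: sigma_gt0; lra.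
  have ru : rel u a by apply/existsP; exists i; rewrite iu.
  have := cmp a cs; rewrite -relE => /(_ ru); have := sigma_gt0; lra.
(* Here [i] lies in [S u] but not in [S v]. Heaviness makes the base atom of [v] relevant, and
   comparing there gives [f u i <= sigma + sigma / 2 + hpsi], which is [2 sigma]. *)
have [i' i'v] := S_neq0 hv.
have rv : rel v (j v) by apply/existsP; exists i'; rewrite i'v; move: i'v; rewrite inE.
have := f_le u (j v) i; have /andP[h1 h2] := ppE (j v); move: h1 h2; rewrite /hpsi psi_j => h1 h2.
have := f_ge0 v i.
move: (iv); rewrite inE -ltNge => cv.
have [cs|cs] := leP sigma (c u (j v) i); last by move: sigma_gt0; lra.
have := cmp _ cs rv; lra.
Qed.

Let light_close u v : ~~ heavy u -> ~~ heavy v ->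
  \sum_i (f u i - f v i) ^+ 2 <= n%:R * (2 * sigma) ^+ 2.
Proof.
rewrite /heavy -!ltNge => hu hv.
apply: (@le_trans _ _ (\sum_i (sigma ^+ 2 + ((i \in S u)%:R + (i \in S v)%:R)))).
  apply: ler_sum => i _.
  have := f_ge0 u i; have := f_ge0 v i; have := f_le1 u i; have := f_le1 v i.
  have s2 := sqr_ge0 sigma.
  have [iu|/f_small iu] := boolP (i \in S u); have [iv|/f_small iv] := boolP (i \in S v);
    rewrite /= ?add0r ?addr0; move: sigma_gt0; nra.
rewrite !big_split /= sumr_const card_ord -!natr_sum -[X in X + _]mulr_natl.
have cE (A : {set 'I_n}) : (\sum_(i < n) (i \in A))%N = #|A|.
  by rewrite -sum1_card [RHS]big_mkcond /=; apply: eq_bigr => i _; case: (i \in A).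
by rewrite !cE; move: hu hv; rewrite /m; lra.
Qed.

Let disjoint_heavy (C : {set V}) := [forall u in C, heavy u] &&
  [forall u in C, forall v in C, (u != v) ==> [disjoint S u & S v]].

(** Each [S u] holds a share at least [m] of the sample, and no sample point is counted twice. *)
Let card_disjoint_heavy C : disjoint_heavy C -> #|C|%:R <= m^-1.
Proof.
move=> /andP[/forallP hC /forallP dC].
rewrite -[leRHS]mul1r ler_pdivlMr // -(@ler_pM2r _ n%:R) ?ltr0n // mul1r -mulrA.
apply: (@le_trans _ _ (\sum_(u in C) #|S u|%:R)).
  by rewrite mulr_natl -sumr_const; apply: ler_sum => u uC; have := hC u; rewrite uC.
rewrite -natr_sum ler_nat.
rewrite (eq_bigr (fun u => \sum_(i < n) (if i \in S u then 1 else 0))%N); last first.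
  by move=> u _; rewrite -sum1_card big_mkcond.
rewrite exchange_big /= -[leqRHS]card_ord -sum1_card; apply: leq_sum => i _.
rewrite -big_mkcondr /= sum1_card.
apply/card_le1_eqP => u v hu hv.
have /andP[uC iu] : (u \in C) && (i \in S u) := hu.
have /andP[vC iv] : (v \in C) && (i \in S v) := hv.
apply/eqP; apply: contraT => uv; have := dC v; rewrite vC /= => /forallP/(_ u).
by rewrite uC uv /= => /pred0P/(_ i); rewrite /= iu iv.
Qed.

(* Off [S v] the potential lies between [0] and [sigma] whatever the atoms are.
   If [S v] is a small fraction of the sample, one cell suffices; otherwise
   [beta v (j v)] is at distance at most [r] from many sample points, so a
   maximal disjoint family gives boundedly many centres, around which a lattice
   of step [rho] labels the relevant atoms. *)
Lemma local_cover : exists rep : V -> V,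
  (forall u, \sum_i (f u i - f (rep u) i) ^+ 2 <= n%:R * (2 * sigma) ^+ 2) /\
  #|[set rep u | u : V]%SET|%:R <= 1 + m^-1 *
    ((2 * expR 1 * (1 + 48 * L / sigma ^+ 2)) ^+ d *
     (2 * expR 1 * (1 + 16 * L / sigma ^+ 2)) *
     (2 * expR 1 * (1 + 2 / sigma))) ^+ N.
Proof.
have disj0 : disjoint_heavy finset.set0.
  by apply/andP; split; apply/forallP => u; rewrite inE.
have [C /maxsetP[dC maxC] _] := maxset_exists disj0.
(* By maximality of [C] the set [S v] of a heavy [v] meets some [S u] with [u] in [C]; the common
   sample point ties the atoms of [v] to the base atom of [u]. *)
pose cen v := odflt v [pick u in C | ~~ [disjoint S u & S v]].
have cenP v : heavy v -> cen v \in C /\ exists2 i, i \in S (cen v) & i \in S v.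
  move=> hv; rewrite /cen; case: pickP => [u /andP[uC]|] /=.
    rewrite -finset.setI_eq0 => /finset.set0Pn[i]; rewrite inE => /andP[? ?]; split => //; by exists i.
  move=> nC; have [i iv] := S_neq0 hv.
  suff vC : v \in C.
    by have := nC v; rewrite vC /= => /negbT; rewrite negbK => /pred0P/(_ i); rewrite /= iv.
  suff <- : (v |: C)%SET = C by rewrite !inE eqxx.
  apply: maxC; last exact: finset.subsetUr.
  have nC' u : u \in C -> ([disjoint S u & S v])%bool.
    by move=> uC; have := nC u; rewrite uC => /negbT; rewrite negbK.
  move/andP: dC => [/forallP hC /forallP dC]; apply/andP; split.
    apply/forallP => u; apply/implyP; rewrite finset.in_setU1 => /predU1P[->//|uC].
    by have := hC u; rewrite uC.
  apply/forallP => u; apply/implyP => uC; apply/forallP => w; apply/implyP => wC.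
  apply/implyP => uw; move: uC wC; rewrite !finset.in_setU1.
  move=> /predU1P[uE|uC] /predU1P[wE|wC].
  - by rewrite uE wE eqxx in uw.
  - by rewrite uE disjoint_sym nC'.
  - by rewrite wE nC'.
  - by have := dC u; rewrite uC => /forallP/(_ w); rewrite wC uw.
pose J := ('I_N * 'I_d + ('I_N + 'I_N))%type.
(* The free boolean of the second block stores relevance; irrelevant atoms get the integer 0, which
   charges nothing to the budget. *)
pose lat v (x : J) : bool * nat := match x with
  | inl ak => if rel v ak.1 then
      signed_label (rho / Num.sqrt d%:R) ((beta v ak.1 - b0 (cen v)) 0 ak.2) else (true, 0%N)
  | inr (inl a) => (rel v a, if rel v a then Num.truncn (e v a / he) else 0%N)
  | inr (inr a) => (true, Num.truncn (- psi v a / hpsi))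
  end.
pose lab v : option V * {ffun J -> bool * nat} :=
  if heavy v then (Some (cen v), [ffun x => lat v x]) else (None, [ffun=> (true, 0%N)]).
have [rep [labE labI]] := exists_representative lab.
exists rep; split=> [u|].
  have := labE u; rewrite /lab.
  have [hu|lu] := boolP (heavy u); have [hv|lv] := boolP (heavy (rep u)) => // E; last exact: light_close.
  case: E => cE /ffunP lE; set v := rep u in hv cE lE *.
  have latE x : lat v x = lat u x by have := lE x; rewrite !ffunE.
  have relE a : rel u a = rel v a by have := latE (inr (inl a)) => -[->].
  have eb a : rel u a -> rel v a ->
      `|e u a - e v a| <= he /\ enorm (beta u a - beta v a) <= rho.
    move=> ru rv; split.
      have := latE (inr (inl a)); rewrite /lat /= ru rv => -[] /esym.
      exact: truncn_eq_dist.
    have -> : beta u a - beta v a = (beta u a - b0 (cen u)) - (beta v a - b0 (cen v)).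
      by rewrite cE opprB addrA subrK.
    apply: signed_label_enorm => // k.
    by have := latE (inl (a, k)); rewrite /lat /= ru rv => ->.
  have pp a : `|psi u a - psi v a| <= hpsi.
    have := latE (inr (inr a)); rewrite /lat /= => -[] /esym E.
    have nn w : 0 <= - psi w a by rewrite oppr_ge0; case/andP: (psi_bd w a).
    have := truncn_eq_dist hpsi_gt0 (nn u) (nn v) E.
    by rewrite -opprD normrN.
  have h1 := heavy_close hu hv relE eb pp.
  have h2 i : f v i - f u i <= 2 * sigma.
    apply: (heavy_close hv hu) => [a|a rv ru|a].
    - by rewrite relE.
    - by rewrite distrC enorm_distC; exact: eb.
    - by rewrite distrC.
  apply: (@le_trans _ _ (\sum_(i < n) (2 * sigma) ^+ 2)); last first.
    by rewrite sumr_const card_ord -[X in X <= _]mulr_natl.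
  apply: ler_sum => i _; rewrite -real_normK ?num_real // lerXn2r ?nnegrE //.
    by rewrite mulr_ge0 // ltW.
  by rewrite ler_norml; have := h1 i; have := h2 i; lra.
set Rp := [set rep u | u : V]%SET in labI *.
pose H := [set u in Rp | heavy u]%SET.
have cardRp : (#|Rp| <= 1 + #|H|)%N.
  rewrite -(cardsID [set u | heavy u]%SET Rp) addnC leq_add //.
    apply/card_le1_eqP => u v; rewrite !inE => /andP[lu uR] /andP[lv vR].
    by apply: labI => //; rewrite /lab (negbTE lu) (negbTE lv).
  by apply: subset_leq_card; apply/fintype.subsetP => u; rewrite !inE.
apply: (@le_trans _ _ (1 + #|H|%:R)); first by rewrite -(natrD _ 1) ler_nat.
rewrite lerD2l; set W := _ ^+ N.
have W0 : 0 <= W.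
  have l0 : 0 <= L by move: L_ge; lra.
  by rewrite exprn_ge0 // !mulr_ge0 ?exprn_ge0 ?mulr_ge0 ?expR_ge0 ?addr_ge0 ?divr_ge0
    ?mulr_ge0 ?exprn_ge0 // ltW.
pose cell u0 := [set u in H | cen u == u0]%SET.
have HE : (#|H| = \sum_(u0 in C) #|cell u0|)%N.
  rewrite -sum1_card (partition_big cen (mem C)) /=; last first.
    by move=> u; rewrite inE => /andP[_ /cenP[]].
  by apply: eq_bigr => u0 _; rewrite -[RHS]sum1_card; apply: eq_bigl => u; rewrite [RHS]inE.
have cellW u0 : #|cell u0|%:R <= W.
  pose s (x : J) : R := match x with
    | inl _ => 48 * L / sigma ^+ 2
    | inr (inl _) => 16 * L / sigma ^+ 2
    | inr (inr _) => 2 / sigma end.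
  have L0 : 0 < L by move: L_ge; lra.
  have s0 x : 0 < s x by case: x => [_|[_|_]] /=; rewrite divr_gt0 ?exprn_gt0 ?mulr_gt0.
  pose lt u : {ffun J -> bool * nat} := [ffun x => lat u x].
  have ltI : {in cell u0 &, injective lt}.
    move=> u v; rewrite !inE => /andP[/andP[uR hu] /eqP cu] /andP[/andP[vR hv] /eqP cv] E.
    by apply: labI => //; rewrite /lab hu hv cu cv -/(lt u) -/(lt v) E.
  have := card_lattice_labels s0 ltI.
  have -> : \prod_j (2 * expR 1 * (1 + s j)) = W.
    rewrite big_sumType big_sumType /= !prodr_const /= card_prod !card_ord.
    by rewrite mulnC exprM -!exprMn mulrA.
  apply => u; rewrite !inE => /andP[/andP[uR hu] /eqP cu].
  rewrite big_sumType big_sumType /= /lt.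
  under eq_bigr do rewrite ffunE.
  under [X in _ + (X + _)]eq_bigr do rewrite ffunE.
  under [X in _ + (_ + X)]eq_bigr do rewrite ffunE.
  rewrite !card_sum card_prod !card_ord !natrD natrM.
  have nN (F : 'I_N -> R) (a : R) : (forall i, F i <= a) -> \sum_i F i <= N%:R * a.
    move=> h; rewrite -[N in N%:R]card_ord mulr_natl -sumr_const; exact: ler_sum.
  apply: lerD; last apply: lerD.
  - rewrite -(pair_big xpredT xpredT (fun a k => (lat u (inl (a, k))).2%:R / s (inl (a, k)))) /=.
    apply: nN => a; have [ra|_] := boolP (rel u a); last first.
      by rewrite big1 ?ler0n // => k _; rewrite mul0r.
    have sb : 0 < 48 * L / sigma ^+ 2 by rewrite divr_gt0 ?exprn_gt0 ?mulr_gt0.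
    rewrite -mulr_suml ler_pdivrMr //.
    apply: (le_trans (sum_signed_label _ rho_gt0 d_gt0)).
    rewrite ler_pM2l ?ltr0n // ler_pdivrMr //.
    have -> : 48 * L / sigma ^+ 2 * rho = 4 * r.
      have -> : 48 * L / sigma ^+ 2 * rho = 4 * (4 * L / p) / r.
        by rewrite /rho; field; rewrite !gt_eqF.
      by rewrite -rr; field; rewrite gt_eqF.
    (* Four steps of length at most [r]: from the atom to a sample point, to the base atom of [u],
       to the shared sample point, to the base atom of the centre. Hence the weight
       [48 L / sigma^2 = 4 r / rho]. *)
    have [_ [i iu iv]] := cenP _ hu; have /existsP[i' /andP[i'u cs]] := ra.
    have h1 := close i'u cs.
    have h2 : enorm (xi i' - beta u (j u)) <= r.
      by apply: close => //; move: i'u; rewrite inE.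
    have h3 : enorm (xi i - beta u (j u)) <= r.
      by apply: close => //; move: iv; rewrite inE.
    have h4 : enorm (xi i - b0 (cen u)) <= r.
      by apply: close => //; move: iu; rewrite inE.
    apply: (le_trans (enorm_dist_triangle _ (xi i') _)).
    apply: (@le_trans _ _ (r + (r + (r + r)))); last lra.
    rewrite enorm_distC; apply: lerD => //.
    apply: (le_trans (enorm_dist_triangle _ (beta u (j u)) _)); apply: lerD => //.
    apply: (le_trans (enorm_dist_triangle _ (xi i) _)); apply: lerD => //.
    by rewrite enorm_distC.
  - rewrite -[leRHS]mulr1 /=; apply: nN => a; have [ra|_] := boolP (rel u a); last by rewrite /= mul0r.
    rewrite ler_pdivrMr ?mul1r; last exact: (s0 (inr (inl a))).
    apply: (le_trans (truncn_le_id _)); first by rewrite divr_ge0 // ltW.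
    have /existsP[i' /andP[i'u cs]] := ra; rewrite ler_pdivrMr //.
    have -> : 16 * L / sigma ^+ 2 * he = 2 * L / p by rewrite /he; field; rewrite !gt_eqF.
    by move: i'u; rewrite inE => i'u; have [] := localized i'u cs.
  - rewrite -[leRHS]mulr1; apply: nN => a.
    have nn : 0 <= - psi u a by rewrite oppr_ge0; case/andP: (psi_bd u a).
    rewrite ler_pdivrMr ?mul1r; last exact: (s0 (inr (inr a))).
    apply: (le_trans (truncn_le_id _)); first by rewrite divr_ge0 // ltW.
    rewrite ler_pdivrMr //.
    have -> : 2 / sigma * hpsi = 1 by rewrite /hpsi; field; rewrite gt_eqF.
    by rewrite lerNl; case/andP: (psi_bd u a).
rewrite HE natr_sum; apply: (@le_trans _ _ (\sum_(u0 in C) W)); first exact: ler_sum.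
by rewrite sumr_const -mulr_natl ler_wpM2r // card_disjoint_heavy.
Qed.
End local_cover.

(** * Numerical bounds and the size of the local cover *)

Section numeric_bounds.
Context {R : realType}.

Lemma ln2_ge : 16 / 25 <= ln 2 :> R.
Proof.
rewrite -ler_expR lnK ?posrE //.
have -> : 16 / 25 = - (- (2 / 25) * 8%:R) :> R by lra.
rewrite expRN expRM_natr -[leRHS]invrK lef_pV2 ?posrE ?exprn_gt0 ?expR_gt0 //.
apply: (@le_trans _ _ ((23 / 25) ^+ 8)); first by lra.
rewrite lerXn2r ?nnegrE ?expR_ge0 ?divr_ge0 //.
by apply: le_trans (expR_ge1Dx _); lra.
Qed.

Lemma ln2_le : ln 2 <= 7 / 10 :> R.
Proof.
rewrite -ler_expR lnK ?posrE //.
have dbl (a b x : R) : 0 <= a -> b <= a ^+ 2 -> a <= expR (x / 2) -> b <= expR x.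
  move=> a0 ba ax; apply: (le_trans ba); have <- : expR (x / 2) ^+ 2 = expR x by rewrite -expRM_natr; congr expR; lra.
  rewrite lerXn2r ?nnegrE ?expR_ge0 //.
(* Successive square roots of 2, rounded up to fractions, down to [647/640 = 1 + 7/640], where
   [7/640] is [7/10] halved six times. *)
apply: (dbl (695 / 491)); [lra|lra|].
apply: (dbl (232 / 195)); [lra|lra|].
apply: (dbl (649 / 595)); [lra|lra|].
apply: (dbl (588 / 563)); [lra|lra|].
apply: (dbl (93 / 91)); [lra|lra|].
apply: (dbl (647 / 640)); [lra|lra|].
by apply: le_trans (expR_ge1Dx _); lra.
Qed.

Lemma natr_ln m (x : R) : 0 < x -> m%:R * ln x = ln (x ^+ m).
Proof. by move=> x0; rewrite lnXn // mulr_natl. Qed.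

Lemma ln_pow2 k : ln (2 ^+ k) = k%:R * ln 2 :> R.
Proof. by rewrite lnXn // mulr_natl. Qed.

Lemma ln_le_pow2 (a : R) m : 0 < a -> a <= 2 ^+ m -> ln a <= m%:R * ln 2.
Proof. by move=> a0 h; rewrite natr_ln // ler_ln ?posrE ?exprn_gt0. Qed.

Lemma lnD_le_pow2 (a b : R) m : 0 < a -> 0 < b -> a * b <= 2 ^+ m ->
  ln a + ln b <= m%:R * ln 2.
Proof. by move=> a0 b0 h; rewrite -lnM ?posrE // ln_le_pow2 ?mulr_gt0. Qed.

Lemma ln_le_mul (a b c : R) m : 0 < a -> 0 < b -> c <= a * b ^+ m -> 0 < c ->
  ln c <= ln a + m%:R * ln b.
Proof.
move=> a0 b0 h c0; rewrite natr_ln // -lnM ?posrE ?exprn_gt0 //.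
by rewrite ler_ln ?posrE ?mulr_gt0 ?exprn_gt0.
Qed.

Lemma ln_2expR1 (x : R) : 0 < x -> ln (2 * expR 1 * x) = ln 2 + 1 + ln x.
Proof.
move=> x0; rewrite lnM ?posrE ?mulr_gt0 ?expR_gt0 //.
by rewrite lnM ?posrE ?expR_gt0 // expRK.
Qed.

(** The pair [A = 5], [B = 3/4] is picked so that the chaining bound [3/2 A + 2 B] is exactly 9. The
    log-cardinal grows linearly in [k], so it fits below a square of this form. *)
Lemma local_cover_count (N d k : nat) (sigma L : R) : (0 < N)%N -> (0 < d)%N ->
  sigma = 2^-1 ^+ k.+2 -> L = - ln sigma ->
  ln (2 * (1 + (3 / 2 * sigma ^+ 2)^-1 *
    ((2 * expR 1 * (1 + 48 * L / sigma ^+ 2)) ^+ d *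
     (2 * expR 1 * (1 + 16 * L / sigma ^+ 2)) *
     (2 * expR 1 * (1 + 2 / sigma))) ^+ N)) <=
  (N * (d + 1))%:R * (5 + 3 / 4 * k%:R) ^+ 2 / 2.
Proof.
move=> N0 d0 sigmaE LE0.
pose t : R := 2 ^+ k.+1.
have l2 : 0 < ln 2 :> R by have := ln2_ge; lra.
have t2 : 2 <= t by rewrite /t -[leLHS]expr1 ler_weXn2l // ler1n.
have t0 : 0 < t by lra.
have sE : sigma = (2 * t)^-1 by rewrite sigmaE /t -exprS exprVn.
have s0 : 0 < sigma by rewrite sE invr_gt0 mulr_gt0.
have LE : L = k.+2%:R * ln 2.
  by rewrite LE0 sigmaE exprVn lnV ?posrE ?exprn_gt0 // opprK ln_pow2.
have kt : k.+2%:R <= t.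
  rewrite /t -natrX ler_nat; elim: (k) => // m IH.
  by rewrite expnS mul2n -addnn; apply: (@leq_trans (m.+2 + m.+2)); [rewrite addnS ltnS addSn ltnS leq_addr|exact: leq_add].
have Lt : 0 <= L <= 7 / 10 * t.
  rewrite LE mulr_ge0 ?(ltW l2) //= mulrC ler_pM ?ler0n ?(ltW l2) //; exact: ln2_le.
have is2 : (sigma ^+ 2)^-1 = 4 * t ^+ 2 by rewrite sE exprVn invrK exprMn; lra.
have is1 : sigma^-1 = 2 * t by rewrite sE invrK.
set X := 1 + 48 * L / _; set Y := 1 + 16 * L / _; set Z := 1 + 2 / _.
have t3 : 8 <= t ^+ 3 by have := sqr_ge0 (t - 2); nra.
have /andP[L0 Lt'] := Lt.
have Lt2 : L * t ^+ 2 <= 7 / 10 * t ^+ 3.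
  have -> : 7 / 10 * t ^+ 3 = 7 / 10 * t * t ^+ 2 by ring.
  by rewrite ler_wpM2r ?sqr_ge0.
have Lt0 : 0 <= L * t ^+ 2 by rewrite mulr_ge0 ?sqr_ge0.
have XE : 1 <= X <= 135 * t ^+ 3.
  by rewrite /X is2; apply/andP; split; nra.
have YE : 1 <= Y <= 45 * t ^+ 3.
  by rewrite /Y is2; apply/andP; split; nra.
have ZE : 1 <= Z <= 9 / 2 * t.
  by rewrite /Z is1; apply/andP; split; nra.
have e2 : 2 <= expR 1 :> R by have := expR_ge1Dx (1 : R); lra.
have lt : ln t = k.+1%:R * ln 2 by rewrite /t ln_pow2.
have /andP[X1 X2] := XE; have /andP[Y1 Y2] := YE; have /andP[Z1 Z2] := ZE.
have X0 : 0 < X by lra.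
have Y0 : 0 < Y by lra.
have Z0 : 0 < Z by lra.
have [p135 p270 p45 p9 p810] : [/\ 0 < 135 :> R, 0 < 270 :> R, 0 < 45 :> R, 0 < 9 / 2 :> R & 0 < 810 :> R].
  by split; rewrite ?divr_gt0 ?ltr0n.
have lX : ln (2 * expR 1 * X) <= 1 + ln 270 + 3 * ln t.
  rewrite ln_2expR1 //; have := @ln_le_mul 135 t X 3 p135 t0 X2 X0.
  have : ln (2 * 135) = ln 2 + ln 135 :> R by rewrite lnM ?posrE.
  have -> : 2 * 135 = 270 :> R by lra.
  lra.
have lYZ : ln (2 * expR 1 * Y) + ln (2 * expR 1 * Z) <= 2 + ln 810 + 4 * ln t.
  have h1 := @ln_le_mul 45 t Y 3 p45 t0 Y2 Y0.
  have h2 := @ln_le_mul (9 / 2) t Z 1 p9 t0 Z2 Z0.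
  have : ln (2 * 45 * (2 * (9 / 2))) = ln 2 + ln 45 + (ln 2 + ln (9 / 2)) :> R.
    by rewrite !lnM ?posrE ?mulr_gt0.
  have -> : 2 * 45 * (2 * (9 / 2)) = 810 :> R by lra.
  by rewrite !ln_2expR1 //; lra.
have lab : ln 270 + ln 810 <= 18 * ln 2 :> R.
  by apply: (@lnD_le_pow2 _ _ 18) => //; lra.
have la : ln 270 <= 9 * ln 2 :> R.
  by apply: (@ln_le_pow2 _ 9) => //; lra.
have t22 : 4 <= t ^+ 2 by rewrite expr2; have := ler_pM (ler0n R 2) (ler0n R 2) t2 t2; lra.
clear p135 p270 p45 p9 p810 Lt Lt' Lt2 Lt0 X2 Y2 Z2 XE YE ZE LE kt t3.
have W1 : 1 <= 2 * expR 1 * X /\ 1 <= 2 * expR 1 * Y /\ 1 <= 2 * expR 1 * Z.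
  have h (u : R) : 1 <= u -> 1 <= 2 * expR 1 * u by move=> u1; apply: mulr_ege1 => //; lra.
  by split; [|split]; exact: h.
case: W1 => WX [WY WZ].
set WI := _ * _ * (2 * expR 1 * Z).
have WI1 : 1 <= WI.
  by apply: mulr_ege1 (WZ); apply: mulr_ege1 (WY); apply: exprn_ege1.
have dR : 1 <= d%:R :> R by rewrite ler1n.
have NR : 1 <= N%:R :> R by rewrite ler1n.
(* The constants are the averages of the position bound and of the joint bound for [Y] and [Z], as
   for [d = 1]; each further coordinate costs less than the average. *)
have lWI : ln WI <= (d%:R + 1) * (15 / 10 + 9 * ln 2 + 7 / 2 * ln t).
  have hX : ln ((2 * expR 1 * X) ^+ d) = d%:R * ln (2 * expR 1 * X).
    by rewrite -(natr_ln _ (lt_le_trans ltr01 WX)).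
  have -> : ln WI = d%:R * ln (2 * expR 1 * X) + (ln (2 * expR 1 * Y) + ln (2 * expR 1 * Z)).
    have X0' : 0 < 2 * expR 1 * X := lt_le_trans ltr01 WX.
    have Y0' : 0 < 2 * expR 1 * Y := lt_le_trans ltr01 WY.
    have Z0' : 0 < 2 * expR 1 * Z := lt_le_trans ltr01 WZ.
    by rewrite /WI -hX addrA -!lnM ?posrE ?mulr_gt0 ?exprn_gt0.
  have lt0 : 0 <= ln t by rewrite ln_ge0 //; lra.
  have h1 := ler_wpM2l (ler0n R d) lX.
  have d1 : 0 <= d%:R - 1 :> R by lra.
  have h2 := ler_wpM2l d1 la; have h3 := mulr_ge0 d1 lt0.
  by move: h1 h2 h3 lYZ lab lt0; nra.
have i3 : (3 / 2 * sigma ^+ 2)^-1 = 8 / 3 * t ^+ 2.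
  by rewrite invfM is2; lra.
rewrite i3.
have WN1 : 1 <= WI ^+ N by rewrite exprn_ege1.
apply: (@le_trans _ _ (ln (32 / 3 * t ^+ 2 * WI ^+ N))).
  rewrite ler_ln ?posrE; last first.
  - by rewrite !mulr_gt0 ?exprn_gt0 ?divr_gt0 ?(lt_le_trans ltr01 WI1).
  - by rewrite mulr_gt0 ?addr_gt0 ?mulr_gt0 ?exprn_gt0 ?(lt_le_trans ltr01 WI1) ?divr_gt0.
  have : 1 * 1 <= t ^+ 2 * WI ^+ N by apply: ler_pM => //; lra.
  lra.
have WI0 : 0 < WI := lt_le_trans ltr01 WI1.
have p32 : 0 < 32 / 3 :> R by rewrite divr_gt0.
have tt0 : 0 < t ^+ 2 by rewrite exprn_gt0.
rewrite (lnM (mulr_gt0 p32 tt0) (exprn_gt0 N WI0)) (lnM p32 tt0).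
rewrite -(natr_ln 2 t0) -(natr_ln N WI0).
have l5 : ln (32 / 3) <= 7 / 2 * ln 2 :> R.
  by have := @lnD_le_pow2 _ _ 7 p32 p32; lra.
clear lX lYZ lab la i3 WN1 t22 WX WY WZ.
have c2 := @ln2_le.
set c := ln 2 in lt l2 l5 lWI c2 *; set K : R := k%:R.
have K0 : 0 <= K by rewrite ler0n.
have {}lt : ln t = (K + 1) * c by rewrite lt -natr1.
set D : R := (N * (d + 1))%:R.
have DE : D = N%:R * (d%:R + 1) by rewrite /D natrM natrD.
have D2 : 2 <= D by rewrite DE; nra.
have h1 : N%:R * ln WI <= D * (15 / 10 + 9 * c + 7 / 2 * ((K + 1) * c)).
  by rewrite DE -mulrA ler_wpM2l ?ler0n // -lt.
have cK : 0 <= (K + 1) * c by rewrite mulr_ge0 ?(ltW l2) //; lra.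
(* The number of centres is paid once, not per parameter; [D >= 2] lets half of its logarithm be
   charged to each unit of [D]. *)
have h2 : ln (32 / 3) + 2 * ln t <= D * (7 / 4 * c + (K + 1) * c).
  have : 2 * (7 / 4 * c + (K + 1) * c) <= D * (7 / 4 * c + (K + 1) * c).
    by rewrite ler_wpM2r //; lra.
  by rewrite lt; lra.
have cK' : (K + 1) * c <= (K + 1) * (7 / 10) by rewrite ler_wpM2l //; lra.
have h3 : 15 / 10 + 9 * c + 7 / 2 * ((K + 1) * c) + (7 / 4 * c + (K + 1) * c) <=
    (5 + 3 / 4 * K) ^+ 2 / 2 by nra.
have := ler_wpM2l (le_trans (ler0n R 2) D2) h3.
by move: h1 h2; rewrite !mulrDr; lra.
Qed.
End numeric_bounds.

(** * Rademacher averages of hard and soft minima *)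

Section local_class.
Context {R : realType}.

Lemma half_expn_gt0 k : 0 < (2^-1 : R) ^+ k.
Proof. by rewrite exprn_gt0. Qed.

(** At level [k] the resolution is [sigma = 2^-(k+2)]: it is at most [1/4], and the radius [2 sigma]
    of the cover is the one that chaining expects. Subtracting [1/2] centres potentials with values
    in [[0, 1]]. *)
Lemma rademacher_local_class (V : finType) (N d n : nat) (p : R)
    (xi : 'I_n -> 'rV[R]_d) (beta : V -> 'I_N -> 'rV[R]_d)
    (e psi : V -> 'I_N -> R) (j : V -> 'I_N)
    (c : V -> 'I_N -> 'I_n -> R) (f : V -> 'I_n -> R)
    (sel : {ffun 'I_n -> bool} -> V) :
  (0 < N)%N -> (0 < d)%N -> (0 < n)%N -> 1 <= p ->
  (forall v a i, 0 <= c v a i <= 1) -> (forall v a, -1 <= psi v a <= 0) ->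
  (forall v, psi v (j v) = 0) -> (forall v a i, f v i <= c v a i - psi v a) ->
  (forall v i, exists a, f v i = c v a i - psi v a) -> (forall v a, 0 <= e v a) ->
  (forall sigma, 0 < sigma -> sigma <= 1 / 4 ->
    forall v a i, sigma <= c v (j v) i -> sigma <= c v a i ->
    enorm (xi i - beta v a) ^+ 2 <= 4 * (- ln sigma) / p /\ e v a <= 2 * (- ln sigma) / p) ->
  (forall sigma, 0 < sigma -> sigma <= 1 / 4 ->
    forall u v a i, sigma <= c u a i \/ sigma <= c v a i ->
    `|c u a i - c v a i| <= p / sigma * (`|e u a - e v a| +
    `|enorm (xi i - beta u a) ^+ 2 - enorm (xi i - beta v a) ^+ 2| / 2)) ->
  avg_signs (fun s => n%:R^-1 * `|signed_sum (fun i => f (sel s) i - 1 / 2) s|) <=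
  9 * Num.sqrt ((N * (d + 1))%:R / n%:R).
Proof.
move=> N0 d0 n0 p1 c01 psi1 psij fle fatt e0 hloc hlip.
have s0 k : 0 < (2^-1 : R) ^+ k.+2 by exact: half_expn_gt0.
have s1 k : (2^-1 : R) ^+ k.+2 <= 1 / 4.
  have -> : 1 / 4 = 2^-1 ^+ 2 :> R by lra.
  by rewrite ler_wiXn2l // invf_le1 // ler1n.
have /choice[rep hrep] k := local_cover n0 d0 p1 (s0 k) (s1 k) c01 psi1 psij fle fatt e0
  (hloc _ (s0 k) (s1 k)) (hlip _ (s0 k) (s1 k)).
have -> : (9 : R) = 3 / 2 * 5 + 2 * (3 / 4) by lra.
pose v u i := f u i - 1 / 2.
apply: (@chaining R n V v _ _ _ rep sel) => //.
- move=> u i; rewrite /v ler_norml.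
  have [a fE] := fatt u i; have /andP[c0 _] := c01 u a i; have /andP[_ q0] := psi1 u a.
  have := fle u (j u) i; have /andP[_ c1] := c01 u (j u) i; rewrite psij; lra.
- move=> k u; have [+ _] := hrep k; move=> /(_ u).
  rewrite [2 * _](_ : _ = 2^-1 ^+ k.+1); last by rewrite exprS mulrA divff ?mul1r.
  move=> h; apply: le_trans h; apply: ler_sum => i _.
  by have -> : v u i - v (rep k u) i = f u i - f (rep k u) i by rewrite /v; ring.
- move=> k; have [_ hc] := hrep k.
  apply: le_trans (@local_cover_count R N d k _ _ N0 d0 erefl erefl).
  rewrite ler_ln ?posrE.
  + by rewrite ler_pM2l.
  + rewrite mulr_gt0 // ltr0n; apply/card_gt0P; exists (rep k (sel [ffun=> true])).
    exact: imset_f.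
  + rewrite mulr_gt0 //; apply: lt_le_trans hc.
    rewrite ltr0n; apply/card_gt0P; exists (rep k (sel [ffun=> true])).
    exact: imset_f.
Qed.

End local_class.

(** * Soft minima: dependence on costs and weights *)

Section soft_minimum.
Context {R : realType}.

Definition softmin (N : nat) (eps : R) (w c : 'I_N -> R) : R :=
  - (eps * ln (\sum_a w a * expR (- (c a / eps)))).

Section fixed_parameter.
Variables (N : nat) (eps : R).
Hypothesis eps_gt0 : 0 < eps.
Implicit Types w c : 'I_N -> R.

Let Z w c := \sum_a w a * expR (- (c a / eps)).

Lemma softmin_sum_ge w c M : (forall a, 0 <= w a) -> \sum_a w a = 1 ->
  (forall a, c a <= M) -> expR (- (M / eps)) <= Z w c.
Proof.
move=> w0 w1 cM; rewrite -[leLHS]mul1r -w1 mulr_suml; apply: ler_sum => a _.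
by rewrite ler_wpM2l // ler_expR lerN2 ler_pM2r ?invr_gt0.
Qed.

Lemma softmin_sum_gt0 w c : (forall a, 0 <= w a) -> \sum_a w a = 1 -> 0 < Z w c.
Proof.
move=> w0 w1; have h : forall a, c a <= \sum_b `|c b|.
  move=> a; apply: (le_trans (ler_norm _)); rewrite (bigD1 a) //= lerDl.
  by apply: sumr_ge0.
exact: lt_le_trans (expR_gt0 _) (softmin_sum_ge w0 w1 h).
Qed.

Lemma softmin_le_shift w c c' h : (forall a, 0 <= w a) -> \sum_a w a = 1 ->
  (forall a, c a <= c' a + h) -> softmin eps w c <= softmin eps w c' + h.
Proof.
move=> w0 w1 hc; rewrite /softmin -lerBlDr -opprD lerN2.
have -> : eps * ln (Z w c) + h = eps * ln (Z w c * expR (h / eps)).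
  rewrite lnM ?posrE ?expR_gt0 ?softmin_sum_gt0 // expRK mulrDr.
  by congr (_ + _); rewrite mulrC divfK ?gt_eqF.
rewrite ler_pM2l // ler_ln ?posrE ?mulr_gt0 ?expR_gt0 ?softmin_sum_gt0 //.
rewrite mulr_suml; apply: ler_sum => a _; rewrite -mulrA -expRD ler_wpM2l // ler_expR.
rewrite -!mulNr -mulrDl ler_pM2r ?invr_gt0 //; have := hc a; lra.
Qed.

Lemma softmin_le w c M : (forall a, 0 <= w a) -> \sum_a w a = 1 ->
  (forall a, c a <= M) -> softmin eps w c <= M.
Proof.
move=> w0 w1 cM; rewrite /softmin lerNl -ler_pdivrMl // mulrN mulrC.
rewrite -[leLHS]expRK ler_ln ?posrE ?expR_gt0 ?softmin_sum_gt0 //.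
exact: softmin_sum_ge.
Qed.

Lemma softmin_ge0 w c : (forall a, 0 <= w a) -> \sum_a w a = 1 ->
  (forall a, 0 <= c a) -> 0 <= softmin eps w c.
Proof.
move=> w0 w1 c0; rewrite /softmin oppr_ge0 pmulr_rle0 // ln_le0 //.
rewrite -w1; apply: ler_sum => a _; rewrite -[leRHS]mulr1 ler_wpM2l //.
by rewrite -expR0 ler_expR oppr_le0 divr_ge0 // ltW.
Qed.

End fixed_parameter.

Lemma ln_le_tangent (x y : R) : 0 < x -> 0 < y -> ln x <= ln y + (x - y) / y.
Proof.
move=> x0 y0; have : ln (1 + (x / y - 1)) <= x / y - 1.
  by apply: le_ln1Dx; rewrite -subr_gt0 opprK subrK divr_gt0.
rewrite subrKC ln_div ?posrE // mulrBl divff ?gt_eqF //; lra.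
Qed.

Lemma expR1_le4 : expR 1 <= 4 :> R.
Proof.
rewrite -[leLHS]invrK -expRN -[leRHS]invrK lef_pV2 ?posrE ?expR_gt0 ?invr_gt0 //.
have -> : -1 = - (1 / 2) * 2%:R :> R by lra.
rewrite expRM_natr; apply: (@le_trans _ _ ((1 / 2) ^+ 2)); first lra.
by rewrite lerXn2r ?nnegrE ?expR_ge0 ?divr_ge0 // (le_trans _ (expR_ge1Dx _)) //; lra.
Qed.

(* The label of a weight is chosen so that the labels of a probability vector
   sum to [O(N / tau)] whatever [eps] is: this is where the bound avoids any
   [ln N] factor (concavity of [ln] for [eps < 1]). *)
Definition weight_cell (N : nat) (eps tau w : R) : R :=
  if eps < 1 then eps * ln (1 + N%:R * expR eps^-1 * w) / (tau / 4)
  else N%:R * w / (tau / 8).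

Lemma weight_cell_ge0 N eps tau w : 0 < eps -> 0 < tau -> 0 <= w ->
  0 <= weight_cell N eps tau w.
Proof.
move=> e0 t0 w0; rewrite /weight_cell; case: ifP => _.
  rewrite divr_ge0 ?divr_ge0 ?(ltW t0) // mulr_ge0 ?(ltW e0) // ln_ge0 // lerDl.
  by rewrite !mulr_ge0 ?expR_ge0.
by rewrite divr_ge0 ?mulr_ge0 ?divr_ge0 ?(ltW t0).
Qed.

Lemma sum_weight_cell N eps tau (w : 'I_N -> R) : 0 < eps -> 0 < tau ->
  (forall a, 0 <= w a) -> \sum_a w a = 1 ->
  \sum_a weight_cell N eps tau (w a) <= N%:R * (8 / tau).
Proof.
move=> e0 t0 w0 w1; rewrite /weight_cell.
have [e1|_] := boolP (eps < 1); last first.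
  by rewrite -mulr_suml -mulr_sumr w1 mulr1 invf_div.
rewrite -mulr_suml invf_div.
have -> : N%:R * (8 / tau) = N%:R * 2 * (4 / tau) by ring.
rewrite ler_pM2r ?divr_gt0 //.
set k := expR eps^-1; have k0 : 0 < k := expR_gt0 _.
have k1 : 0 < 1 + k by rewrite addr_gt0.
rewrite -mulr_sumr.
(* Tangent at [1 + k], the value at uniform weights, so the linear parts sum to 0. What remains is
   at most [eps * ln (1 + k) <= eps * ln 2 + 1 <= 2] per atom. *)
apply: (@le_trans _ _ (eps * \sum_(a < N) (ln (1 + k) + (N%:R * k * w a - k) / (1 + k)))).
  rewrite ler_pM2l //; apply: ler_sum => a _.
  have h : 0 < 1 + N%:R * k * w a.
    by rewrite ltr_wpDr // !mulr_ge0 ?(ltW k0).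
  apply: (le_trans (ln_le_tangent h k1)); rewrite lerD2l.
  by have -> : 1 + N%:R * k * w a - (1 + k) = N%:R * k * w a - k by ring.
rewrite big_split /= -mulr_suml sumrB -mulr_sumr w1 !sumr_const card_ord mulr1.
rewrite -[k *+ N]mulr_natl subrr mul0r addr0 -[ln _ *+ N]mulr_natl mulrCA ler_wpM2l //.
have : ln (1 + k) <= ln (2 * k).
  have kk : 1 <= k by rewrite -[leLHS]expR0 ler_expR invr_ge0 ltW.
  rewrite ler_ln ?posrE ?mulr_gt0 //; lra.
rewrite lnM ?posrE // expRK => h.
have l2 := @ln2_le R.
have : eps * ln (1 + k) <= eps * (ln 2 + eps^-1) by rewrite ler_pM2l.
rewrite mulrDr divff ?gt_eqF // => h'; apply: (le_trans h').
have : eps * ln 2 <= 1 * 1 by rewrite ler_pM ?(ltW e0) ?(ltW e1) ?ln_ge0 ?ler1n //; lra.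
lra.
Qed.

Lemma softmin_weight_cell N eps tau (w w' c : 'I_N -> R) : 0 < eps -> 0 < tau ->
  (forall a, 0 <= w a) -> \sum_a w a = 1 ->
  (forall a, 0 <= w' a) -> \sum_a w' a = 1 ->
  (forall a, 0 <= c a <= 1) ->
  (forall a, Num.truncn (weight_cell N eps tau (w a)) =
             Num.truncn (weight_cell N eps tau (w' a))) ->
  softmin eps w c - softmin eps w' c <= tau / 2.
Proof.
move=> e0 t0 w0 w1 w0' w1' c01 cellE.
have N0 : (0 < N)%N.
  by case: (N) w w1 {w0 w' w0' w1' c c01 cellE} => // w; rewrite big_ord0 => /eqP; rewrite eq_sym oner_eq0.
have NR : 0 < N%:R :> R by rewrite ltr0n.
rewrite /softmin opprK addrC -mulrBr.
set S := \sum_a w a * _; set S' := \sum_a w' a * _.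
have S0 : 0 < S by exact: softmin_sum_gt0.
have S0' : 0 < S' by exact: softmin_sum_gt0.
have c1 a : c a <= 1 by case/andP: (c01 a).
have Sk : expR (- (1 / eps)) <= S by exact: softmin_sum_ge.
have e1 a : expR (- (c a / eps)) <= 1.
  by rewrite -expR0 ler_expR oppr_le0 divr_ge0 ?(ltW e0) //; case/andP: (c01 a).
move: cellE; rewrite /weight_cell.
have [eps1|eps1] := boolP (eps < 1) => cellE.
  have h0 : 0 < tau / 4 by rewrite divr_gt0.
  set k := expR eps^-1 in cellE; have k0 : 0 < k := expR_gt0 _.
  have p0 u : 0 <= u -> 0 < 1 + N%:R * k * u.
    by move=> u0; rewrite ltr_wpDr // !mulr_ge0 ?(ltW k0).
  have l0 u : 0 <= u -> 0 <= eps * ln (1 + N%:R * k * u).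
    by move=> u0; rewrite mulr_ge0 ?(ltW e0) // ln_ge0 // lerDl !mulr_ge0 ?(ltW k0).
  set q := expR (tau / 4 / eps).
  have q1 : 1 <= q by rewrite -[leLHS]expR0 ler_expR !divr_ge0 ?(ltW t0) ?(ltW e0).
  (* Equal cells bound the ratio of the quantities [1 + N k w] by [q]. The additive error sums to at
     most [(q - 1) / k], and [1 / k <= S] because costs are at most 1, so it is absorbed by
     [2 q - 1 <= q^2]. *)
  have hw a : w' a <= q * w a + (q - 1) * (expR (- (1 / eps)) / N%:R).
    have := truncn_eq_dist h0 (l0 _ (w0 a)) (l0 _ (w0' a)) (cellE a).
    rewrite ler_norml => /andP[+ _]; rewrite -mulrBr -ler_pdivrMl // => hh.
    have : ln (1 + N%:R * k * w' a) <= ln (q * (1 + N%:R * k * w a)).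
      rewrite lnM ?posrE ?expR_gt0 ?p0 // expRK; move: hh; rewrite mulrN [eps^-1 * _]mulrC; lra.
    rewrite ler_ln ?posrE ?mulr_gt0 ?expR_gt0 ?p0 // => hk.
    have Nk : 0 < N%:R * k by rewrite mulr_gt0.
    rewrite -(ler_pM2l Nk) mulrDr.
    have -> : N%:R * k * ((q - 1) * (expR (- (1 / eps)) / N%:R)) = q - 1.
      by rewrite expRN div1r -/k; field; rewrite !gt_eqF.
    by move: hk; rewrite mulrDr mulr1 mulrCA; lra.
  have SS : S' <= q ^+ 2 * S.
    apply: (@le_trans _ _ (q * S + (q - 1) * expR (- (1 / eps)))).
      apply: (@le_trans _ _ (\sum_a (q * w a + (q - 1) * (expR (- (1 / eps)) / N%:R)) *
          expR (- (c a / eps)))).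
        by apply: ler_sum => a _; rewrite ler_wpM2r ?expR_ge0.
      rewrite (eq_bigr (fun a => q * (w a * expR (- (c a / eps))) +
         (q - 1) * (expR (- (1 / eps)) / N%:R) * expR (- (c a / eps)))); last first.
        by move=> a _; ring.
      rewrite big_split /= -mulr_sumr lerD2l.
      apply: (@le_trans _ _ (\sum_(a < N) (q - 1) * (expR (- (1 / eps)) / N%:R))).
        apply: ler_sum => a _; rewrite -[leRHS]mulr1; apply: ler_wpM2l; last exact: e1.
        apply: mulr_ge0; first by rewrite subr_ge0.
        by rewrite divr_ge0 ?expR_ge0 // ler0n.
      rewrite sumr_const card_ord -[leLHS]mulr_natl.
      by rewrite [leLHS](_ : _ = (q - 1) * expR (- (1 / eps))) //; field; rewrite gt_eqF.
    have : (q - 1) * expR (- (1 / eps)) <= (q - 1) * S by rewrite ler_wpM2l // subr_ge0.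
    have := mulr_ge0 (sqr_ge0 (q - 1)) (ltW S0); lra.
  have : ln S' <= 2 * (tau / 4 / eps) + ln S.
    have -> : 2 * (tau / 4 / eps) = ln (q ^+ 2) by rewrite lnXn ?expR_gt0 // expRK mulr_natl.
    by rewrite -lnM ?posrE ?exprn_gt0 ?expR_gt0 // ler_ln ?posrE ?mulr_gt0 ?exprn_gt0 ?expR_gt0.
  move=> hl; rewrite mulrC -ler_pdivlMr //.
  have -> : tau / 2 / eps = 2 * (tau / 4 / eps) by field; rewrite gt_eqF.
  lra.
have {}eps1 : 1 <= eps by rewrite leNgt.
have h0 : 0 < tau / 8 by rewrite divr_gt0.
have hw a : w' a - w a <= tau / 8 / N%:R.
  have := truncn_eq_dist h0 (mulr_ge0 (ler0n R N) (w0 a)) (mulr_ge0 (ler0n R N) (w0' a)) (cellE a).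
  by rewrite ler_norml => /andP[hh _]; rewrite ler_pdivlMr //; lra.
set k := expR (- (1 / eps)) in Sk.
have k1 : 1 - k <= eps^-1 by rewrite /k; have := expR_ge1Dx (- (1 / eps)); rewrite div1r; lra.
have ek a : k <= expR (- (c a / eps)).
  by rewrite ler_expR lerN2 ler_pM2r ?invr_gt0.
have SS : S' - S <= tau / 8 * eps^-1.
  (* Both weight vectors have sum 1, so the constant [k] can be subtracted; the exponentials then
     vary by at most [1 / eps], which pays for the outer factor [eps]. *)
  have -> : S' - S = \sum_a (w' a - w a) * (expR (- (c a / eps)) - k).
    rewrite (eq_bigr (fun a => w' a * expR (- (c a / eps)) - w a * expR (- (c a / eps)) - k * (w' a - w a))).
      by rewrite !sumrB -mulr_sumr sumrB w1 w1' subrr mulr0 subr0.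
    by move=> a _; ring.
  apply: (@le_trans _ _ (\sum_(a < N) tau / 8 / N%:R * (1 - k))).
    apply: ler_sum => a _; apply: (@le_trans _ _ (tau / 8 / N%:R * (expR (- (c a / eps)) - k))).
      by rewrite ler_wpM2r // subr_ge0.
    by rewrite ler_wpM2l ?divr_ge0 ?(ltW t0) // lerD2r.
  rewrite sumr_const card_ord -[leLHS]mulr_natl.
  rewrite [leLHS](_ : _ = tau / 8 * (1 - k)); last by field; rewrite gt_eqF.
  by rewrite ler_wpM2l // ltW.
have Se : 1 / 4 <= S.
  apply: le_trans Sk; rewrite /k expRN div1r lef_pV2 ?posrE ?expR_gt0 //.
  by apply: le_trans expR1_le4; rewrite ler_expR div1r invf_le1.
have := ln_le_tangent S0' S0.
have : (S' - S) / S <= tau / 2 / eps.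
  rewrite ler_pdivrMr //; apply: (le_trans SS).
  have t8 : 0 < tau / eps by rewrite divr_gt0.
  have : tau / eps * (1 / 4) <= tau / eps * S by rewrite ler_pM2l.
  lra.
by move=> h1 h2; rewrite mulrC -ler_pdivlMr //; lra.
Qed.

End soft_minimum.

Section soft_class.
Context {R : realType}.
Variables (V : finType) (N d n : nat) (p eps : R).
Variables (beta : V -> 'I_N -> 'rV[R]_d) (w : V -> 'I_N -> R).
Variables (c : V -> 'I_N -> 'I_n -> R).
Hypothesis N_gt0 : (0 < N)%N.
Hypothesis d_gt0 : (0 < d)%N.
Hypothesis n_gt0 : (0 < n)%N.
Hypothesis p_ge1 : 1 <= p.
Hypothesis eps_gt0 : 0 < eps.
Hypothesis beta1 : forall v a, enorm (beta v a) <= 1.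
Hypothesis w_ge0 : forall v a, 0 <= w v a.
Hypothesis w_sum1 : forall v, \sum_a w v a = 1.
Hypothesis c01 : forall v a i, 0 <= c v a i <= 1.
Hypothesis c_lip : forall u v a i,
  `|c u a i - c v a i| <= p * enorm (beta u a - beta v a).

Let f v i := softmin eps (w v) (fun a => c v a i).

Let p0 : 0 < p. Proof. exact: lt_le_trans p_ge1. Qed.

(** The target constant grows like [4 p + 1], so a uniform lattice of step proportional to [tau / p]
    is affordable here. Half of [tau] goes to the atoms and half to the weights. *)
Lemma soft_cover (tau : R) : 0 < tau -> exists rep : V -> V,
  (forall u i, `|f u i - f (rep u) i| <= tau) /\
  #|[set rep u | u : V]%SET|%:R <=
    ((2 * expR 1 * (1 + 2 * p / tau)) ^+ d * (2 * expR 1 * (1 + 8 / tau))) ^+ N.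
Proof.
move=> tau0; pose rho := tau / (2 * p).
have rho0 : 0 < rho by rewrite divr_gt0 ?mulr_gt0.
pose J := ('I_N * 'I_d + 'I_N)%type.
pose lab v : {ffun J -> bool * nat} := [ffun x : J => match x with
  | inl ak => signed_label (rho / Num.sqrt d%:R) (beta v ak.1 0 ak.2)
  | inr a => (true, Num.truncn (weight_cell N eps tau (w v a)))
  end].
have [rep [labE labI]] := exists_representative lab.
have near u v i : lab u = lab v -> f u i - f v i <= tau.
  move=> /ffunP E.
  apply: (@le_trans _ _ (tau / 2 + tau / 2)); last lra.
  rewrite -[f u i - _](subrKA (softmin eps (w u) (fun a => c v a i))); apply: lerD.
    rewrite lerBlDl; apply: softmin_le_shift => // a.
    rewrite -lerBlDl; apply: (le_trans (ler_norm _)); apply: (le_trans (c_lip _ _ _ _)).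
    have : enorm (beta u a - beta v a) <= rho.
      apply: signed_label_enorm => // k.
      by have := E (inl (a, k)); rewrite !ffunE.
    rewrite -(ler_pM2l p0) /rho.
    by have -> : p * (tau / (2 * p)) = tau / 2 by field; rewrite gt_eqF.
  apply: softmin_weight_cell => // a.
  by have := E (inr a); rewrite !ffunE => -[].
exists rep; split=> [u i|].
  by rewrite ler_norml lerNl opprB !near ?labE.
pose s (x : J) : R := if x is inl _ then 2 * p / tau else 8 / tau.
have s0 x : 0 < s x by case: x => ?; rewrite divr_gt0 ?mulr_gt0.
have := card_lattice_labels s0 labI.
have -> : \prod_j (2 * expR 1 * (1 + s j)) =
    ((2 * expR 1 * (1 + 2 * p / tau)) ^+ d * (2 * expR 1 * (1 + 8 / tau))) ^+ N.
  by rewrite big_sumType /= !prodr_const /= card_prod !card_ord mulnC exprM -!exprMn.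
apply => u _; rewrite big_sumType /=.
under eq_bigr do rewrite ffunE.
under [X in _ + X]eq_bigr do rewrite ffunE.
rewrite card_sum card_prod !card_ord natrD natrM; apply: lerD.
  rewrite -(pair_big xpredT xpredT (fun a k =>
    (signed_label (rho / Num.sqrt d%:R) (beta u a 0 k)).2%:R / s (inl (a, k)))) /=.
  apply: ler_sum_const => a.
  rewrite -mulr_suml ler_pdivrMr ?divr_gt0 ?mulr_gt0 //.
  apply: (le_trans (sum_signed_label _ rho0 d_gt0)).
  rewrite ler_pM2l ?ltr0n // ler_pdivrMr //.
  by have -> : 2 * p / tau * rho = 1 by rewrite /rho; field; rewrite !gt_eqF.
rewrite -mulr_suml ler_pdivrMr ?divr_gt0 //.
apply: le_trans (sum_weight_cell eps_gt0 tau0 (w_ge0 u) (w_sum1 u)).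
by apply: ler_sum => a _; rewrite truncn_le_id // weight_cell_ge0.
Qed.

(** The exponent enters through [ln p <= p - 1]; taking [A = 4 p + 1] and [B = 1] keeps
    [3/2 A + 2 B] below [2 (4 p + 1)]. *)
Lemma soft_cover_count (k : nat) (tau : R) : tau = 2^-1 ^+ k.+1 ->
  ln (2 * ((2 * expR 1 * (1 + 2 * p / tau)) ^+ d *
           (2 * expR 1 * (1 + 8 / tau))) ^+ N) <=
  (N * (d + 1))%:R * (4 * p + 1 + 1 * k%:R) ^+ 2 / 2.
Proof.
move=> tauE; pose t : R := 2 ^+ k.
have t1 : 1 <= t by rewrite exprn_ege1 // ler1n.
have it : tau^-1 = 2 * t by rewrite tauE exprVn invrK exprS.
have t0 : 0 < t := lt_le_trans ltr01 t1.
have pt : 1 <= p * t by rewrite -[leLHS]mulr1 ler_pM.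
set X := 1 + 2 * p / tau; set Y := 1 + 8 / tau.
have XE : X <= 17 * p * t by rewrite /X it; lra.
have YE : Y <= 17 * p * t.
  have : t <= p * t by rewrite -[leLHS]mul1r ler_pM2r.
  by rewrite /Y it; lra.
have X0 : 0 < X by rewrite /X it; have := mulr_gt0 p0 t0; lra.
have Y0 : 0 < Y by rewrite /Y it; lra.
have l2 := @ln2_le R; have l20 := @ln2_ge R.
have lt : ln t = k%:R * ln 2 by rewrite /t ln_pow2.
have l17 : ln (17 * p * t) <= 5 * ln 2 + (p - 1) + k%:R * ln 2.
  have p17 : 0 < 17 :> R by rewrite ltr0n.
  rewrite (lnM (mulr_gt0 p17 p0) t0) (lnM p17 p0) lt.
  have : ln 17 <= 5 * ln 2 :> R by apply: (@ln_le_pow2 _ _ 5) => //; lra.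
  have hp : -1 < p - 1 by move: p0; lra.
  by have := le_ln1Dx hp; rewrite subrKC; lra.
have lX : ln (2 * expR 1 * X) <= 2 + 5 * ln 2 + (p - 1) + k%:R * ln 2.
  rewrite ln_2expR1 //; have : ln X <= ln (17 * p * t).
    by rewrite ler_ln ?posrE // (lt_le_trans X0 XE).
  lra.
have lY : ln (2 * expR 1 * Y) <= 2 + 5 * ln 2 + (p - 1) + k%:R * ln 2.
  rewrite ln_2expR1 //; have : ln Y <= ln (17 * p * t).
    by rewrite ler_ln ?posrE // (lt_le_trans Y0 YE).
  lra.
have eX0 : 0 < 2 * expR 1 * X by rewrite !mulr_gt0 ?expR_gt0.
have eY0 : 0 < 2 * expR 1 * Y by rewrite !mulr_gt0 ?expR_gt0.
have eXd := exprn_gt0 d eX0.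
rewrite (lnM (ltr0n R 2) (exprn_gt0 N (mulr_gt0 eXd eY0))).
rewrite -(natr_ln N (mulr_gt0 eXd eY0)) (lnM eXd eY0) -(natr_ln d eX0).
clear XE YE X0 Y0 l17 eX0 eY0 eXd.
set B := 2 + _ + _ + _ in lX lY.
have K0 : 0 <= k%:R :> R by rewrite ler0n.
have Kl : k%:R * ln 2 <= k%:R * (7 / 10) :> R by rewrite ler_wpM2l.
have B' : B + 1 <= (4 * p + 1 + 1 * k%:R) ^+ 2 / 2.
  have Kp : k%:R * 1 <= k%:R * p by rewrite ler_wpM2l.
  have pp : 1 * p <= p * p by rewrite ler_pM2r.
  have := sqr_ge0 (k%:R : R); have := p_ge1; rewrite /B; lra.
have NR : 1 <= N%:R :> R by rewrite ler1n.
have dR : 1 <= d%:R :> R by rewrite ler1n.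
have D1 : 1 <= N%:R * (d%:R + 1) :> R by apply: mulr_ege1 => //; rewrite lerDr ler0n.
have h1 : N%:R * (d%:R * ln (2 * expR 1 * X) + ln (2 * expR 1 * Y)) <=
    N%:R * (d%:R + 1) * B.
  have -> : N%:R * (d%:R + 1) * B = N%:R * (d%:R * B + B) by ring.
  by apply: ler_wpM2l => //; apply: lerD => //; apply: ler_wpM2l.
have h2 := ler_wpM2l (le_trans ler01 D1) B'.
by rewrite natrM natrD; lra.
Qed.

Lemma rademacher_soft_class (sel : {ffun 'I_n -> bool} -> V) :
  avg_signs (fun s => n%:R^-1 * `|signed_sum (fun i => f (sel s) i - 1 / 2) s|) <=
  2 * (4 * p + 1) * Num.sqrt ((N * (d + 1))%:R / n%:R).
Proof.
have /choice[rep hrep] k := soft_cover (half_expn_gt0 (R := R) k.+1).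
have f01 u i : 0 <= f u i <= 1.
  have c0 a : 0 <= c u a i by case/andP: (c01 u a i).
  have c1 a : c u a i <= 1 by case/andP: (c01 u a i).
  by rewrite softmin_ge0 ?softmin_le.
apply: (@le_trans _ _ ((3 / 2 * (4 * p + 1) + 2 * 1) * Num.sqrt ((N * (d + 1))%:R / n%:R))).
  apply: (@chaining R n V (fun u i => f u i - 1 / 2) _ _ _ rep sel) => //.
  - by rewrite addr_ge0 // mulr_ge0 // ltW.
  - by move=> u i; rewrite ler_norml; case/andP: (f01 u i); lra.
  - move=> k u; have [h _] := hrep k.
    apply: ler_sum_const => i.
    rewrite -real_normK ?num_real // lerXn2r ?nnegrE ?(ltW (half_expn_gt0 _)) //.
    by have := h u i; rewrite opprB addrA subrK.
  - move=> k; have [_ hc] := hrep k.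
    apply: le_trans (@soft_cover_count k _ erefl).
    have c0 : 0 < #|[set rep k u | u : V]%SET|%:R :> R.
      rewrite ltr0n; apply/card_gt0P; exists (rep k (sel [ffun=> true])).
      exact: imset_f.
    rewrite ler_ln ?posrE ?mulr_gt0 //; last exact: lt_le_trans hc.
    by rewrite ler_pM2l.
by rewrite ler_wpM2r // ?sqrtr_ge0 //; move: p_ge1; lra.
Qed.

End soft_class.

(** * From Rademacher averages to empirical measures *)

Section symmetrization.
Context {R : realType}.
Variables (K : finType) (n : nat) (q : K -> R).
Hypothesis n_gt0 : (0 < n)%N.
Hypothesis q_ge0 : forall b, 0 <= q b.
Hypothesis q_sum1 : \sum_b q b = 1.

Definition sample_weight (a : {ffun 'I_n -> K}) : R := \prod_i q (a i).

Lemma sample_weight_ge0 a : 0 <= sample_weight a.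
Proof. exact: prodr_ge0. Qed.

Lemma sample_weight_sum1 : \sum_a sample_weight a = 1.
Proof.
rewrite -(bigA_distr_bigA (fun (_ : 'I_n) b => q b)) /=.
by rewrite big1 // => i _; exact: q_sum1.
Qed.

Lemma sample_weight_marginal (G : K -> R) (i : 'I_n) :
  \sum_a sample_weight a * G (a i) = \sum_b q b * G b.
Proof.
pose H (j : 'I_n) b := q b * (if j == i then G b else 1).
transitivity (\sum_(a : {ffun 'I_n -> K}) \prod_j H j (a j)).
  apply: eq_bigr => a _; rewrite /H big_split /=; congr (_ * _).
  by rewrite -big_mkcond /= big_pred1_eq.
rewrite -(bigA_distr_bigA H) (bigD1 i) //= [X in _ * X]big1 ?mulr1.
  by apply: eq_bigr => b _; rewrite /H eqxx.
move=> j ji; rewrite -[RHS]q_sum1; apply: eq_bigr => b _.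
by rewrite /H (negbTE ji) mulr1.
Qed.

Let swap (s : {ffun 'I_n -> bool}) (x : {ffun 'I_n -> K} * {ffun 'I_n -> K}) :=
  ([ffun i => if s i then x.1 i else x.2 i], [ffun i => if s i then x.2 i else x.1 i]).

Let swapK s : involutive (swap s).
Proof.
by move=> [a b]; rewrite /swap /=; congr (_, _); apply/ffunP => i; rewrite !ffunE; case: (s i).
Qed.

Let weight_swap s x : sample_weight (swap s x).1 * sample_weight (swap s x).2 =
  sample_weight x.1 * sample_weight x.2.
Proof.
rewrite /sample_weight -[LHS]big_split -[RHS]big_split /=; apply: eq_bigr => i _.
by rewrite !ffunE; case: (s i) => //; rewrite mulrC.
Qed.

(** [phi] plays the near-maximiser for a sample. Swapping it with a ghost sample where [s] says so
    preserves the product weight and produces the signs, but makes the chosen index depend on [s];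
    this is why the hypothesis allows an arbitrary selection [sel]. *)
Lemma symmetrization (I : Type) (F : I -> K -> R) (phi : {ffun 'I_n -> K} -> I) (rho : R) :
  (forall (a : {ffun 'I_n -> K}) (sel : {ffun 'I_n -> bool} -> I),
    (forall i, 0 < q (a i)) ->
    avg_signs (fun s => n%:R^-1 * `|signed_sum (fun i => F (sel s) (a i)) s|) <= rho) ->
  \sum_a sample_weight a *
    `|\sum_b q b * F (phi a) b - n%:R^-1 * \sum_i F (phi a) (a i)| <= 2 * rho.
Proof.
move=> hrad.
have nR : 0 < n%:R :> R by rewrite ltr0n.
pose diff k (x : {ffun 'I_n -> K} * {ffun 'I_n -> K}) i := F k (x.2 i) - F k (x.1 i).
pose W x := sample_weight x.1 * sample_weight x.2.
have W0 x : 0 <= W x by rewrite mulr_ge0 ?sample_weight_ge0.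
have meanE k : \sum_b q b * F k b = n%:R^-1 * \sum_(i < n) \sum_a sample_weight a * F k (a i).
  rewrite [X in _ = _ * X](_ : _ = \sum_(i < n) \sum_b q b * F k b); last first.
    by apply: eq_bigr => i _; exact: sample_weight_marginal.
  set S := \sum_b _.
  by rewrite sumr_const card_ord -[S *+ n]mulr_natl mulrA mulVf ?mul1r ?gt_eqF.
apply: (@le_trans _ _ (\sum_x W x * `|n%:R^-1 * \sum_i diff (phi x.1) x i|)).
  rewrite -(pair_bigA _ (fun a b => W (a, b) * `|n%:R^-1 * \sum_i diff (phi a) (a, b) i|)) /=.
  apply: ler_sum => a _; rewrite /W /=.
  under [leRHS]eq_bigr do rewrite -mulrA.
  rewrite -mulr_sumr ler_wpM2l ?sample_weight_ge0 //.
  (* The true mean is the average over a ghost sample [b]; the absolute value then moves inside. *)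
  apply: (@le_trans _ _ `|\sum_b sample_weight b * (n%:R^-1 * \sum_i diff (phi a) (a, b) i)|).
    rewrite le_eqVlt; apply/predU1P; left; congr `|_|.
    rewrite meanE exchange_big /= mulr_sumr.
    rewrite -[X in _ - X]mul1r -sample_weight_sum1 mulr_suml -sumrB.
    apply: eq_bigr => b _.
    by rewrite /diff sumrB /= mulrBr mulrBr -mulr_sumr; ring.
  apply: (le_trans (ler_norm_sum _ _ _)); apply: ler_sum => b _.
  by rewrite normrM ger0_norm // sample_weight_ge0.
pose G (s : {ffun 'I_n -> bool}) x := n%:R^-1 *
  `|signed_sum (diff (phi (swap s x).1) x) s|.
have swapE s : \sum_x W x * `|n%:R^-1 * \sum_i diff (phi x.1) x i| = \sum_x W x * G s x.
  rewrite (reindex_inj (inv_inj (swapK s))) /=; apply: eq_bigr => x _.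
  rewrite /W weight_swap; congr (_ * _).
  rewrite normrM (ger0_norm (x := n%:R^-1)) ?invr_ge0 ?ler0n //; congr (_ * `|_|).
  apply: eq_bigr => i _; rewrite /diff /swap /= !ffunE /sgb; case: (s i).
    by rewrite mul1r.
  by rewrite mulN1r opprB.
rewrite -(avg_signs_cst n (\sum_x _)).
have -> : avg_signs (fun _ : {ffun 'I_n -> bool} =>
    \sum_x W x * `|n%:R^-1 * \sum_i diff (phi x.1) x i|) =
    avg_signs (fun s => \sum_x W x * G s x).
  by rewrite /avg_signs; congr (_ * _); apply: eq_bigr => s _; exact: swapE.
rewrite avg_signs_sum.
apply: (@le_trans _ _ (\sum_x W x * (2 * rho))).
  apply: ler_sum => x _; rewrite avg_signsZ.
  have [->|W_neq0] := eqVneq (W x) 0; first by rewrite !mul0r.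
  rewrite ler_wpM2l //.
  have q0 i : 0 < q (x.1 i) /\ 0 < q (x.2 i).
    move: W_neq0; rewrite /W mulf_eq0 negb_or => /andP[/prodf_neq0 h1 /prodf_neq0 h2].
    by rewrite !lt_neqAle !q_ge0 !andbT ![0 == _]eq_sym h1 ?h2.
  apply: (@le_trans _ _ (avg_signs (fun s =>
    n%:R^-1 * `|signed_sum (fun i => F (phi (swap s x).1) (x.2 i)) s| +
    n%:R^-1 * `|signed_sum (fun i => F (phi (swap s x).1) (x.1 i)) s|))).
    apply: le_avg_signs => s; rewrite /G -mulrDr ler_wpM2l ?invr_ge0 ?ler0n //.
    by rewrite /diff signed_sumB ler_normB.
  rewrite avg_signsD mulr2n mulrDl mul1r; apply: lerD.
    by apply: (hrad x.2 (fun s => phi (swap s x).1)) => i; case: (q0 i).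
  by apply: (hrad x.1 (fun s => phi (swap s x).1)) => i; case: (q0 i).
rewrite -mulr_suml -(pair_bigA _ (fun a b => sample_weight a * sample_weight b)) /=.
under eq_bigr do rewrite -mulr_sumr sample_weight_sum1 mulr1.
by rewrite sample_weight_sum1 mul1r.
Qed.
End symmetrization.

(** * Integrals of bounded measurable functions *)

Section bounded_measurable.
Context {R : realType} {d} {T : measurableType d}.
Implicit Types (f g : T -> R) (mu : probability T R).

(** Bounded everywhere, hence integrable for every probability measure at once; the same potential
    is integrated against the law, the empirical measure and couplings. *)
Definition bmfun f := measurable_fun setT f /\ exists M, forall x, `|f x| <= M.

Lemma bmfun_cst (a : R) : bmfun (fun=> a).
Proof. by split; [exact: measurable_cst|exists `|a|]. Qed.

Lemma bmfunD f g : bmfun f -> bmfun g -> bmfun (fun x => f x + g x).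
Proof.
move=> [mf [M fM]] [mg [M' gM]]; split; first exact: measurable_funD.
by exists (M + M') => x; apply: le_trans (ler_normD _ _) _; exact: lerD.
Qed.

Lemma bmfunM f g : bmfun f -> bmfun g -> bmfun (fun x => f x * g x).
Proof.
move=> [mf [M fM]] [mg [M' gM]]; split; first exact: measurable_funM.
by exists (M * M') => x; rewrite normrM ler_pM.
Qed.

Lemma bmfunZ a f : bmfun f -> bmfun (fun x => a * f x).
Proof. exact/bmfunM/bmfun_cst. Qed.

Lemma bmfunN f : bmfun f -> bmfun (fun x => - f x).
Proof. by move=> bf; under eq_fun do rewrite -mulN1r; exact: bmfunZ. Qed.

Lemma bmfunB f g : bmfun f -> bmfun g -> bmfun (fun x => f x - g x).
Proof. by move=> bf /bmfunN; exact: bmfunD. Qed.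

Lemma bmfun_sum (I : finType) (F : I -> T -> R) :
  (forall i, bmfun (F i)) -> bmfun (fun x => \sum_i F i x).
Proof.
move=> bF; elim: (index_enum I) => [|i r IH].
  by under eq_fun do rewrite big_nil; exact: bmfun_cst.
by under eq_fun do rewrite big_cons; exact: bmfunD.
Qed.

Lemma bmfun_indic A : measurable A -> bmfun (\1_A : T -> R).
Proof.
move=> mA; split; first exact: measurable_indic.
by exists 1 => x; rewrite indicE; case: (_ \in _); rewrite ?normr1 ?normr0.
Qed.

Lemma bmfun_expR f : bmfun f -> bmfun (fun x => expR (f x)).
Proof.
move=> [mf [M fM]]; split; first exact: measurableT_comp.
by exists (expR M) => x; rewrite ger0_norm ?expR_ge0 // ler_expR (le_trans (ler_norm _)).
Qed.

Lemma bmfun_ln f m : 0 < m -> (forall x, m <= f x) -> bmfun f -> bmfun (fun x => ln (f x)).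
Proof.
move=> m0 mf [meas [M fM]]; split; first exact: measurableT_comp.
exists (`|ln m| + `|ln M|) => x.
have fx : 0 < f x := lt_le_trans m0 (mf x).
have fxM : f x <= M := le_trans (ler_norm _) (fM x).
have h1 : ln m <= ln (f x) by rewrite ler_ln ?posrE.
have h2 : ln (f x) <= ln M by rewrite ler_ln ?posrE // (lt_le_trans fx).
rewrite ler_norml; have := ler_norm (ln M); have := ler_norm (- ln m); rewrite normrN.
by have := normr_ge0 (ln m); have := normr_ge0 (ln M); lra.
Qed.

Lemma bmfun_integrable mu f : bmfun f -> mu.-integrable setT (EFin \o f).
Proof.
move=> [mf [M fM]]; apply: measurable_bounded_integrable => //.
  by apply: (le_lt_trans (probability_le1 mu measurableT)); exact: ltry.
exists M; split; first exact: num_real.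
by move=> r Mr x _; exact: le_trans (fM x) (ltW Mr).
Qed.
Hint Resolve bmfun_integrable : core.

Lemma Rintegral_EFin mu f : bmfun f -> (\int[mu]_x f x)%:E = (\int[mu]_x (f x)%:E)%E.
Proof. by move=> bf; rewrite /Rintegral fineK //; exact: integrable_fin_num (bmfun_integrable mu bf). Qed.

Lemma Rintegral_prob_cst mu (a : R) : \int[mu]_x a = a.
Proof.
rewrite Rintegral_cst // [X in _ * fine X](_ : _ = 1%E) ?mulr1 //.
exact: probability_setT.
Qed.

Lemma Rint_D mu f g : bmfun f -> bmfun g ->
  \int[mu]_x (f x + g x) = \int[mu]_x f x + \int[mu]_x g x.
Proof. by move=> bf bg; rewrite RintegralD //; exact: bmfun_integrable. Qed.

Lemma Rint_B mu f g : bmfun f -> bmfun g ->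
  \int[mu]_x (f x - g x) = \int[mu]_x f x - \int[mu]_x g x.
Proof. by move=> bf bg; rewrite RintegralB //; exact: bmfun_integrable. Qed.

Lemma Rint_Z mu a f : bmfun f -> \int[mu]_x (a * f x) = a * \int[mu]_x f x.
Proof. by move=> bf; rewrite RintegralZl //; exact: bmfun_integrable. Qed.

Lemma Rint_sum mu (I : finType) (F : I -> T -> R) : (forall i, bmfun (F i)) ->
  \int[mu]_x (\sum_i F i x) = \sum_i \int[mu]_x F i x.
Proof.
move=> bF; suff : bmfun (fun x => \sum_i F i x) /\
  \int[mu]_x (\sum_i F i x) = \sum_i \int[mu]_x F i x by case.
elim: (index_enum I) => [|i r [bS IH]].
  split; first by under eq_fun do rewrite big_nil; exact: bmfun_cst.
  by under eq_Rintegral do rewrite big_nil; rewrite big_nil Rintegral_prob_cst.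
split; first by under eq_fun do rewrite big_cons; exact: bmfunD.
by under eq_Rintegral do rewrite big_cons; rewrite big_cons Rint_D // IH.
Qed.

Lemma Rint_indic mu A : measurable A -> \int[mu]_x \1_A x = fine (mu A).
Proof. by move=> mA; rewrite /Rintegral integral_indic // setIT. Qed.

Lemma Rint_le mu (B : set T) f g : measurable B -> mu B = 1%E ->
  bmfun f -> bmfun g -> (forall x, B x -> f x <= g x) ->
  \int[mu]_x f x <= \int[mu]_x g x.
Proof.
move=> mB muB bf bg fg.
have muBC : mu (~` B) = 0%E by rewrite probability_setC // muB subee.
have res h : bmfun h -> \int[mu]_x h x = \int[mu]_(x in B) h x.
  move=> bh; rewrite /Rintegral (negligible_integral (N := ~` B)) //.
  - by rewrite setTD setCK.
  - exact: measurableC.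
  - exact: bmfun_integrable.
rewrite !res //; apply: le_Rintegral => //.
- by apply: integrableS (bmfun_integrable mu bf).
- by apply: integrableS (bmfun_integrable mu bg).
Qed.

Lemma Rint_eq mu (B : set T) f g : measurable B -> mu B = 1%E ->
  bmfun f -> bmfun g -> (forall x, B x -> f x = g x) ->
  \int[mu]_x f x = \int[mu]_x g x.
Proof.
move=> mB muB bf bg fg; apply/eqP; rewrite eq_le.
by rewrite !(Rint_le mB muB) // => x /fg ->.
Qed.

End bounded_measurable.

Section discrete_integral.
Context {R : realType} {d} {T : measurableType d} {N : nat}.
Variables (w : simplex R N) (y : 'I_N -> T).

Let w0 i : 0 <= w i. Proof. by case/andP: (weight01 w i). Qed.

Let atom (k : nat) : {measure set T -> \bar R} :=
  match insub k : option 'I_N with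
  | Some i => mscale (NngNum (w0 i)) (dirac (y i))
  | None => mzero
  end.

Lemma ge0_integral_discrete (f : T -> \bar R) : measurable_fun setT f ->
  (forall x, 0 <= f x)%E ->
  (\int[discrete_prob w y]_x f x = \sum_(i < N) (w i)%:E * f (y i))%E.
Proof.
move=> mf f0.
have -> : (\int[discrete_prob w y]_x f x = \int[msum atom N]_x f x)%E.
  apply: eq_measure_integral => A mA _; rewrite /discrete_prob /msum /=.
  by apply: eq_bigr => i _; rewrite /atom valK.
rewrite ge0_integral_measure_sum //; apply: eq_bigr => i _.
rewrite /atom valK ge0_integral_mscale // integral_dirac //.
by rewrite diracT mul1e.
Qed.

Lemma Rint_discrete (f : T -> R) : bmfun f ->
  \int[discrete_prob w y]_x f x = \sum_(i < N) w i * f (y i).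
Proof.
move=> bf; have [mf [M fM]] := bf.
have h (g : T -> R) : bmfun g -> (forall x, 0 <= g x) ->
    \int[discrete_prob w y]_x g x = \sum_(i < N) w i * g (y i).
  move=> [mg _] g0; rewrite /Rintegral ge0_integral_discrete //.
  - by rewrite (eq_bigr (fun i => (w i * g (y i))%:E)) ?sumEFin // => i _; rewrite EFinM.
  - exact/measurable_EFinP.
have bM : bmfun (fun x => f x + M) by apply: bmfunD => //; exact: bmfun_cst.
have fM0 x : 0 <= f x + M by have := fM x; rewrite ler_norml => /andP[]; lra.
have := h _ bM fM0; rewrite Rint_D //; last exact: bmfun_cst.
rewrite Rintegral_prob_cst => E.
apply: (addIr M); rewrite E.
under eq_bigr do rewrite mulrDr.
by rewrite big_split /= -mulr_suml weight_sum1 mul1r.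
Qed.

End discrete_integral.

(** * Domination of the empirical process *)

Section empirical_process.
Context {R : realType} {d} {T : measurableType d} {d'} {Omega : measurableType d'}.
Variables (P : probability Omega R) (n : nat) (X : 'I_n -> {RV P >-> T}).
Variables (mu : probability T R) (B : set T) (I : Type) (F : I -> T -> R) (rho : R).
Hypothesis n_gt0 : (0 < n)%N.
Hypothesis iidX : iid_with_law X mu.
Hypothesis mB : measurable B.
Hypothesis muB : mu B = 1%E.
Hypothesis mF : forall i, measurable_fun setT (F i).
Variables (M : R) (i0 : I).
Hypothesis F_bound : forall i x, `|F i x| <= M.
Hypothesis F_osc : forall eta, 0 < eta -> exists (K : finType) (lab : T -> K),
  (forall k, measurable (B `&` lab @^-1` [set k])) /\
  (forall i x x', B x -> B x' -> lab x = lab x' -> `|F i x - F i x'| <= eta).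
Hypothesis F_rademacher :
  forall (x : 'I_n -> T) (sel : {ffun 'I_n -> bool} -> I), (forall j, B (x j)) ->
  avg_signs (fun s => n%:R^-1 * `|signed_sum (fun j => F (sel s) (x j)) s|) <= rho.

Let bF i : bmfun (F i). Proof. by split; [exact: mF|exists M]. Qed.

(* The class is not assumed countable and its supremum need not be measurable;
   it is dominated by the measurable function [Z]. *)
Lemma empirical_process (eta : R) : 0 < eta -> exists Z : Omega -> \bar R,
  [/\ measurable_fun setT Z, (forall w, 0 <= Z w)%E,
    (\int[P]_w Z w <= (2 * rho + eta)%:E)%E &
    forall w, Z w = +oo%E \/ ((forall j, B (X j w)) /\ forall i,
      (`|\int[mu]_x F i x - n%:R^-1 * \sum_j F i (X j w)|%:E <= Z w)%E)].
Proof.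
move=> eta0; pose e := eta / 4; have e0 : 0 < e by rewrite divr_gt0.
have [K [lab [mA osc]]] := F_osc e0.
pose A k := B `&` lab @^-1` [set k].
pose q k := fine (mu (A k)).
have nR : 0 < n%:R :> R by rewrite ltr0n.
have M0 : 0 <= M.
  have [x _] : exists x, B x.
    apply/set0P; apply/eqP => B0; move: muB; rewrite B0 measure0 => /eqP.
    by rewrite eq_sym onee_eq0.
  exact: le_trans (normr_ge0 _) (F_bound i0 x).
have [x0 Bx0] : exists x, B x.
  apply/set0P; apply/eqP => B0; move: muB; rewrite B0 measure0 => /eqP.
  by rewrite eq_sym onee_eq0.
(* An empty cell still gets a point of [B], so the Rademacher hypothesis applies to every
   discretised sample. *)
have /choice[xr hxr] k : exists x, B x /\ (A k !=set0 -> lab x = k).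
  have [[x [Bx /= <-]]|nA] := pselect (A k !=set0); first by exists x.
  by exists x0.
have muA k : mu (A k) = (q k)%:E by rewrite /q fineK // fin_num_measure //; exact: mA.
have q0 k : 0 <= q k by rewrite fine_ge0.
have bA (c : R) k : bmfun (fun x => c * \1_(A k) x) by apply/bmfunZ/bmfun_indic/mA.
have stepE (c : K -> R) x : B x -> \sum_k c k * \1_(A k) x = c (lab x).
  move=> Bx; rewrite (bigD1 (lab x)) //= indicE mem_set // mulr1 big1 ?addr0 // => k kx.
  rewrite indicE memNset ?mulr0 // => -[_ /= E]; by rewrite -E eqxx in kx.
have intE (c : K -> R) : \int[mu]_x (\sum_k c k * \1_(A k) x) = \sum_k q k * c k.
  rewrite Rint_sum //; apply: eq_bigr => k _.
  rewrite Rint_Z; last exact/bmfun_indic/mA.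
  by rewrite Rint_indic; [rewrite mulrC|exact: mA].
have q1 : \sum_k q k = 1.
  rewrite -(Rintegral_prob_cst mu 1) -[LHS](eq_bigr _ (fun k _ => mulr1 (q k))) -intE.
  apply: (Rint_eq mB muB); [exact: bmfun_sum|exact: bmfun_cst|].
  by move=> x Bx; exact: (stepE (fun=> 1)).
have oscr i x : B x -> `|F i x - F i (xr (lab x))| <= e.
  move=> Bx; have [Br lr] := hxr (lab x); apply: osc => //.
  by rewrite lr //; exists x.
have mean i : `|\int[mu]_x F i x - \sum_b q b * F i (xr b)| <= e.
  rewrite -intE -Rint_B //; last exact: bmfun_sum.
  have bD : bmfun (fun x => F i x - \sum_k F i (xr k) * \1_(A k) x).
    by apply: bmfunB => //; exact: bmfun_sum.
  rewrite ler_norml -(Rintegral_prob_cst mu e) -(Rintegral_prob_cst mu (- _)).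
  rewrite !Rintegral_prob_cst -[X in X <= _ <= _](Rintegral_prob_cst mu).
  rewrite -[X in _ <= _ <= X](Rintegral_prob_cst mu).
  rewrite !(Rint_le mB muB) //; try exact: bmfun_cst.
  - by move=> x Bx; rewrite stepE //; have := oscr i x Bx; rewrite ler_norml => /andP[].
  - by move=> x Bx; rewrite stepE //; have := oscr i x Bx; rewrite ler_norml => /andP[].
pose val (a : {ffun 'I_n -> K}) i :=
  `|\sum_b q b * F i (xr b) - n%:R^-1 * \sum_j F i (xr (a j))|.
pose Zc a := sup [set val a i | i in setT].
have hs a : has_sup [set val a i | i in setT].
  split; first by exists (val a i0), i0.
  exists (2 * M) => _ [i _ <-]; rewrite /val mulr2n mulrDl mul1r.
  apply: (le_trans (ler_normB _ _)); apply: lerD.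
    apply: (le_trans (ler_norm_sum _ _ _)).
    apply: (@le_trans _ _ (\sum_b q b * M)); last by rewrite -mulr_suml q1 mul1r.
    by apply: ler_sum => b _; rewrite normrM (ger0_norm (q0 b)) ler_wpM2l.
  rewrite normrM ger0_norm ?invr_ge0 ?ler0n // ler_pdivrMl //.
  apply: (le_trans (ler_norm_sum _ _ _)).
  by apply: ler_sum_const => j.
have valZ a i : val a i <= Zc a by apply: ub_le_sup; [case: (hs a)|exists i].
have Zc0 a : 0 <= Zc a by exact: le_trans (normr_ge0 _) (valZ a i0).
have /choice[phi hphi] a : exists i, Zc a - e <= val a i.
  have [_ [i _ <-] h] := sup_adherent e0 (hs a).
  by exists i; exact: ltW.
have sumZ : \sum_a sample_weight q a * Zc a <= 2 * rho + e.
  have := @symmetrization R K n q n_gt0 q0 q1 I (fun i b => F i (xr b)) phi rho.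
  move=> /(_ _)/Wrap[a sel _|hsym].
    by apply: F_rademacher => j; case: (hxr (a j)).
  apply: (@le_trans _ _ (\sum_a (sample_weight q a * val a (phi a) + sample_weight q a * e))).
    apply: ler_sum => a _; rewrite -mulrDr ler_wpM2l ?sample_weight_ge0 //.
    by have := hphi a; lra.
  by rewrite big_split /= -mulr_suml sample_weight_sum1 // mul1r lerD2r.
pose E (a : {ffun 'I_n -> K}) := \big[setI/setT]_(j in [set: 'I_n]%SET) (X j @^-1` A (a j)).
pose O := \big[setI/setT]_(j in [set: 'I_n]%SET) (X j @^-1` B).
have mbig (C : 'I_n -> set T) : (forall j, measurable (C j)) ->
    measurable (\big[setI/setT]_(j in [set: 'I_n]%SET) (X j @^-1` C j)).
  move=> mC; apply: big_ind => //; first exact: measurableI.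
  by move=> j _; rewrite -[X in measurable X]setTI; exact: measurable_funPT.
have inbig (C : 'I_n -> set T) w : (\big[setI/setT]_(j in [set: 'I_n]%SET) (X j @^-1` C j)) w <->
    forall j, C j (X j w).
  rewrite -bigcap_seq_cond; split=> [h j|h j _]; last exact: h.
  by apply: (h j) => /=; rewrite mem_index_enum inE.
have Pbig (C : 'I_n -> set T) : (forall j, measurable (C j)) ->
    (P (\big[setI/setT]_(j in [set: 'I_n]%SET) (X j @^-1` C j)) = \prod_j mu (C j))%E.
  move=> mC; have [ind law] := iidX; rewrite ind //.
  by apply: eq_big => [j|j _]; [rewrite inE|exact: (law j _ (mC j))].
have PE a : fine (P (E a)) = sample_weight q a.
  rewrite Pbig; last by move=> j; exact: mA.
  under eq_bigr do rewrite muA.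
  by rewrite -(big_morph EFin (@EFinM R) erefl).
have PO : P O = 1%E by rewrite Pbig // big1 // => j _; exact: muB.
have mO : measurable O by exact: mbig.
have PNO : P (~` O) = 0%E by rewrite probability_setC // PO subee.
have mE a : measurable (E a) by apply: mbig => j; exact: mA.
(* One [e] for discretising the mean and one for the sample; with the [e] of the near-maximiser the
   total is [3 e], below [eta = 4 e]. *)
pose step w := \sum_a Zc a * \1_(E a) w + 2 * e.
have bstep : bmfun step.
  apply: bmfunD; last exact: bmfun_cst.
  by apply: bmfun_sum => a; exact/bmfunZ/bmfun_indic.
have step0 w : 0 <= step w.
  apply: addr_ge0; last by rewrite mulr_ge0 // ltW.
  by apply: sumr_ge0 => a _; rewrite mulr_ge0 // indicE.
have stepint : \int[P]_w step w <= 2 * rho + eta.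
  rewrite Rint_D; [|by apply: bmfun_sum => a; exact/bmfunZ/bmfun_indic|exact: bmfun_cst].
  rewrite Rintegral_prob_cst Rint_sum; last by move=> a; exact/bmfunZ/bmfun_indic.
  rewrite (eq_bigr (fun a => sample_weight q a * Zc a)).
    by move: sumZ; rewrite /e; lra.
  move=> a _; rewrite Rint_Z; last exact/bmfun_indic.
  by rewrite Rint_indic // PE mulrC.
(* Where some sample point leaves [B] nothing is controlled, so the bound is infinite there; that
   event is null, and [+oo * 0 = 0] elsewhere. *)
pose Z w := ((step w)%:E + +oo * (\1_(~` O) w)%:E)%E.
have ind0 (C : set Omega) w : (0 <= (\1_C w : R)%:E)%E by rewrite lee_fin indicE.
have mZ : measurable_fun setT Z.
  apply: emeasurable_funD; first by apply/measurable_EFinP; case: bstep.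
  apply: emeasurable_funM => //; apply/measurable_EFinP.
  by apply: measurable_indic; exact: measurableC.
have Z0 w : (0 <= Z w)%E by rewrite adde_ge0 ?lee_fin // mule_ge0.
have ZO w : O w -> Z w = (step w)%:E.
  by move=> Ow; rewrite /Z indicE memNset ?mule0 ?adde0 // => /(_ Ow).
exists Z; split => //.
- rewrite (@ge0_negligible_integral _ _ _ P setT (~` O) Z (measurableC mO) measurableT mZ (fun x _ => Z0 x) PNO).
  rewrite setTD setCK; apply: (@le_trans _ _ (\int[P]_(w in O) (step w)%:E)%E).
    rewrite le_eqVlt; apply/predU1P; left; apply: eq_integral => w.
    by rewrite inE => Ow; exact: ZO.
  apply: (@le_trans _ _ (\int[P]_w (step w)%:E)%E).
    apply: ge0_subset_integral => //; first by apply/measurable_EFinP; case: bstep.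
    by move=> w _; rewrite lee_fin.
  by rewrite -Rintegral_EFin // lee_fin.
- move=> w; have [Ow|nO] := pselect (O w); last first.
    by left; rewrite /Z indicE mem_set // mule1 addey // -ltNye ltNyr.
  right; have BX : forall j, B (X j w) by apply/(inbig (fun=> B)).
  split=> // i; rewrite ZO // lee_fin.
  pose a0 : {ffun 'I_n -> K} := [ffun j => lab (X j w)].
  have -> : step w = Zc a0 + 2 * e.
    congr (_ + _); rewrite (bigD1 a0) //= indicE mem_set ?mulr1.
      rewrite big1 ?addr0 // => a aa0; rewrite indicE memNset ?mulr0 //.
      move=> /(inbig (fun j => A (a j))) h; case/eqP: aa0; apply/ffunP => j; rewrite ffunE.
      by have [_ /= ->] := h j.
    by apply/(inbig (fun j => A (a0 j))) => j; rewrite ffunE.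
  have h1 := mean i; have h2 := valZ a0 i.
  have h3 : `|n%:R^-1 * \sum_j F i (X j w) - n%:R^-1 * \sum_j F i (xr (a0 j))| <= e.
    rewrite -mulrBr normrM ger0_norm ?invr_ge0 ?ler0n // ler_pdivrMl // -sumrB.
    apply: (le_trans (ler_norm_sum _ _ _)); apply: ler_sum_const => j.
    by rewrite ffunE; exact: oscr.
  move: h2; rewrite /val.
  set x1 := \int[mu]_x _ in h1 *; set x2 := \sum_b _ in h1 *; set x3 := _ * _ in h3 *.
  set x4 := n%:R^-1 * _ in h3 *.
  have -> : x1 - x3 = (x1 - x2) + (x2 - x4) - (x3 - x4) by ring.
  move=> h2; apply: (le_trans (ler_normB _ _)).
  have := ler_normD (x1 - x2) (x2 - x4); lra.
Qed.
End empirical_process.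

(** * Duality for discrete targets *)

Section schroedinger.
Context {R : realType} {d} {T : measurableType d}.
Variables (mu : probability T R) (N : nat) (w : simplex R N) (y : 'I_N -> T).
Variables (c : T -> T -> R) (M eps : R).
Hypothesis mc : measurable_fun setT (fun z : T * T => c z.1 z.2).
Hypothesis c_ge0 : forall x x', 0 <= c x x'.
Hypothesis c_le : forall x x', c x x' <= M.
Hypothesis eps_gt0 : 0 < eps.

Let w0 a : 0 <= w a. Proof. by case/andP: (weight01 w a). Qed.
Let w1 : \sum_a w a = 1. Proof. exact: weight_sum1. Qed.

Let a0 : 'I_N.
Proof.
case: (pickP (fun _ : 'I_N => true)) => // h; exfalso.
move: w1; rewrite big1 => [/eqP|a _]; first by rewrite eq_sym oner_eq0.
by have := h a.
Qed.

Let M0 : 0 <= M. Proof. exact: le_trans (c_ge0 (y a0) (y a0)) (c_le _ _). Qed.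

Lemma bmfun_cost_left x' : bmfun (fun x => c x x').
Proof.
split; last by exists M => x; rewrite ger0_norm.
exact: (measurableT_comp mc (measurable_pair2 x')).
Qed.

Definition soft_potential (psi : 'I_N -> R) (x : T) : R :=
  softmin eps w (fun a => c x (y a) - psi a).

Lemma bmfun_soft_potential psi : bmfun (soft_potential psi).
Proof.
pose K := M + \sum_a `|psi a|.
have h x a : c x (y a) - psi a <= K.
  apply: lerD => //; apply: le_trans (ler_norm _) _; rewrite normrN (bigD1 a) //= lerDl.
  exact: sumr_ge0.
apply/bmfunN/bmfunZ/(@bmfun_ln _ _ _ _ (expR (- (K / eps)))).
- exact: expR_gt0.
- by move=> x; apply: softmin_sum_ge.
- apply: bmfun_sum => a; apply/bmfunZ/bmfun_expR/bmfunN.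
  under eq_fun do rewrite mulrC.
  by apply/bmfunZ/bmfunB; [exact: bmfun_cost_left|exact: bmfun_cst].
Qed.

(** The Gibbs density built from the soft potential has mass 1 at each [x]: the first marginal is
    right for any prices. *)
Lemma soft_potential_mass psi x :
  \sum_a w a * expR ((soft_potential psi x + psi a - c x (y a)) / eps) = 1.
Proof.
rewrite /soft_potential /softmin.
have := softmin_sum_gt0 eps_gt0 (fun a => c x (y a) - psi a) w0 w1.
set Z := \sum_a _ => Z0.
rewrite (eq_bigr (fun a => Z^-1 * (w a * expR (- ((c x (y a) - psi a) / eps))))).
  by rewrite -mulr_sumr mulVf ?gt_eqF.
move=> a _; rewrite [RHS]mulrCA; congr (_ * _).
rewrite -[X in _ = X^-1 * _](lnK (x := Z)) ?posrE // -expRN -expRD; congr expR.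
by field; rewrite gt_eqF.
Qed.

Lemma soft_potential_shift psi s x :
  soft_potential (fun a => psi a - s) x = soft_potential psi x + s.
Proof.
rewrite /soft_potential; apply/eqP; rewrite eq_le; apply/andP; split.
  by apply: softmin_le_shift => // a; lra.
by rewrite -lerBrDr; apply: softmin_le_shift => // a; lra.
Qed.

Lemma soft_potential_lipschitz psi psi' h x : (forall a, `|psi a - psi' a| <= h) ->
  `|soft_potential psi x - soft_potential psi' x| <= h.
Proof.
move=> hh; rewrite ler_norml; apply/andP; split.
  rewrite lerNl opprB lerBlDl; apply: softmin_le_shift => // a.
  by have := hh a; rewrite ler_norml => /andP[]; lra.
rewrite lerBlDl; apply: softmin_le_shift => // a.
by have := hh a; rewrite ler_norml => /andP[]; lra.
Qed.

Definition dual_value psi : R :=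
  \int[mu]_x soft_potential psi x + \sum_a w a * psi a.

Lemma dual_value_shift psi s : dual_value (fun a => psi a - s) = dual_value psi.
Proof.
rewrite /dual_value; under eq_Rintegral do rewrite soft_potential_shift.
rewrite Rint_D ?Rintegral_prob_cst; [|exact: bmfun_soft_potential|exact: bmfun_cst].
under [X in _ + X = _]eq_bigr do rewrite mulrBr.
by rewrite sumrB -mulr_suml w1; ring.
Qed.

Lemma dual_value_lipschitz psi psi' h : (forall a, `|psi a - psi' a| <= h) ->
  `|dual_value psi - dual_value psi'| <= h + h.
Proof.
move=> hh; rewrite /dual_value.
have -> : forall a b c d : R, a + b - (c + d) = (a - c) + (b - d) by move=> *; ring.
apply: (le_trans (ler_normD _ _)); apply: lerD.
  have bs p := bmfun_soft_potential p.
  rewrite -Rint_B // ler_norml -[in X in _ && X](Rintegral_prob_cst mu h).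
  rewrite -[- h](Rintegral_prob_cst mu); apply/andP; split.
    apply: (Rint_le (B := setT)) => //; try exact: probability_setT.
    + exact: bmfun_cst.
    + exact: bmfunB.
    + by move=> x _; have := soft_potential_lipschitz x hh; rewrite ler_norml => /andP[].
  apply: (Rint_le (B := setT)) => //; try exact: probability_setT.
  + exact: bmfunB.
  + exact: bmfun_cst.
  + by move=> x _; have := soft_potential_lipschitz x hh; rewrite ler_norml => /andP[].
rewrite -sumrB; apply: (le_trans (ler_norm_sum _ _ _)).
apply: (@le_trans _ _ (\sum_a w a * h)); last by rewrite -mulr_suml w1 mul1r.
by apply: ler_sum => a _; rewrite -mulrBr normrM ger0_norm // ler_wpM2l.
Qed.

(** Maximality over the box is enough: the dual is invariant under shifts, and a Sinkhorn update has
    oscillation at most [M], so it can be shifted into the box. *)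
Lemma dual_maximizer : exists psi : 'I_N -> R, forall psi',
  (forall a, -M <= psi' a <= M) -> dual_value psi' <= dual_value psi.
Proof.
pose A : set 'rV[R]_N := [set v | forall a, `[- M, M]%classic (v ord0 a)].
have cA : compact A by apply: (@rV_compact R N (fun=> `[- M, M]%classic)) => a; exact: segment_compact.
pose J (v : 'rV[R]_N) := dual_value (v 0).
have A0 : A !=set0.
  by exists 0 => a; rewrite /= mxE in_itv /= oppr_le0 M0.
have cJ : continuous J.
  move=> v; apply/(@cvgrPdist_lt _ _ _ (nbhs v) (nbhs_filter v)) => e e0 /=.
  apply/nbhs_ballP; exists (e / 3) => /=; first by rewrite divr_gt0.
  move=> v' [_ vv']; rewrite /J.
  have : `|dual_value (v 0) - dual_value (v' 0)| <= e / 3 + e / 3.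
    by apply: dual_value_lipschitz => a; have := vv' 0 a; rewrite /ball /= => /ltW.
  lra.
have [v vA vmax] := EVT_max_rV A0 cA (continuous_subspaceT cJ).
exists (v 0) => psi' hpsi'.
have /= := vmax (\row_a psi' a); rewrite /J.
have -> : (\row_a psi' a) 0 = psi' by apply/funext => a; rewrite mxE.
by apply; rewrite inE => a /=; rewrite mxE in_itv /= hpsi'.
Qed.

(** Normalises the mass at every [x'] of the space, not only at the atoms. *)
Definition sinkhorn (f : T -> R) (x' : T) : R :=
  - (eps * ln (\int[mu]_x expR ((f x - c x x') / eps))).

Section sinkhorn.
Variable f : T -> R.
Hypothesis bf : bmfun f.

Let bexp x' : bmfun (fun x => expR ((f x - c x x') / eps)).
Proof.
apply: bmfun_expR; under eq_fun do rewrite mulrC.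
by apply/bmfunZ/bmfunB => //; exact: bmfun_cost_left.
Qed.

Let mass x' := \int[mu]_x expR ((f x - c x x') / eps).

Let mass_bounds : exists2 m, 0 < m & exists K, forall x', m <= mass x' <= K.
Proof.
have [_ [K fK]] := bf.
exists (expR ((- K - M) / eps)); first exact: expR_gt0.
exists (expR (K / eps)) => x'.
rewrite -[leLHS](Rintegral_prob_cst mu) -[in X in _ && X](Rintegral_prob_cst mu (expR _)).
have fx x : - K <= f x <= K by rewrite -ler_norml.
apply/andP; split; apply: (Rint_le (B := setT)) => //; try exact: probability_setT;
  try exact: bmfun_cst.
  by move=> x _; rewrite ler_expR ler_pM2r ?invr_gt0 //; have := fx x; have := c_le x x'; lra.
by move=> x _; rewrite ler_expR ler_pM2r ?invr_gt0 //; have := fx x; have := c_ge0 x x'; lra.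
Qed.

Let mass_gt0 x' : 0 < mass x'.
Proof. by have [m m0 [K mK]] := mass_bounds; case/andP: (mK x') => /(lt_le_trans m0). Qed.

Lemma bmfun_sinkhorn : bmfun (sinkhorn f).
Proof.
have [m m0 [K mK]] := mass_bounds.
apply/bmfunN/bmfunZ/(@bmfun_ln _ _ _ _ m) => //; first by move=> x'; case/andP: (mK x').
split; last first.
  exists K => x'; rewrite ger0_norm; first by case/andP: (mK x').
  exact: ltW (mass_gt0 x').
apply/measurable_EFinP.
have -> : EFin \o (fun x' => \int[mu]_x expR ((f x - c x x') / eps)) =
    (fun x' => \int[mu]_x (expR ((f x - c x x') / eps))%:E)%E.
  by apply/funext => x' /=; rewrite Rintegral_EFin.
apply: (@measurable_fun_fubini_tonelli_G _ _ _ _ _ mu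
  (fun z => (expR ((f z.1 - c z.1 z.2) / eps))%:E)) => [|z]; last by rewrite lee_fin expR_ge0.
apply/measurable_EFinP/measurableT_comp => //.
apply: measurable_funM => //; apply: measurable_funB => //.
exact: (measurableT_comp bf.1 measurable_fst).
Qed.

Lemma sinkhorn_mass x' : \int[mu]_x expR ((f x + sinkhorn f x' - c x x') / eps) = 1.
Proof.
have h x : expR ((f x + sinkhorn f x' - c x x') / eps) =
    (mass x')^-1 * expR ((f x - c x x') / eps).
  rewrite -[X in _ = X^-1 * _](lnK (x := mass x')) ?posrE // -expRN -expRD; congr expR.
  by rewrite /sinkhorn -/(mass x'); field; rewrite gt_eqF.
by under eq_Rintegral do rewrite h; rewrite Rint_Z // mulVf ?gt_eqF.
Qed.

Lemma sinkhorn_osc x1 x2 : sinkhorn f x1 - sinkhorn f x2 <= M.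
Proof.
rewrite /sinkhorn opprK addrC -mulrBr -ler_pdivlMl //.
rewrite lerBlDl -[X in _ + X]expRK -lnM ?posrE ?expR_gt0 ?mass_gt0 //.
rewrite ler_ln ?posrE ?mulr_gt0 ?expR_gt0 ?mass_gt0 // mulrC -Rint_Z //.
apply: (Rint_le (B := setT)) => //; try exact: probability_setT.
  exact: bmfunZ.
move=> x _; rewrite -expRD ler_expR [eps^-1 * M]mulrC -mulrDl ler_pM2r ?invr_gt0 //.
have := c_le x x1; have := c_ge0 x x2; lra.
Qed.

End sinkhorn.

Lemma ln_eq_sub1 (q : R) : 0 < q -> q - 1 <= ln q -> q = 1.
Proof.
move=> q0 h; have [l0|l0] := eqVneq (ln q) 0.
  by rewrite -(lnK (x := q)) ?posrE // l0 expR0.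
by have := expR_gt1Dx l0; rewrite lnK ?posrE //; lra.
Qed.

(* Starting from a maximiser [psi] of the dual, one Sinkhorn step does not
   increase the dual value any further, which forces the second marginal to be
   right: [psi] already equals its Sinkhorn update where [w] is positive. *)
Lemma schroedinger : exists (f psi : T -> R),
  [/\ bmfun f, bmfun psi,
      (forall x, f x = soft_potential (fun a => psi (y a)) x),
      (forall x', \int[mu]_x expR ((f x + psi x' - c x x') / eps) = 1) &
      (forall x1 x2, psi x1 - psi x2 <= M)].
Proof.
have [p pmax] := dual_maximizer.
pose f := soft_potential p; have bf : bmfun f := bmfun_soft_potential p.
have bgap k x' : bmfun (fun x => expR ((f x + k - c x x') / eps)).
  apply: bmfun_expR; under eq_fun do rewrite mulrC.
  apply/bmfunZ/bmfunB; last exact: bmfun_cost_left.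
  by apply: bmfunD => //; exact: bmfun_cst.
pose psi := sinkhorn f.
pose q a := \int[mu]_x expR ((f x + p a - c x (y a)) / eps).
have bq a : bmfun (fun x => expR ((f x + p a - c x (y a)) / eps)).
  exact: bgap.
have psiE a : expR ((p a - psi (y a)) / eps) = q a.
  rewrite /q; have h x : expR ((f x + p a - c x (y a)) / eps) =
      expR ((p a - psi (y a)) / eps) * expR ((f x + psi (y a) - c x (y a)) / eps).
    by rewrite -expRD; congr expR; field; rewrite gt_eqF.
  under eq_Rintegral do rewrite h.
  rewrite Rint_Z ?sinkhorn_mass ?mulr1 //.
have q0 a : 0 < q a by rewrite -psiE expR_gt0.
have lnq a : psi (y a) = p a - eps * ln (q a).
  by rewrite -psiE expRK; field; rewrite gt_eqF.
have sumq : \sum_a w a * q a = 1.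
  rewrite -[RHS](Rintegral_prob_cst mu).
  transitivity (\int[mu]_x \sum_a w a * expR ((f x + p a - c x (y a)) / eps)).
    rewrite Rint_sum; last by move=> a; exact: bmfunZ.
    by apply: eq_bigr => a _; rewrite Rint_Z.
  by apply: eq_Rintegral => x _; exact: soft_potential_mass.
pose g := soft_potential (fun a => psi (y a)).
have bg : bmfun g := bmfun_soft_potential _.
(* Here [g = f - eps * ln S] with [S] of integral 1; the bound [ln S <= S - 1] concludes. *)
have fg : \int[mu]_x f x <= \int[mu]_x g x.
  pose S x := \sum_a w a * expR ((f x + psi (y a) - c x (y a)) / eps).
  have bS : bmfun S.
    by apply: bmfun_sum => a; apply: bmfunZ; exact: bgap.
  have intS : \int[mu]_x S x = 1.
    rewrite Rint_sum; last first.
      by move=> a; apply: bmfunZ; exact: bgap.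
    rewrite -w1; apply: eq_bigr => a _.
    rewrite Rint_Z ?sinkhorn_mass ?mulr1 //.
  have gE x : g x = f x - eps * ln (S x).
    rewrite /g /soft_potential /softmin.
    have := softmin_sum_gt0 eps_gt0 (fun a => c x (y a) - psi (y a)) w0 w1.
    set Z := \sum_a _ => Z0.
    have -> : S x = expR (f x / eps) * Z.
      rewrite /S /Z mulr_sumr; apply: eq_bigr => a _; rewrite [RHS]mulrCA -expRD.
      by congr (_ * expR _); field; rewrite gt_eqF.
    by rewrite lnM ?posrE ?expR_gt0 // expRK; field; rewrite gt_eqF.
  have S0 x : 0 < S x.
    have := softmin_sum_gt0 eps_gt0 (fun a => c x (y a) - psi (y a)) w0 w1.
    set Z := \sum_a _ => Z0; have -> : S x = expR (f x / eps) * Z.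
      rewrite /S /Z mulr_sumr; apply: eq_bigr => a _; rewrite [RHS]mulrCA -expRD.
      by congr (_ * expR _); field; rewrite gt_eqF.
    by rewrite mulr_gt0 ?expR_gt0.
  have : \int[mu]_x (f x + eps * (1 - S x)) <= \int[mu]_x g x.
    apply: (Rint_le (B := setT)) => //; try exact: probability_setT.
      by apply: bmfunD => //; apply/bmfunZ/bmfunB => //; exact: bmfun_cst.
    move=> x _; rewrite gE lerD2l -mulrN ler_pM2l //.
    have : -1 < S x - 1 by have := S0 x; lra.
    by move/le_ln1Dx; rewrite subrKC; lra.
  have b1S : bmfun (fun x => 1 - S x) by apply: bmfunB => //; exact: bmfun_cst.
  rewrite (Rint_D mu bf (bmfunZ eps b1S)) (Rint_Z mu eps b1S).
  by rewrite (Rint_B mu (bmfun_cst 1) bS) Rintegral_prob_cst intS subrr mulr0 addr0.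
have osc x1 x2 : psi x1 - psi x2 <= M by exact: sinkhorn_osc.
have := pmax (fun a => psi (y a) - psi (y a0)).
rewrite dual_value_shift => hmax.
have {}hmax : dual_value (fun a => psi (y a)) <= dual_value p.
  apply: hmax => a; rewrite osc andbT lerNl opprB; exact: osc.
(* The update changes the prices by [- eps * ln (q a)] and does not lower the first integral, so
   maximality forces a nonnegative mean of [ln q]. As [q] has mean 1, every term here vanishes where
   [w] is positive. *)
have gain : \sum_a w a * (q a - 1 - ln (q a)) <= 0.
  move: hmax; rewrite /dual_value -/g -/f => hmax.
  have : \sum_a w a * psi (y a) <= \sum_a w a * p a.
    by rewrite -(lerD2l (\int[mu]_x g x)); apply: (le_trans hmax); rewrite lerD2r.
  under eq_bigr do rewrite lnq mulrBr.
  rewrite sumrB gerBl => h.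
  under eq_bigr do rewrite mulrBr mulrBr mulr1.
  rewrite !sumrB sumq w1 subrr sub0r oppr_le0.
  move: h; rewrite (eq_bigr (fun a => eps * (w a * ln (q a)))); last by move=> a _; ring.
  by rewrite -mulr_sumr pmulr_rge0.
have term0 a : 0 <= w a * (q a - 1 - ln (q a)).
  rewrite mulr_ge0 // subr_ge0.
  have : -1 < q a - 1 by have := q0 a; lra.
  by move/le_ln1Dx; rewrite subrKC.
have eqw a : w a = 0 \/ psi (y a) = p a.
  have [->|wa] := eqVneq (w a) 0; [by left|right].
  have : \sum_a w a * (q a - 1 - ln (q a)) = 0.
    by apply/eqP; rewrite eq_le gain sumr_ge0.
  move/psumr_eq0P => /(_ (fun a _ => term0 a)) /(_ a isT) /eqP.
  rewrite mulf_eq0 (negbTE wa) /= subr_eq0 => /eqP h.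
  have -> : psi (y a) = p a - eps * ln (q a) by [].
  by rewrite (ln_eq_sub1 (q0 a)) ?h // ln1 mulr0 subr0.
exists f, psi; split => //; first exact: bmfun_sinkhorn.
- move=> x; rewrite /f /soft_potential /softmin; congr (- (_ * ln _)).
  by apply: eq_bigr => a _; have [->|->] := eqw a; rewrite ?mul0r.
- by move=> x'; exact: sinkhorn_mass.
Qed.

End schroedinger.

(** * Comparison of integrals *)

Section integral_comparison.
Context {R : realType} {d} {T : measurableType d}.
Variable mu : {measure set T -> \bar R}.
Implicit Types f g : T -> \bar R.
Local Open Scope ereal_scope.

(* No measurability is required: the integral of a nonnegative function is
   defined as a supremum over simple functions below it. *)
Lemma ge0_le_integral_all f g : (forall x, 0 <= f x) -> (forall x, f x <= g x) ->
  \int[mu]_x f x <= \int[mu]_x g x.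
Proof.
move=> f0 fg; have g0 x : 0 <= g x := le_trans (f0 x) (fg x).
rewrite !ge0_integralTE //; apply: le_ereal_sup => _ [h hf <-].
by exists h => // x; exact: le_trans (hf x) (fg x).
Qed.

Lemma le_integral_all f g : (forall x, f x <= g x) -> \int[mu]_x f x <= \int[mu]_x g x.
Proof.
move=> fg; rewrite [leLHS]integralE [leRHS]integralE; apply: leeB.
  apply: ge0_le_integral_all => x; first exact: funepos_ge0.
  by apply: funepos_le; rewrite ?inE.
apply: ge0_le_integral_all => x; first exact: funeneg_ge0.
by apply: funeneg_le; rewrite ?inE.
Qed.

Let infty_on (N : set T) (x : T) : \bar R := +oo * (\1_N x : R)%:E.

Let infty_on_out N x : ~ N x -> infty_on N x = 0.
Proof. by move=> Nx; rewrite /infty_on indicE memNset // mule0. Qed.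

Let infty_on_in N x : N x -> infty_on N x = +oo.
Proof. by move=> Nx; rewrite /infty_on indicE mem_set // mule1. Qed.

Let measurable_infty_on N : measurable N -> measurable_fun setT (infty_on N).
Proof.
move=> mN; apply: emeasurable_funM => //; apply/measurable_EFinP.
exact: measurable_indic.
Qed.

(** Adding [+oo] on [N] to [g] gives a measurable majorant of [f], itself arbitrary, with the same
    integral as [g]. *)
Lemma le_integral_off_null f (g : T -> R) N : measurable N -> mu N = 0 ->
  measurable_fun setT g -> (forall x, ~ N x -> f x <= (g x)%:E) ->
  \int[mu]_x f x <= \int[mu]_x (g x)%:E.
Proof.
move=> mN N0 mg fg; have mgE : measurable_fun setT (EFin \o g) by exact/measurable_EFinP.
apply: (@le_trans _ _ (\int[mu]_x ((g x)%:E + infty_on N x))).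
  apply: le_integral_all => x; have [Nx|Nx] := pselect (N x).
    by rewrite infty_on_in // addey // leey.
  by rewrite infty_on_out // adde0 fg.
rewrite le_eqVlt; apply/predU1P; left; apply: ae_eq_integral => //.
  by apply: emeasurable_funD => //; exact: measurable_infty_on.
exists N; split => // x /= /not_implyP[_ h]; apply: contrapT => Nx.
by apply: h; rewrite infty_on_out // adde0.
Qed.

Lemma ge_integral_off_null f (g : T -> R) N : measurable N -> mu N = 0 ->
  measurable_fun setT g -> (forall x, ~ N x -> (g x)%:E <= f x) ->
  \int[mu]_x (g x)%:E <= \int[mu]_x f x.
Proof.
move=> mN N0 mg fg; have mgE : measurable_fun setT (EFin \o g) by exact/measurable_EFinP.
apply: (@le_trans _ _ (\int[mu]_x ((g x)%:E - infty_on N x))); last first.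
  apply: le_integral_all => x; have [Nx|Nx] := pselect (N x).
    by rewrite infty_on_in // leNye.
  by rewrite infty_on_out // sube0 fg.
rewrite le_eqVlt; apply/predU1P; left; apply: ae_eq_integral => //.
  by apply: emeasurable_funB => //; exact: measurable_infty_on.
exists N; split => // x /= /not_implyP[_ h]; apply: contrapT => Nx.
by apply: h; rewrite infty_on_out // sube0.
Qed.

End integral_comparison.

(** * Gibbs measures and relative entropy *)

Section density.
Context {R : realType} {d} {S : measurableType d}.
Variables (xi : probability S R) (h : S -> R).
Hypothesis bh : bmfun h.
Hypothesis h1 : \int[xi]_z expR (h z) = 1.
Local Open Scope ereal_scope.

Definition gibbs (A : set S) : \bar R := \int[xi]_(z in A) (expR (h z))%:E.

Let mh : measurable_fun setT (fun z => (expR (h z))%:E).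
Proof. by apply/measurable_EFinP; have [] := bmfun_expR bh. Qed.

Let gibbs0 : gibbs set0 = 0. Proof. by rewrite /gibbs integral_set0. Qed.

Let gibbs_ge0 A : 0 <= gibbs A.
Proof. by apply: integral_ge0 => z _; rewrite lee_fin expR_ge0. Qed.

Let gibbs_sigma_additive : semi_sigma_additive gibbs.
Proof.
move=> /= F mF tF mUF; rewrite /gibbs; apply: cvg_toP.
  apply: ereal_nondecreasing_is_cvgn => m n mn.
  apply: lee_sum_nneg_natr => // k _ _; apply: integral_ge0 => /= x Fkx.
  by rewrite lee_fin expR_ge0.
rewrite ge0_integral_bigcup //=.
  exact: measurable_funTS.
Qed.

HB.instance Definition _ := isMeasure.Build _ _ _
  gibbs gibbs0 gibbs_ge0 gibbs_sigma_additive.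

Let gibbs_setT : gibbs setT = 1.
Proof. by rewrite /gibbs -Rintegral_EFin ?h1 //; exact: bmfun_expR. Qed.

HB.instance Definition _ := @Measure_isProbability.Build _ _ R gibbs gibbs_setT.

Definition gibbs_prob : probability S R := gibbs.

Lemma gibbs_dominated : gibbs_prob `<< xi.
Proof.
apply/null_content_dominatesP => A mA A0; rewrite /gibbs_prob /= /gibbs.
by apply: null_set_integral => //; exact: measurable_funTS.
Qed.

Let rn := Radon_Nikodym (charge_of_finite_measure gibbs_prob) xi.

Let rnE : ae_eq xi setT rn (fun z => (expR (h z))%:E).
Proof.
apply: ae_eq_sym; apply: integral_ae_eq => //.
- exact: (bmfun_integrable xi (bmfun_expR bh)).
- apply: measurable_int; apply: Radon_Nikodym_integrable; exact: gibbs_dominated.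
- move=> E _ mE; rewrite -(@Radon_Nikodym_integral _ _ _ (charge_of_finite_measure gibbs_prob) xi) //.
  exact: gibbs_dominated.
Qed.

Lemma Rint_gibbs (f : S -> R) : bmfun f ->
  (\int[gibbs_prob]_z f z = \int[xi]_z (f z * expR (h z)))%R.
Proof.
move=> bf; rewrite /Rintegral; congr fine.
rewrite -(Radon_Nikodym_change_of_variables gibbs_dominated measurableT
  (bmfun_integrable gibbs_prob bf)).
have [mf _] := bf.
apply: ae_eq_integral => //.
- apply: emeasurable_funM; first exact/measurable_EFinP.
  by apply: measurable_int; apply: Radon_Nikodym_integrable; exact: gibbs_dominated.
- by apply/measurable_EFinP/measurable_funM => //; have [] := bmfun_expR bh.
- by apply: filterS rnE => z /= E _; rewrite -/rn E.
Qed.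

Lemma KL_gibbs_le : KL gibbs_prob xi <= (\int[gibbs_prob]_z h z - 1)%:E.
Proof.
rewrite /KL; case: asboolP => [_|]; last by move/(_ gibbs_dominated).
have [N [mN N0 NP]] := rnE.
have b1 : bmfun (fun z => h z - 1)%R by apply: bmfunB => //; exact: bmfun_cst.
apply: (@le_trans _ _ (\int[gibbs_prob]_z (h z - 1)%:E)).
  apply: (@le_integral_off_null _ _ _ _ _ _ N) => //.
  - by have /null_content_dominatesP := gibbs_dominated; apply.
  - by have [] := b1.
  - move=> z Nz; have rE : rn z = (expR (h z))%:E.
      by apply: contrapT => nE; apply: Nz; apply: NP => /= E; exact: nE (E I).
    by rewrite -/rn rE lne_EFin ?expR_gt0 // expRK EFinB.
by rewrite -Rintegral_EFin // Rint_B // ?Rintegral_prob_cst //; exact: bmfun_cst.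
Qed.

End density.

Section KL_lower_bound.
Context {R : realType} {d} {S : measurableType d}.
Variables (g xi : probability S R) (h : S -> R).
Hypothesis bh : bmfun h.
Hypothesis h1 : \int[xi]_z expR (h z) = 1.
Local Open Scope ereal_scope.

(* Gibbs variational principle: [ln t - 1 >= h - exp h / t] for [t > 0]. *)
Lemma KL_ge : (\int[g]_z h z - 1)%:E <= KL g xi.
Proof.
rewrite /KL; case: asboolP => [dom|_]; last by rewrite leey.
(* A version of the density that is finite and nonnegative everywhere, so that its real logarithm
   can be taken off the [g]-null set where it vanishes. *)
pose r := Radon_Nikodym_SigmaFinite.f g xi.
have r0 z : 0 <= r z by exact: Radon_Nikodym_SigmaFinite.f_ge0.
have rfin z : r z \is a fin_num by exact: Radon_Nikodym_SigmaFinite.f_fin_num.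
have mr : measurable_fun setT r.
  by apply: measurable_int; exact: Radon_Nikodym_SigmaFinite.f_integrable.
have mfr : measurable_fun setT (fine \o r) by exact: measurableT_comp.
have [N [mN N0 NP]] := ae_eq_Radon_Nikodym_SigmaFinite dom measurableT.
pose Z := [set z | r z = 0].
have mZ : measurable Z.
  have -> : Z = setT `&` r @^-1` [set 0] by rewrite setTI.
  exact: mr.
have gZ : g Z = 0.
  rewrite (Radon_Nikodym_SigmaFinite.f_integral dom mZ).
  by apply: integral0_eq => z Zz; exact: Zz.
have gN : g N = 0 by have /null_content_dominatesP := dom; apply.
pose u z := expR (h z - ln (fine (r z))).
have mu_ : measurable_fun setT u.
  apply: measurableT_comp => //; apply: measurable_funB; first by case: bh.
  exact: (measurableT_comp (@measurable_ln R) mfr).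
(* Only an inequality: changing variables to [xi] restores [exp h] where [r > 0], and the rest of
   the mass of [exp h] is lost. *)
have intu : \int[g]_z (u z)%:E <= 1.
  rewrite -(Radon_Nikodym_SigmaFinite.change_of_variables dom) //; last 2 first.
  - by move=> z; rewrite lee_fin expR_ge0.
  - exact/measurable_EFinP.
  have -> : 1 = \int[xi]_z (expR (h z))%:E.
    by rewrite -Rintegral_EFin ?h1 //; exact: bmfun_expR.
  apply: ge0_le_integral_all => z; first by rewrite mule_ge0 // lee_fin expR_ge0.
  rewrite -/r; have [/eqP rz|rz] := boolP (r z == 0).
    by rewrite rz mule0 lee_fin expR_ge0.
  have fr : (0 < fine (r z))%R by rewrite fine_gt0 // lt_neqAle eq_sym rz r0 /= ltey_eq rfin.
  rewrite -(fineK (rfin z)) -EFinM lee_fin /u expRD expRN lnK ?posrE //.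
  by rewrite divfK ?gt_eqF.
apply: (@le_trans _ _ (\int[g]_z (h z - u z)%:E)); last first.
  apply: (@ge_integral_off_null _ _ _ _ _ _ (N `|` Z)).
  - exact: measurableU.
  - have : g (N `|` Z) <= g N + g Z by exact: measureU2.
    rewrite gN gZ adde0 => h0; apply/eqP; rewrite eq_le measure_ge0 andbT.
    exact: h0.
  - by apply: measurable_funB => //; case: bh.
  - move=> z NZ; have Nz : ~ N z by move=> ?; apply: NZ; left.
    have Zz : r z != 0 by apply/eqP => ?; apply: NZ; right.
    have <- : r z = Radon_Nikodym (charge_of_finite_measure g) xi z.
      by apply: contrapT => nE; apply: Nz; apply: NP => /= E; exact: nE (E I).
    have fr : (0 < fine (r z))%R.
      by rewrite fine_gt0 // lt_neqAle eq_sym Zz r0 /= ltey_eq rfin.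
    rewrite -(fineK (rfin z)) lne_EFin // -EFinB lee_fin /u /=.
    have := expR_ge1Dx (h z - ln (fine (r z))); lra.
have iu : g.-integrable setT (EFin \o u).
  apply/integrableP; split; first exact/measurable_EFinP.
  under eq_integral do rewrite /= ger0_norm ?expR_ge0 //.
  by apply: le_lt_trans intu _; exact: ltry.
under [leRHS]eq_integral do rewrite EFinB.
rewrite integralB_EFin //; last exact: bmfun_integrable.
by rewrite EFinB Rintegral_EFin // leeB.
Qed.

End KL_lower_bound.

Section couplings.
Context {R : realType} {d} {T : measurableType d}.
Implicit Types (mu nu : probability T R).

Lemma bmfun_fst (f : T -> R) : bmfun f -> bmfun (fun z : T * T => f z.1).
Proof.
move=> [mf [M fM]]; split; last by exists M.
exact: (measurableT_comp mf measurable_fst).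
Qed.

Lemma bmfun_snd (f : T -> R) : bmfun f -> bmfun (fun z : T * T => f z.2).
Proof.
move=> [mf [M fM]]; split; last by exists M.
exact: (measurableT_comp mf measurable_snd).
Qed.

Lemma Rint_coupling_fst mu nu g (f : T -> R) : coupling mu nu g -> bmfun f ->
  \int[g]_z f z.1 = \int[mu]_x f x.
Proof.
move=> [g1 _] bf; have [mf _] := bf; rewrite /Rintegral; congr fine.
transitivity (\int[pushforward g fst]_x (f x)%:E)%E.
  rewrite integral_pushforward //; first exact/measurable_EFinP.
  exact: (bmfun_integrable g (bmfun_fst bf)).
apply: eq_measure_integral => A mA _; transitivity (g (A `*` setT)); last exact: g1.
by rewrite /pushforward; congr (g _); apply/seteqP; split=> z /=; [split|case].
Qed.

Lemma Rint_coupling_snd mu nu g (f : T -> R) : coupling mu nu g -> bmfun f ->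
  \int[g]_z f z.2 = \int[nu]_x f x.
Proof.
move=> [_ g2] bf; have [mf _] := bf; rewrite /Rintegral; congr fine.
transitivity (\int[pushforward g snd]_x (f x)%:E)%E.
  rewrite integral_pushforward //; first exact/measurable_EFinP.
  exact: (bmfun_integrable g (bmfun_snd bf)).
apply: eq_measure_integral => A mA _; transitivity (g (setT `*` A)); last exact: g2.
by rewrite /pushforward; congr (g _); apply/seteqP; split=> z /=; [split|case].
Qed.

Lemma Rint_prod mu nu (f : T * T -> R) : bmfun f -> (forall z, 0 <= f z) ->
  \int[(mu \x nu)%E]_z f z = \int[mu]_x \int[nu]_y f (x, y).
Proof.
move=> bf f0; have [mf [M fM]] := bf; rewrite /Rintegral; congr fine.
rewrite fubini_tonelli1 //; last by apply/measurable_EFinP.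
apply: eq_integral => x _; rewrite /fubini_F -Rintegral_EFin //.
split; last by exists M.
exact: (measurableT_comp mf (measurable_pair1 x)).
Qed.

End couplings.

Section entropic_cost.
Context {R : realType} {d} {T : measurableType d}.
Variables (c : T -> T -> R) (eps : R) (f psi : T -> R).
Hypothesis bc : bmfun (fun z : T * T => c z.1 z.2).
Hypothesis eps_gt0 : 0 < eps.
Hypothesis bf : bmfun f.
Hypothesis bpsi : bmfun psi.
Implicit Types (mu nu : probability T R).

Let h (z : T * T) : R := (f z.1 + psi z.2 - c z.1 z.2) / eps.

Lemma bmfun_potential_gap : bmfun h.
Proof.
rewrite /h; under eq_fun do rewrite mulrC.
by apply/bmfunZ/bmfunB => //; apply: bmfunD; [exact: bmfun_fst|exact: bmfun_snd].
Qed.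

Let bh := bmfun_potential_gap.
Let be : bmfun (fun z => expR (h z)) := bmfun_expR bh.

(** The right side is the same for all couplings, so comparing entropic costs reduces to comparing
    the integral of [h] with the relative entropy. *)
Lemma Rint_potential_gap mu nu g : coupling mu nu g ->
  \int[g]_z c z.1 z.2 + eps * \int[g]_z h z = \int[mu]_x f x + \int[nu]_x psi x.
Proof.
move=> gc; rewrite -(Rint_coupling_fst gc bf) -(Rint_coupling_snd gc bpsi).
have bhe : bmfun (fun z => eps * h z) by exact: bmfunZ.
rewrite -(Rint_Z g eps bh) -(Rint_D g bc bhe).
rewrite -(Rint_D g (bmfun_fst bf) (bmfun_snd bpsi)).
by apply: eq_Rintegral => z _; rewrite /h; field; rewrite gt_eqF.
Qed.

Section left_marginal.
Variables (mu nu : probability T R).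
Hypothesis nu_mass : forall x, \int[nu]_x' expR ((f x + psi x' - c x x') / eps) = 1.

Lemma potential_mass : \int[(mu \x nu)%E]_z expR (h z) = 1.
Proof.
rewrite Rint_prod; [|exact: be|by move=> z; exact: expR_ge0].
rewrite -[RHS](Rintegral_prob_cst mu); apply: eq_Rintegral => x _.
exact: nu_mass.
Qed.

(** Only the normalisation against [nu] enters, so potentials computed for one source measure bound
    the cost of any other from below. The term [- eps] is the shift in [KL]. *)
Lemma entropic_ot_cost_ge :
  ((\int[mu]_x f x + \int[nu]_x psi x - eps)%:E <= entropic_ot_cost eps c mu nu)%E.
Proof.
apply: le_ereal_inf_tmp => _ [g gc <-].
rewrite -(Rint_potential_gap gc) -Rintegral_EFin //.
have -> : \int[g]_z c z.1 z.2 + eps * \int[g]_z h z - eps =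
  \int[g]_z c z.1 z.2 + eps * (\int[g]_z h z - 1) by ring.
rewrite EFinD leeD2l // EFinM lee_pmul2l ?lte_fin //.
exact: KL_ge bh potential_mass.
Qed.

Hypothesis mu_mass : forall x', \int[mu]_x expR ((f x + psi x' - c x x') / eps) = 1.

Let gam := gibbs_prob bh potential_mass.

Let gam_rect A B : measurable A -> measurable B ->
  gam (A `*` B) = (\int[(mu \x nu)%E]_z (\1_A z.1 * \1_B z.2 * expR (h z)))%:E.
Proof.
move=> mA mB.
have bAB : bmfun (fun z : T * T => \1_A z.1 * \1_B z.2 : R).
  exact: (bmfunM (bmfun_fst (bmfun_indic mA)) (bmfun_snd (bmfun_indic mB))).
rewrite -(Rint_gibbs bh potential_mass bAB) -/gam.
rewrite (@eq_Rintegral _ _ _ gam setT (\1_(A `*` B))).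
  by rewrite Rint_indic ?fineK ?fin_num_measure //; exact: measurableX.
move=> z _; rewrite !indicE; case: (boolP (z.1 \in A)) => zA; case: (boolP (z.2 \in B)) => zB;
  rewrite ?mulr1 ?mulr0 ?mul0r.
- by rewrite mem_set //; split; exact: set_mem.
- by rewrite memNset // => -[_ /mem_set]; rewrite (negbTE zB).
- by rewrite memNset // => -[/mem_set]; rewrite (negbTE zA).
- by rewrite memNset // => -[/mem_set]; rewrite (negbTE zA).
Qed.

Let gam_coupling : coupling mu nu gam.
Proof.
have ind0 A (x : T) : 0 <= \1_A x :> R by rewrite indicE.
have b1 A : measurable A -> bmfun (fun z : T * T => \1_A z.1 : R).
  by move=> mA; exact: (bmfun_fst (bmfun_indic mA)).
have b2 A : measurable A -> bmfun (fun z : T * T => \1_A z.2 : R).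
  by move=> mA; exact: (bmfun_snd (bmfun_indic mA)).
have bexp1 x : bmfun (fun x' => expR ((f x + psi x' - c x x') / eps)).
  have [mh [M hM]] := be; split; last by exists M => x'; exact: (hM (x, x')).
  exact: (measurableT_comp mh (measurable_pair1 x)).
have bexp2 x' : bmfun (fun x => expR ((f x + psi x' - c x x') / eps)).
  have [mh [M hM]] := be; split; last by exists M => x; exact: (hM (x, x')).
  exact: (measurableT_comp mh (measurable_pair2 x')).
split => A mA.
  transitivity ((\int[mu]_x \1_A x)%:E); last by rewrite Rint_indic // fineK // fin_num_measure.
  rewrite gam_rect //; congr (_%:E).
  rewrite Rint_prod; last 2 first.
  - by apply: bmfunM => //; apply: bmfunM; [exact: b1|exact: b2].
  - by move=> z; rewrite !mulr_ge0 ?expR_ge0.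
  apply: eq_Rintegral => x _.
  transitivity (\int[nu]_x' (\1_A x * expR ((f x + psi x' - c x x') / eps))).
    by apply: eq_Rintegral => x' _; rewrite [\1_setT _]indicE mem_set // mulr1.
  by rewrite (Rint_Z nu _ (bexp1 x)) nu_mass mulr1.
transitivity ((\int[nu]_x \1_A x)%:E); last by rewrite Rint_indic // fineK // fin_num_measure.
rewrite gam_rect //; congr (_%:E).
rewrite /Rintegral; congr fine; rewrite fubini_tonelli2; last 2 first.
- apply/measurable_EFinP.
  suff [] : bmfun (fun z : T * T => \1_setT z.1 * \1_A z.2 * expR (h z)) by [].
  by apply: bmfunM => //; apply: bmfunM; [exact: b1|exact: b2].
- by move=> z; rewrite lee_fin !mulr_ge0 ?expR_ge0.
apply: eq_integral => x' _; rewrite /fubini_G.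
transitivity (\int[mu]_x (\1_A x' * expR ((f x + psi x' - c x x') / eps))%:E)%E.
  by apply: eq_integral => x _; rewrite [\1_setT _]indicE mem_set // mul1r.
by rewrite -Rintegral_EFin ?(Rint_Z mu _ (bexp2 x')) ?mu_mass ?mulr1 //; exact: bmfunZ.
Qed.

Lemma entropic_ot_cost_le :
  (entropic_ot_cost eps c mu nu <= (\int[mu]_x f x + \int[nu]_x psi x - eps)%:E)%E.
Proof.
apply: le_trans (ereal_inf_lbound _) _; first by exists gam; first exact: gam_coupling.
rewrite -(Rint_potential_gap gam_coupling) -Rintegral_EFin //.
have -> : \int[gam]_z c z.1 z.2 + eps * \int[gam]_z h z - eps =
  \int[gam]_z c z.1 z.2 + eps * (\int[gam]_z h z - 1) by ring.
rewrite EFinD leeD2l // EFinM lee_pmul2l ?lte_fin //.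
exact: KL_gibbs_le.
Qed.

(** The Gibbs plan is also a competitor for the plain cost, and the term dropped is [eps] times a
    relative entropy, nonnegative because [u ln u >= u - 1]. *)
Lemma ot_cost_le_potentials :
  (ot_cost c mu nu <= (\int[mu]_x f x + \int[nu]_x psi x)%:E)%E.
Proof.
apply: le_trans (ereal_inf_lbound _) _; first by exists gam; first exact: gam_coupling.
rewrite -(Rint_potential_gap gam_coupling) -Rintegral_EFin // lee_fin lerDl.
rewrite mulr_ge0 // ?(ltW eps_gt0) // Rint_gibbs //.
have b1 : bmfun (fun z => expR (h z) - 1) by apply: bmfunB => //; exact: bmfun_cst.
apply: (@le_trans _ _ (\int[(mu \x nu)%E]_z (expR (h z) - 1))).
  by rewrite Rint_B // ?Rintegral_prob_cst ?potential_mass ?subrr //; exact: bmfun_cst.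
apply: (Rint_le (B := setT)) => //; first exact: probability_setT.
  exact: bmfunM.
move=> z _; have := expR_ge1Dx (- h z).
have : expR (h z) * expR (- h z) = 1 by rewrite -expRD subrr expR0.
have := expR_gt0 (h z); set u := expR (h z); set v := expR (- h z) => u0 uv hv.
have : u * (1 + - h z) <= u * v by rewrite ler_pM2l.
by rewrite uv; lra.
Qed.

End left_marginal.
End entropic_cost.

(** * Dual potentials and differences of costs *)

Section transport_difference.
Context {R : realType} {d} {T : measurableType d}.
Variables (N : nat) (w : simplex R N) (y : 'I_N -> T) (c : T -> T -> R) (M : R).
Hypothesis mc : measurable_fun setT (fun z : T * T => c z.1 z.2).
Hypothesis c_ge0 : forall x x', 0 <= c x x'.
Hypothesis c_le : forall x x', c x x' <= M.
Implicit Types (mu : probability T R).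

Let nu : probability T R := discrete_prob w y.

Let w0 a : 0 <= w a. Proof. by case/andP: (weight01 w a). Qed.
Let w1 : \sum_a w a = 1. Proof. exact: weight_sum1. Qed.

Let bc : bmfun (fun z : T * T => c z.1 z.2).
Proof. by split => //; exists M => z; rewrite ger0_norm. Qed.

Let right_mass (eps : R) (f psi : T -> R) : 0 < eps -> bmfun f -> bmfun psi ->
  (forall x, f x = soft_potential w y c eps (fun a => psi (y a)) x) ->
  forall x, \int[nu]_x' expR ((f x + psi x' - c x x') / eps) = 1.
Proof.
move=> eps0 bf bpsi fE x; rewrite Rint_discrete.
  by rewrite fE; exact: soft_potential_mass.
have [mh [K hK]] := bmfun_expR (bmfun_potential_gap eps bc bf bpsi).
split; last by exists K => x'; exact: (hK (x, x')).
exact: (measurableT_comp mh (measurable_pair1 x)).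
Qed.

Section entropic.
Variable eps : R.
Hypothesis eps_gt0 : 0 < eps.

Lemma entropic_ot_cost_dual mu : exists psi : 'I_N -> R,
  entropic_ot_cost eps c mu nu =
    (\int[mu]_x soft_potential w y c eps psi x + \sum_a w a * psi a - eps)%:E /\
  forall mu', ((\int[mu']_x soft_potential w y c eps psi x + \sum_a w a * psi a - eps)%:E
    <= entropic_ot_cost eps c mu' nu)%E.
Proof.
have [f [psi [bf bpsi fE mu_mass _]]] := schroedinger mu w y mc c_ge0 c_le eps_gt0.
have nu_mass := right_mass eps_gt0 bf bpsi fE.
have E mu' : \int[mu']_x f x + \int[nu]_x psi x - eps =
  \int[mu']_x soft_potential w y c eps (fun a => psi (y a)) x + \sum_a w a * psi (y a) - eps.
  by rewrite (Rint_discrete _ _ bpsi); congr (_ + _ - _); apply: eq_Rintegral => x _.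
exists (fun a => psi (y a)); split; last first.
  by move=> mu'; rewrite -E; exact: entropic_ot_cost_ge.
apply/eqP; rewrite eq_le -E; apply/andP; split.
  exact: entropic_ot_cost_le.
exact: entropic_ot_cost_ge.
Qed.

Lemma entropic_ot_cost_diff mu mu' (b : R) :
  (forall psi, `|\int[mu]_x soft_potential w y c eps psi x -
    \int[mu']_x soft_potential w y c eps psi x| <= b) ->
  (`|entropic_ot_cost eps c mu nu - entropic_ot_cost eps c mu' nu| <= b%:E)%E.
Proof.
move=> hb.
have [psi [E h]] := entropic_ot_cost_dual mu; have [psi' [E' h']] := entropic_ot_cost_dual mu'.
have aux (A A' B B' s t e : R) : `|A - A'| <= b -> `|B - B'| <= b -> B + t - e <= A + s - e ->
    A' + s - e <= B' + t - e -> `|A + s - e - (B' + t - e)| <= b.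
  by rewrite !ler_norml => /andP[? ?] /andP[? ?] ? ?; apply/andP; split; lra.
have := h mu'; have := h' mu; rewrite E E' !lee_fin => u v.
exact: aux (hb psi) (hb psi') u v.
Qed.

End entropic.

(** The default value of the iterated minimum is the term of [j], which occurs in it anyway; [j] is
    later the atom of price 0. *)
Definition hard_potential (psi : 'I_N -> R) (j : 'I_N) (x : T) : R :=
  \big[Num.min/(c x (y j) - psi j)]_(a < N) (c x (y a) - psi a).

Lemma hard_potential_le psi j x a : hard_potential psi j x <= c x (y a) - psi a.
Proof. by rewrite /hard_potential; apply: bigmin_le_cond. Qed.

Lemma le_hard_potential psi j x m : (forall a, m <= c x (y a) - psi a) ->
  m <= hard_potential psi j x.
Proof. by move=> h; apply: le_bigmin. Qed.

Lemma hard_potential_attained psi j x : exists a, hard_potential psi j x = c x (y a) - psi a.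
Proof.
rewrite /hard_potential; elim/big_rec: _ => [|a v _ [b ->]]; first by exists j.
by case: leP => _; [exists a|exists b].
Qed.

Lemma bmfun_hard_potential psi j : bmfun (hard_potential psi j).
Proof.
split.
  rewrite /hard_potential; elim: (index_enum _) => [|a r IH].
    under eq_fun do rewrite big_nil.
    by have [] := bmfunB (bmfun_cost_left mc c_ge0 c_le (y j)) (bmfun_cst (psi j)).
  under eq_fun do rewrite big_cons.
  apply: measurable_minr => //.
  by have [] := bmfunB (bmfun_cost_left mc c_ge0 c_le (y a)) (bmfun_cst (psi a)).
exists (M + \sum_a `|psi a|) => x; have [a ->] := hard_potential_attained psi j x.
apply: le_trans (ler_normB _ _) _; apply: lerD; first by rewrite ger0_norm.
by rewrite (bigD1 a) //= lerDl sumr_ge0.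
Qed.

Hypothesis measurable_point : forall x : T, measurable [set x].

(* Entropic regularisation of strength [e] costs at most [e * sum |ln w a|];
   atoms of null weight get the lowest admissible price, [- M]. *)
Lemma ot_cost_dual mu (eta : R) : 0 < eta -> exists psi j m,
  [/\ (forall a, - M <= psi a <= 0), psi j = 0,
    (ot_cost c mu nu <= (\int[mu]_x hard_potential psi j x + m + eta)%:E)%E &
    forall mu', ((\int[mu']_x hard_potential psi j x + m)%:E <= ot_cost c mu' nu)%E].
Proof.
move=> eta0.
pose K := \sum_a `|ln (w a)|; have K0 : 0 <= K by exact: sumr_ge0.
pose eps := eta / (1 + K).
have eps0 : 0 < eps by rewrite divr_gt0 //; lra.
have epsK : eps * K <= eta.
  by rewrite /eps mulrAC ler_pdivrMr ?ler_pM2l //; lra.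
have [f [psi [bf bpsi fE mu_mass osc]]] := schroedinger mu w y mc c_ge0 c_le eps0.
have nu_mass := right_mass eps0 bf bpsi fE.
have [a0 wa0] : exists a, 0 < w a.
  apply: contrapT => h; have : \sum_a w a = 0.
    apply: big1 => a _; apply/eqP; rewrite eq_le w0 andbT leNgt; apply/negP => ha.
    by apply: h; exists a.
  by move/eqP; rewrite w1 oner_eq0.
(* Subtracting the largest price over the charged atoms gives prices at most 0, and at least [- M]
   by the oscillation bound. *)
pose j := [arg max_(a > a0 | 0 < w a) psi (y a)]%O.
have [wj jmax] : 0 < w j /\ forall a, 0 < w a -> psi (y a) <= psi (y j).
  by rewrite /j; case: arg_maxP => //.
pose q a := if 0 < w a then psi (y a) - psi (y j) else - M.
have M0 : 0 <= M := le_trans (c_ge0 (y j) (y j)) (c_le _ _).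
have qj : q j = 0 by rewrite /q wj subrr.
have bq := bmfun_hard_potential q j.
exists q, j, (\int[nu]_x psi x - psi (y j)); split => //.
- move=> a; rewrite /q; case: ifP => [wa|_]; last by rewrite lexx oppr_le0.
  by rewrite subr_le0 jmax // andbT lerNl opprB; exact: osc.
- apply: le_trans (ot_cost_le_potentials bc eps0 bf bpsi nu_mass mu_mass) _.
  rewrite lee_fin.
  have : \int[mu]_x f x <= \int[mu]_x (hard_potential q j x + (psi (y j) * -1 + eta)).
    apply: (Rint_le (B := setT)) => //; try exact: probability_setT.
      by apply: bmfunD => //; exact: bmfun_cst.
    move=> x _; rewrite -lerBlDr; apply: le_hard_potential => a.
    (* A single term bounds the partition sum from below, at the cost of
       [- eps * ln (w b) <= eps * K <= eta]. *)
    have supp b : 0 < w b -> f x <= c x (y b) - psi (y b) + eta.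
      move=> wb; rewrite fE /soft_potential /softmin.
      have := softmin_sum_gt0 eps0 (fun a => c x (y a) - psi (y a)) w0 w1.
      set Z := \sum_b' _ => Z0.
      have : w b * expR (- ((c x (y b) - psi (y b)) / eps)) <= Z.
        by rewrite /Z (bigD1 b) //= lerDl sumr_ge0 // => i _; rewrite mulr_ge0 ?expR_ge0.
      rewrite -ler_ln ?posrE ?mulr_gt0 ?expR_gt0 // lnM ?posrE ?expR_gt0 // expRK => hZ.
      have : - ln (w b) <= K.
        apply: le_trans (ler_norm _) _; rewrite normrN /K (bigD1 b) //= lerDl sumr_ge0 //.
      move=> hK; have : eps * (ln (w b) + - ((c x (y b) - psi (y b)) / eps)) <= eps * ln Z.
        by rewrite ler_pM2l.
      have : eps * - ln (w b) <= eps * K by rewrite ler_pM2l.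
      rewrite mulrDr !mulrN [eps * (_ / _)]mulrC divfK ?gt_eqF //.
      by move: epsK; lra.
    rewrite /q; case: ifP => [/supp|_]; first by lra.
    (* With price [- M] a null atom has value at least [M], hence never less than the value at
       [j]. *)
    by have := supp j wj; have := c_le x (y j); have := c_ge0 x (y a); lra.
  rewrite (Rint_D mu bq (bmfun_cst _)) Rintegral_prob_cst; lra.
move=> mu'; apply: le_ereal_inf_tmp => _ [g gc <-].
(* Couplings live over the charged atoms, and there [q] is [psi] up to a constant; at null atoms it
   may differ. *)
pose S : set T := \bigcup_(a in [set a | 0 < w a]) [set y a].
have mS : measurable S by apply: fin_bigcup_measurable => // i _; exact: measurable_point.
have gS : g (setT `*` S) = 1%E.
  rewrite gc.2 // /nu /discrete_prob /= /discrete_prob -w1 -sumEFin; apply: eq_bigr => a _.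
  have [wa|wa] := ltP 0 (w a).
    by rewrite diracE mem_set ?mule1 //; exists a.
  have -> : w a = 0 by apply/eqP; rewrite eq_le wa w0.
  by rewrite mul0e.
rewrite -Rintegral_EFin // lee_fin.
rewrite addrA -(Rint_coupling_fst gc bq) -(Rint_coupling_snd gc bpsi).
rewrite -[X in _ - X](Rintegral_prob_cst g).
rewrite -(Rint_D g (bmfun_fst bq) (bmfun_snd bpsi)).
rewrite -(Rint_B g (bmfunD (bmfun_fst bq) (bmfun_snd bpsi)) (bmfun_cst _)).
apply: (Rint_le (B := setT `*` S)) => //.
- exact: measurableX.
- by apply: bmfunB; [apply: bmfunD; [exact: bmfun_fst|exact: bmfun_snd]|exact: bmfun_cst].
move=> z [_ [a /= wa ->]].
by have := hard_potential_le q j z.1 a; rewrite /q wa; lra.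
Qed.

Lemma ot_cost_fin_num mu : ot_cost c mu nu \is a fin_num.
Proof.
have [psi [j [k [_ _ h1 h2]]]] := ot_cost_dual mu ltr01.
rewrite fin_numE; apply/andP; split.
  by rewrite -ltNye (lt_le_trans _ (h2 mu)) // ltNyr.
by rewrite -ltey (le_lt_trans h1) // ltry.
Qed.

Lemma ot_cost_diff mu mu' (b : R) :
  (forall (psi : 'I_N -> R) j, (forall a, - M <= psi a <= 0) -> psi j = 0 ->
    `|\int[mu]_x hard_potential psi j x - \int[mu']_x hard_potential psi j x| <= b) ->
  (`|ot_cost c mu nu - ot_cost c mu' nu| <= b%:E)%E.
Proof.
move=> hb.
have fin m : ot_cost c m nu \is a fin_num := ot_cost_fin_num m.
have key (m m' : probability T R) : (forall (psi : 'I_N -> R) j, (forall a, - M <= psi a <= 0) -> psi j = 0 ->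
    `|\int[m]_x hard_potential psi j x - \int[m']_x hard_potential psi j x| <= b) ->
    fine (ot_cost c m nu) - fine (ot_cost c m' nu) <= b.
  move=> hm; apply/ler_addgt0Pr => eta eta0.
  have [psi [j [k [hpsi psij h1 h2]]]] := ot_cost_dual m eta0.
  have := h2 m'; move: h1; rewrite -[ot_cost c m nu]fineK // -[ot_cost c m' nu]fineK // !lee_fin.
  by have := hm psi j hpsi psij; rewrite ler_norml => /andP[_]; lra.
rewrite -[ot_cost c mu nu]fineK // -[ot_cost c mu' nu]fineK // -EFinB abse_EFin lee_fin.
rewrite ler_norml key // andbT lerNl opprB key // => psi j h1 h2.
by rewrite distrC; exact: hb.
Qed.

End transport_difference.

Section transport_locality.
Context {R : realType} {d} {T : measurableType d}.
Implicit Types (mu nu : probability T R) (c : T -> T -> R) (g : probability (T * T)%type R).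

(** Meant for the projection of a discrete measure, which agrees with the discrete measure on the
    projected atoms. *)
Lemma ot_cost_ext c mu nu nu' : (forall A, measurable A -> nu A = nu' A) ->
  ot_cost c mu nu = ot_cost c mu nu'.
Proof.
move=> E; rewrite /ot_cost; congr (ereal_inf [set _ | _ in _]).
by apply/seteqP; split=> g [g1 g2]; split => // A mA; rewrite g2 // E.
Qed.

Section local_cost.
Variables (c c' : T -> T -> R) (B : set T) (mu nu : probability T R).
Hypothesis mc : measurable_fun setT (fun z : T * T => c z.1 z.2).
Hypothesis mc' : measurable_fun setT (fun z : T * T => c' z.1 z.2).
Hypothesis mB : measurable B.
Hypothesis muB : mu B = 1%E.
Hypothesis nuB : nu B = 1%E.
Hypothesis ccB : forall x y, B x -> B y -> c x y = c' x y.

Let integral_cost_local g : coupling mu nu g ->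
  (\int[g]_z (c z.1 z.2)%:E = \int[g]_z (c' z.1 z.2)%:E)%E.
Proof.
move=> [g1 g2].
have mBC : measurable (~` B) by exact: measurableC.
have m1 : measurable (~` B `*` setT : set (T * T)) by exact: measurableX.
have m2 : measurable (setT `*` ~` B : set (T * T)) by exact: measurableX.
apply: ae_eq_integral => //; try exact/measurable_EFinP.
exists ((~` B `*` setT) `|` (setT `*` ~` B)); split.
- exact: measurableU.
- have null (m : probability T R) : m B = 1%E -> m (~` B) = 0%E.
    by move=> m1B; rewrite probability_setC // m1B subee.
  apply: null_set_setU => //; first by transitivity (mu (~` B)); [exact: g1|exact: null].
  by transitivity (nu (~` B)); [exact: g2|exact: null].
- move=> [x y] /= /not_implyP[_ h].
  have [Bx|Bx] := pselect (B x); last by left.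
  have [By|By] := pselect (B y); last by right.
  by exfalso; apply: h; rewrite ccB.
Qed.

(** Every coupling is carried by [B * B]. This allows the cost to be truncated, since duality is
    proved for costs bounded on the whole space. *)
Lemma ot_cost_local : ot_cost c mu nu = ot_cost c' mu nu.
Proof.
rewrite /ot_cost; congr ereal_inf; apply/seteqP.
by split=> _ [g gc <-]; exists g => //; rewrite integral_cost_local.
Qed.

Lemma entropic_ot_cost_local eps :
  entropic_ot_cost eps c mu nu = entropic_ot_cost eps c' mu nu.
Proof.
rewrite /entropic_ot_cost; congr ereal_inf; apply/seteqP.
by split=> _ [g gc <-]; exists g => //; rewrite integral_cost_local.
Qed.

End local_cost.
End transport_locality.

(** * Powers of numbers in the unit interval *)

Section powers.
Context {R : realType}.
Implicit Types a b s u sigma : R.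

Lemma exprn_diff_le n a b : 0 <= b -> b <= a -> a <= 1 -> a ^+ n - b ^+ n <= n%:R * (a - b).
Proof.
move=> b0 ba a1; have a0 := le_trans b0 ba; rewrite subrXX mulrC.
apply: ler_wpM2r; first by rewrite subr_ge0.
apply: (@le_trans _ _ (n%:R * 1)); last by rewrite mulr1.
apply: ler_sum_const => i; rewrite mulr_ile1 ?exprn_ge0 ?exprn_ile1 //.
exact: le_trans ba a1.
Qed.

Lemma norm_exprn_diff_le n a b : 0 <= a <= 1 -> 0 <= b <= 1 ->
  `|a ^+ n - b ^+ n| <= n%:R * `|a - b|.
Proof.
move=> /andP[a0 a1] /andP[b0 b1].
have [ab|ba] := leP a b.
  rewrite distrC (distrC a) !ger0_norm ?subr_ge0 ?exprn_diff_le //.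
  by apply: lerXn2r => //; rewrite nnegrE.
have {}ba := ltW ba; rewrite !ger0_norm ?subr_ge0 ?exprn_diff_le //.
by apply: lerXn2r => //; rewrite nnegrE.
Qed.

Lemma root_ge n sigma u : (0 < n)%N -> 0 < sigma -> 0 <= u -> sigma <= u ^+ n ->
  ln sigma / n%:R <= ln u /\ 0 < u.
Proof.
move=> n0 s0 u0 h; have up : 0 < u.
  rewrite lt_neqAle u0 andbT eq_sym; apply/eqP => u00; move: h.
  by rewrite u00 expr0n eqn0Ngt n0 /= leNgt s0.
split => //; rewrite ler_pdivrMr ?ltr0n // mulr_natr -lnXn //.
by rewrite ler_ln ?posrE ?exprn_gt0.
Qed.

Lemma root_defect n sigma u : (0 < n)%N -> 0 < sigma -> 0 <= u -> sigma <= u ^+ n ->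
  1 - u <= - ln sigma / n%:R.
Proof.
move=> n0 s0 u0 h; have [h1 up] := root_ge n0 s0 u0 h.
have := expR_ge1Dx (ln u); rewrite lnK ?posrE //; move: h1; rewrite mulNr; lra.
Qed.

(** Source of the localisation: a large [n]-th power forces [u^2] within order [1/n] of 1, by
    [u^2 >= 1 + 2 ln u]. *)
Lemma sqr_root_defect n sigma u : (0 < n)%N -> 0 < sigma -> 0 <= u -> sigma <= u ^+ n ->
  1 - u ^+ 2 <= 2 * - ln sigma / n%:R.
Proof.
move=> n0 s0 u0 h; have [h1 up] := root_ge n0 s0 u0 h.
have := expR_ge1Dx (2 * ln u).
have -> : expR (2 * ln u) = u ^+ 2 by rewrite expRM_natl lnK.
by move: h1; rewrite mulrN mulNr -mulrA; lra.
Qed.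

(** Passing from [a - b] to [a^2 - b^2] divides by [a + b], which is at least [sigma] because a
    number of the unit interval dominates its powers. Hence the Lipschitz factor [p / sigma]. *)
Lemma sqr_exprn_diff_le n sigma a b : (0 < n)%N -> 0 < sigma -> 0 <= a <= 1 -> 0 <= b <= 1 ->
  sigma <= a ^+ n \/ sigma <= b ^+ n ->
  `|a ^+ n - b ^+ n| <= n%:R / sigma * `|a ^+ 2 - b ^+ 2|.
Proof.
move=> n0 s0 ha hb hs; apply: (le_trans (norm_exprn_diff_le n ha hb)).
rewrite -mulrA ler_wpM2l ?ler0n // mulrC ler_pdivlMr //.
have -> : a ^+ 2 - b ^+ 2 = (a - b) * (a + b) by ring.
move: ha hb => /andP[a0 a1] /andP[b0 b1].
rewrite normrM ler_wpM2l // ger0_norm ?addr_ge0 //.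
have expr_le (u : R) : 0 <= u -> u <= 1 -> u ^+ n <= u.
  move=> u0 u1; rewrite -[leRHS]expr1; apply: ler_wiXn2l => //.
by have := expr_le a a0 a1; have := expr_le b b0 b1; case: hs; lra.
Qed.

End powers.

Section ball_partition.
Context {R : realType} (d : nat) (r : R).
Local Notation V := 'rV[R]_d.

Lemma measurable_coord (k : 'I_d) : measurable_fun setT (fun x : V => x 0 k).
Proof.
have <- : edot (\row_i (i == k)%:R : V) = (fun x : V => x 0 k); last exact: measurable_edot.
apply/funext => x; rewrite /edot (bigD1 k) //= mxE eqxx mul1r big1 ?addr0 // => i ik.
by rewrite mxE (negbTE ik) mul0r.
Qed.

Lemma measurable_enorm : measurable_fun setT (@enorm R d).
Proof.
have msqrt : measurable_fun setT (@Num.sqrt R).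
  by apply: continuous_measurable_fun; exact: sqrt_continuous.
apply: (measurableT_comp msqrt); apply: measurable_sum => k.
by apply: measurable_funM; exact: measurable_coord.
Qed.

Lemma measurable_eball : measurable (eball r : set V).
Proof.
have -> : eball r = @enorm R d @^-1` `]-oo, r] :> set V.
  by apply/seteqP; split=> x; rewrite /eball /= in_itv.
by rewrite -[X in measurable X]setTI; exact: measurable_enorm.
Qed.

Lemma ball_partition (h : R) : 0 < h -> exists (K : finType) (lab : V -> K),
  (forall k, measurable (eball r `&` lab @^-1` [set k])) /\
  (forall x x', eball r x -> eball r x' -> lab x = lab x' -> enorm (x - x') <= h).
Proof.
move=> h0; pose g := h / (1 + Num.sqrt d%:R).
have sd : 0 <= Num.sqrt d%:R :> R by exact: sqrtr_ge0.
have g0 : 0 < g by rewrite divr_gt0 //; lra.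
have gh : Num.sqrt d%:R * g <= h.
  by rewrite /g mulrCA ler_piMr ?(ltW h0) // ler_pdivrMr; lra.
pose B := (Num.truncn (2 * r / g)).+1.
pose thr (m : nat) := m%:R * g - r.
(* Recording comparisons with thresholds rather than cell numbers makes each cell a finite
   intersection of half-spaces or their complements, hence measurable. *)
pose lab (x : V) : {ffun 'I_d * 'I_B -> bool} := [ffun q : 'I_d * 'I_B => thr q.2 <= x 0 q.1].
pose S (k : {ffun 'I_d * 'I_B -> bool}) (q : 'I_d * 'I_B) : set V :=
  [set x : V | (thr q.2 <= x 0 q.1) = k q].
exists {ffun 'I_d * 'I_B -> bool}, lab; split.
  move=> k; apply: measurableI; first exact: measurable_eball.
  have -> : lab @^-1` [set k] =
      \bigcap_(q in setT) S k q.
    apply/seteqP; split => x /=; first by move=> <- q _; rewrite /S /= /lab ffunE.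
    by move=> hx; apply/ffunP => q; rewrite /lab ffunE; exact: (hx q).
  apply: fin_bigcap_measurable => // q _.
  have mq : measurable [set x : V | thr q.2 <= x 0 q.1].
    have -> : [set x : V | thr q.2 <= x 0 q.1] = (fun x : V => x 0 q.1) @^-1` `[thr q.2, +oo[.
      by apply/seteqP; split=> x; rewrite /= in_itv /= andbT.
    by rewrite -[X in measurable X]setTI; exact: measurable_coord.
  rewrite /S; case: (k q).
    by rewrite (_ : [set x : V | _] = [set x : V | thr q.2 <= x 0 q.1]).
  rewrite (_ : [set x : V | _] = ~` [set x : V | thr q.2 <= x 0 q.1]); first exact: measurableC.
  by apply/seteqP; split=> x /=; case: (_ <= _).
move=> x x' Bx Bx' E; apply: le_trans gh; apply: enorm_le_coord; first exact: ltW.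
have close u u' k : eball r u -> lab u = lab u' -> u 0 k - u' 0 k <= g.
  move=> Bu {}E; have := le_trans (coord_le_enorm u k) Bu; rewrite ler_norml => /andP[u1 u2].
  pose m := Num.truncn ((u 0 k + r) / g).
  have q0 : 0 <= (u 0 k + r) / g by rewrite divr_ge0 ?(ltW g0) //; lra.
  have /andP[m1 m2] : m%:R <= (u 0 k + r) / g < m.+1%:R by exact: truncn_itv.
  have mB : (m < B)%N.
    rewrite ltnS; apply: le_truncn; rewrite ler_pM2r ?invr_gt0 //; lra.
  move/ffunP/(_ (k, Ordinal mB)): E; rewrite !ffunE /= /thr.
  move: m1 m2; rewrite ler_pdivlMr // ltr_pdivrMr // -natr1 mulrDl => m1 m2.
  have -> : m%:R * g - r <= u 0 k by lra.
  by move/esym; lra.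
move=> k; rewrite !mxE ler_norml; have := close x x' k Bx E; have := close x' x k Bx' (esym E).
by move=> ? ?; apply/andP; split; lra.
Qed.

End ball_partition.

(** * The three classes of potentials *)

Section lipschitz_process.
Context {R : realType} {d : nat} {d'} {Omega : measurableType d'}.
Local Notation V := 'rV[R]_d.
Variables (P : probability Omega R) (n : nat) (X : 'I_n -> {RV P >-> V}).
Variables (mu : probability V R) (r : R) (I : Type) (F : I -> V -> R) (rho M K : R) (i0 : I).
Hypothesis n_gt0 : (0 < n)%N.
Hypothesis iidX : iid_with_law X mu.
Hypothesis muB : mu (eball r) = 1%E.
Hypothesis mF : forall i, measurable_fun setT (F i).
Hypothesis F_bound : forall i x, `|F i x| <= M.
Hypothesis F_lip : forall i x x', eball r x -> eball r x' ->
  `|F i x - F i x'| <= K * enorm (x - x').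
Hypothesis F_rademacher :
  forall (x : 'I_n -> V) (sel : {ffun 'I_n -> bool} -> I), (forall j, eball r (x j)) ->
  avg_signs (fun s => n%:R^-1 * `|signed_sum (fun j => F (sel s) (x j)) s|) <= rho.

Lemma lipschitz_process (eta : R) : 0 < eta -> exists Z : Omega -> \bar R,
  [/\ measurable_fun setT Z, (forall w, 0 <= Z w)%E,
    (\int[P]_w Z w <= (2 * rho + eta)%:E)%E &
    forall w, Z w = +oo%E \/ ((forall j, eball r (X j w)) /\ forall i,
      (`|\int[mu]_x F i x - \int[empirical R n_gt0 (fun j => X j w)]_x F i x|%:E <= Z w)%E)].
Proof.
move=> eta0.
have osc h : 0 < h -> exists (K : finType) (lab : V -> K),
  (forall k, measurable (eball r `&` lab @^-1` [set k])) /\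
  (forall i x x', eball r x -> eball r x' -> lab x = lab x' -> `|F i x - F i x'| <= h).
  move=> h0; have K1 : 0 < 1 + `|K| by rewrite ltr_pwDl.
  have [L [lab [mlab hlab]]] := ball_partition d r (divr_gt0 h0 K1).
  exists L, lab; split => // i x x' Bx Bx' E; apply: le_trans (F_lip i Bx Bx') _.
  have := hlab x x' Bx Bx' E; rewrite ler_pdivlMr // mulrC; apply: le_trans.
  by apply: ler_wpM2r; [exact: enorm_ge0|have := ler_norm K; lra].
have [Z [mZ Z0 iZ hZ]] := empirical_process n_gt0 iidX (measurable_eball r) muB mF i0
  F_bound osc F_rademacher eta0.
exists Z; split => // w; have [->|[h1 h2]] := hZ w; [by left|right; split => // i].
rewrite /empirical Rint_discrete /= -?mulr_sumr; first exact: h2.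
by split; [exact: mF|exists M].
Qed.

End lipschitz_process.

Section hard_class.
Context {R : realType}.

(** The finite family is indexed by the sign vectors themselves, with the identity as selection. The
    points [x] may depend on the sign vector because the projection direction does. *)
Lemma rademacher_hard_class dT (T : measurableType dT) (N d n : nat) (p M : R)
    (z : {ffun 'I_n -> bool} -> 'I_N -> T) (x : {ffun 'I_n -> bool} -> 'I_n -> T)
    (cost : T -> T -> R) (psi : {ffun 'I_n -> bool} -> 'I_N -> R)
    (j : {ffun 'I_n -> bool} -> 'I_N)
    (xi : 'I_n -> 'rV[R]_d) (beta : {ffun 'I_n -> bool} -> 'I_N -> 'rV[R]_d)
    (e : {ffun 'I_n -> bool} -> 'I_N -> R) :
  let c v a i := cost (x v i) (z v a) / M in
  0 < M -> (0 < N)%N -> (0 < d)%N -> (0 < n)%N -> 1 <= p ->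
  (forall v a i, 0 <= c v a i <= 1) -> (forall v a, - M <= psi v a <= 0) ->
  (forall v, psi v (j v) = 0) -> (forall v a, 0 <= e v a) ->
  (forall sigma, 0 < sigma -> sigma <= 1 / 4 ->
    forall v a i, sigma <= c v (j v) i -> sigma <= c v a i ->
    enorm (xi i - beta v a) ^+ 2 <= 4 * (- ln sigma) / p /\ e v a <= 2 * (- ln sigma) / p) ->
  (forall sigma, 0 < sigma -> sigma <= 1 / 4 ->
    forall u v a i, sigma <= c u a i \/ sigma <= c v a i ->
    `|c u a i - c v a i| <= p / sigma * (`|e u a - e v a| +
    `|enorm (xi i - beta u a) ^+ 2 - enorm (xi i - beta v a) ^+ 2| / 2)) ->
  avg_signs (fun s => n%:R^-1 *
    `|signed_sum (fun i => hard_potential (z s) cost (psi s) (j s) (x s i) - M / 2) s|) <=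
  9 * M * Num.sqrt ((N * (d + 1))%:R / n%:R).
Proof.
move=> c M0 N0 d0 n0 p1 c01 psi1 psij e0 hloc hlip.
pose f v i := hard_potential (z v) cost (psi v) (j v) (x v i) / M.
have := @rademacher_local_class R _ N d n p xi beta e (fun v a => psi v a / M) j c f id.
move=> /(_ N0 d0 n0 p1 c01) h.
have -> : avg_signs (fun s => n%:R^-1 *
    `|signed_sum (fun i => hard_potential (z s) cost (psi s) (j s) (x s i) - M / 2) s|) =
  M * avg_signs (fun s => n%:R^-1 * `|signed_sum (fun i => f s i - 1 / 2) s|).
  rewrite -avg_signsZ; congr avg_signs; apply/funext => s.
  rewrite [RHS]mulrCA; congr (_ * _); rewrite -[X in X * `|_|](gtr0_norm M0) -normrM; congr `|_|.
  rewrite /signed_sum mulr_sumr; apply: eq_bigr => i _.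
  by rewrite /f mulrCA; congr (_ * _); field; rewrite gt_eqF.
rewrite [9 * M]mulrC -mulrA ler_pM2l //; apply: h => //.
- move=> v a; have /andP[h1 h2] := psi1 v a.
  by rewrite ler_pdivlMr // ler_pdivrMr // mul0r mulN1r h1 h2.
- by move=> v; rewrite psij mul0r.
- by move=> v a i; rewrite /f /c -mulrBl ler_pM2r ?invr_gt0 // hard_potential_le.
- move=> v i; have [a ha] := hard_potential_attained (z v) cost (psi v) (j v) (x v i).
  by exists a; rewrite /f ha mulrBl.
Qed.

Lemma hard_potential_lipschitz dT (T : measurableType dT) (N : nat) (z : 'I_N -> T)
    (cost : T -> T -> R) psi j x x' h : (forall a, `|cost x (z a) - cost x' (z a)| <= h) ->
  `|hard_potential z cost psi j x - hard_potential z cost psi j x'| <= h.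
Proof.
move=> hc; have le_shift u u' : (forall a, `|cost u (z a) - cost u' (z a)| <= h) ->
    hard_potential z cost psi j u - hard_potential z cost psi j u' <= h.
  move=> {}hc; have [a ->] := hard_potential_attained z cost psi j u'.
  have := hc a; have := hard_potential_le z cost psi j u a; rewrite ler_norml => ? /andP[? ?].
  by lra.
rewrite ler_norml le_shift // andbT lerNl opprB le_shift // => a.
by rewrite distrC.
Qed.

Lemma hard_potential_bounds dT (T : measurableType dT) (N : nat) (z : 'I_N -> T)
    (cost : T -> T -> R) M psi j x : (forall a, 0 <= cost x (z a) <= M) ->
  (forall a, psi a <= 0) -> psi j = 0 -> 0 <= hard_potential z cost psi j x <= M.
Proof.
move=> hc hpsi psij; apply/andP; split.
  by apply: le_hard_potential => a; have := hpsi a; have /andP[? _] := hc a; lra.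
by have := hard_potential_le z cost psi j x j; have /andP[_] := hc j; rewrite psij; lra.
Qed.

End hard_class.

Section ball_costs.
Context {R : realType}.

Lemma discrete_prob_carrier dT (T : measurableType dT) N (w : simplex R N) (y : 'I_N -> T) B :
  (forall a, B (y a)) -> (discrete_prob w y : probability T R) B = 1%E.
Proof.
move=> hy; transitivity (discrete_prob w y B) => //.
rewrite /discrete_prob -(weight_sum1 w) -sumEFin; apply: eq_bigr => a _.
by rewrite diracE mem_set ?mule1.
Qed.

Record hard_index (T : Type) (B : set T) (M : R) (N : nat) := HardIndex {
  atoms : 'I_N -> T ;
  price : 'I_N -> R ;
  base : 'I_N ;
  atomsP : forall a, B (atoms a) ;
  priceP : forall a, - M <= price a <= 0 ;
  baseP : price base = 0 }.

Lemma hard_index_exists (T : Type) (B : set T) (M : R) (N : nat) b :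
  (0 < N)%N -> 0 <= M -> B b -> hard_index B M N.
Proof.
move=> N0 M0 Bb; apply: (@HardIndex _ _ _ _ (fun=> b) (fun=> 0) (Ordinal N0)) => // a.
by rewrite lexx oppr_le0 M0.
Qed.

Definition truncated dT (T : measurableType dT) (c : T -> T -> R) (M : R) (x y : T) : R :=
  Num.min (c x y) M.

Lemma measurable_truncated dT (T : measurableType dT) (c : T -> T -> R) (M : R) :
  measurable_fun setT (fun z : T * T => c z.1 z.2) ->
  measurable_fun setT (fun z : T * T => truncated c M z.1 z.2).
Proof. by move=> mc; apply: measurable_minr. Qed.

Lemma truncated_ge0 dT (T : measurableType dT) (c : T -> T -> R) (M : R) x y :
  0 <= M -> (forall x y, 0 <= c x y) -> 0 <= truncated c M x y.
Proof. by move=> M0 c0; rewrite /truncated le_min c0 M0. Qed.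

Lemma truncated_le dT (T : measurableType dT) (c : T -> T -> R) (M : R) x y :
  truncated c M x y <= M.
Proof. by rewrite /truncated ge_min lexx orbT. Qed.

Lemma truncatedE dT (T : measurableType dT) (c : T -> T -> R) (M : R) x y :
  c x y <= M -> truncated c M x y = c x y.
Proof. by move=> h; rewrite /truncated min_l. Qed.

Context (d p : nat).
Local Notation V := 'rV[R]_d.

Lemma measurable_point_rV (x : V) : measurable [set x].
Proof.
have -> : [set x] = \bigcap_(k in [set: 'I_d]) ((fun y : V => y 0 k) @^-1` [set x 0 k]).
  apply/seteqP; split => y /=; first by move=> -> k.
  by move=> h; apply/rowP => k; exact: (h k).
apply: fin_bigcap_measurable => // k _; rewrite -[X in measurable X]setTI.
by apply: measurable_coord => //; exact: measurable_set1.
Qed.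

Lemma measurable_ecost : measurable_fun setT (fun z : V * V => ecost p z.1 z.2).
Proof.
apply: measurable_funX.
have msqrt : measurable_fun setT (@Num.sqrt R).
  by apply: continuous_measurable_fun; exact: sqrt_continuous.
apply: (measurableT_comp msqrt); apply: measurable_sum => k.
under eq_fun do rewrite !mxE.
have m1 := measurableT_comp (@measurable_coord R d k) (@measurable_fst _ _ V V).
have m2 := measurableT_comp (@measurable_coord R d k) (@measurable_snd _ _ V V).
by apply: measurable_funM; apply: measurable_funB.
Qed.

Lemma ecost_ge0 (x y : V) : 0 <= ecost p x y.
Proof. by rewrite /ecost exprn_ge0 // enorm_ge0. Qed.

Variable r : R.
Hypothesis r_gt0 : 0 < r.

Lemma eball0 : eball r (0 : V).
Proof.
rewrite /eball /= /enorm /edot big1 ?sqrtr0 ?(ltW r_gt0) // => i _.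
by rewrite mxE mul0r.
Qed.

Lemma ball_dist01 (x y : V) : eball r x -> eball r y -> 0 <= enorm (x - y) / (2 * r) <= 1.
Proof.
move=> Bx By; have r20 : 0 < 2 * r by rewrite mulr_gt0.
rewrite divr_ge0 ?enorm_ge0 ?(ltW r20) //= ler_pdivrMr // mul1r.
apply: le_trans (ler_enormD _ _) _; rewrite enormN.
by move: Bx By; rewrite /eball /=; lra.
Qed.

Lemma ecost_le (x y : V) : eball r x -> eball r y -> ecost p x y <= (2 * r) ^+ p.
Proof.
move=> Bx By; have r20 : 0 < 2 * r by rewrite mulr_gt0.
have /andP[_] := ball_dist01 Bx By; rewrite ler_pdivrMr // mul1r => h.
by apply: lerXn2r; rewrite ?nnegrE ?enorm_ge0 ?(ltW r20).
Qed.

Lemma truncated_ecostE (x y : V) : eball r x -> eball r y ->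
  truncated (@ecost R d p) ((2 * r) ^+ p) x y / (2 * r) ^+ p = (enorm (x - y) / (2 * r)) ^+ p.
Proof. by move=> Bx By; rewrite truncatedE ?ecost_le // /ecost expr_div_n. Qed.

(* |x-y|^2 + |x+y|^2 = 2|x|^2 + 2|y|^2, rescaled by 4r^2. *)
Lemma sqr_dist_defect (x y : V) : (enorm (x - y) / (2 * r)) ^+ 2 =
  1 - (enorm ((Num.sqrt 2 * r)^-1 *: x - - (Num.sqrt 2 * r)^-1 *: y) ^+ 2 / 2 +
       (r ^+ 2 - enorm y ^+ 2) / (2 * r ^+ 2) + (r ^+ 2 - enorm x ^+ 2) / (2 * r ^+ 2)).
Proof.
have s2 : Num.sqrt 2 ^+ 2 = 2 :> R by rewrite sqr_sqrtr.
have rn0 : r != 0 by rewrite gt_eqF.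
set k := (Num.sqrt 2 * r)^-1; have k2 : k ^+ 2 = (2 * r ^+ 2)^-1 by rewrite /k exprVn exprMn s2.
have -> : k *: x - - k *: y = k *: (x + y) by rewrite scaleNr opprK scalerDr.
rewrite enormZ expr_div_n !exprMn real_normK ?num_real // k2.
rewrite (sqr_enormD x y) (sqr_enormD x (- y)) enormN !edotE.
by field.
Qed.

Lemma truncated_ecost_lipschitz (x x' y : V) :
  eball r x -> eball r x' -> eball r y ->
  `|truncated (@ecost R d p) ((2 * r) ^+ p) x y - truncated (@ecost R d p) ((2 * r) ^+ p) x' y| <=
  (2 * r) ^+ p * p%:R / (2 * r) * enorm (x - x').
Proof.
move=> Bx Bx' By; have r20 : 0 < 2 * r by rewrite mulr_gt0.
have M0 : 0 < (2 * r) ^+ p by rewrite exprn_gt0.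
rewrite -[X in `|X - _|](divfK (lt0r_neq0 M0)) -[X in `|_ - X|](divfK (lt0r_neq0 M0)).
rewrite !truncated_ecostE // -mulrBl normrM (gtr0_norm M0) mulrC -!mulrA ler_pM2l //.
apply: (le_trans (norm_exprn_diff_le p (ball_dist01 Bx By) (ball_dist01 Bx' By))).
rewrite ler_wpM2l ?ler0n // -mulrBl normrM (gtr0_norm (x := (2 * r)^-1)) ?invr_gt0 //.
rewrite mulrC ler_pM2l ?invr_gt0 // ler_norml.
have := enorm_dist_triangle x x' y; have := enorm_dist_triangle x' x y.
by rewrite (enorm_distC x' x) => ? ?; apply/andP; split; lra.
Qed.

End ball_costs.

Section wasserstein.
Context {R : realType} (d p N n : nat) (r : R).
Local Notation V := 'rV[R]_d.
Hypothesis d_gt0 : (0 < d)%N.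
Hypothesis p_gt0 : (0 < p)%N.
Hypothesis N_gt0 : (0 < N)%N.
Hypothesis n_gt0 : (0 < n)%N.
Hypothesis r_gt0 : 0 < r.
Let M := (2 * r) ^+ p.
Let tcost : V -> V -> R := truncated (@ecost R d p) M.

Let M0 : 0 < M. Proof. by rewrite exprn_gt0 // mulr_gt0. Qed.
Let p1 : 1 <= p%:R :> R. Proof. by rewrite ler1n. Qed.
Let tcost0 x y : 0 <= tcost x y.
Proof. by apply: truncated_ge0 => *; [exact: ltW|exact: ecost_ge0]. Qed.
Let tcostM x y : tcost x y <= M. Proof. exact: truncated_le. Qed.
Let mtcost : measurable_fun setT (fun z : V * V => tcost z.1 z.2).
Proof. exact: (measurable_truncated M (measurable_ecost p)). Qed.

Let defect_ge0 (x : V) : eball r x -> 0 <= (r ^+ 2 - enorm x ^+ 2) / (2 * r ^+ 2).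
Proof.
move=> Bx; apply: divr_ge0; last by rewrite mulr_ge0 ?sqr_ge0.
rewrite subr_ge0; apply: lerXn2r; rewrite ?nnegrE ?enorm_ge0 ?(ltW r_gt0) //.
Qed.

Definition wasserstein_class (q : hard_index (eball r : set V) M N) (x : V) : R :=
  hard_potential (atoms q) tcost (price q) (base q) x - M / 2.

Lemma rademacher_wasserstein_class (x : 'I_n -> V)
    (sel : {ffun 'I_n -> bool} -> hard_index (eball r : set V) M N) :
  (forall i, eball r (x i)) ->
  avg_signs (fun s => n%:R^-1 * `|signed_sum (fun i => wasserstein_class (sel s) (x i)) s|) <=
  9 * M * Num.sqrt ((N * (d + 1))%:R / n%:R).
Proof.
move=> Bx; pose k := (Num.sqrt 2 * r)^-1.
have Ba v a := atomsP (sel v) a.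
apply: (rademacher_hard_class (p := p%:R) (z := fun v => atoms (sel v))
  (x := fun _ => x) (xi := fun i => k *: x i) (beta := fun v a => - k *: atoms (sel v) a)
  (e := fun v a => (r ^+ 2 - enorm (atoms (sel v) a) ^+ 2) / (2 * r ^+ 2))) => //.
- move=> v a i; rewrite divr_ge0 ?(ltW M0) ?tcost0 //=.
  by rewrite ler_pdivrMr // mul1r tcostM.
- by move=> v a; exact: priceP.
- by move=> v; exact: baseP.
- by move=> v a; exact: defect_ge0.
(* The three nonnegative parts of [1 - u^2] sum to at most [2 L / p]; one of them is half a squared
   distance, whence the constants 4 and 2. *)
- move=> sigma s0 _ v a i _; rewrite truncated_ecostE // => h.
  have /andP[u0 _] := ball_dist01 r_gt0 (Bx i) (Ba v a).
  have := sqr_root_defect p_gt0 s0 u0 h; rewrite sqr_dist_defect // -/k.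
  have := defect_ge0 (Bx i); have := defect_ge0 (Ba v a).
  have := sqr_ge0 (enorm (k *: x i - - k *: atoms (sel v) a)).
  set A := enorm _ ^+ 2; set e1 := (_ / (2 * _)); set e2 := (_ / (2 * _)) => A0 e10 e20.
  rewrite -!(mulrA _ (- ln sigma)); set L := - ln sigma / _.
  by move=> ?; split; lra.
- move=> sigma s0 _ u v a i; rewrite !truncated_ecostE // => h.
  apply: (le_trans (sqr_exprn_diff_le p_gt0 s0 (ball_dist01 r_gt0 (Bx i) (Ba u a))
    (ball_dist01 r_gt0 (Bx i) (Ba v a)) h)).
  rewrite ler_pM2l ?divr_gt0 ?ltr0n // !sqr_dist_defect // -/k.
  set A := enorm _ ^+ 2; set A' := enorm (_ - - k *: _) ^+ 2; set e1 := (_ / (2 * _)); set e2 := (_ / (2 * _)); set e3 := (_ / (2 * _)).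
  have -> : 1 - (A / 2 + e1 + e2) - (1 - (A' / 2 + e3 + e2)) = - (e1 - e3) - (A - A') / 2 by ring.
  apply: (le_trans (ler_normB _ _)); by rewrite normrN normrM lerD2l (@ger0_norm _ 2^-1) // invr_ge0.
Qed.

Lemma wasserstein_class_lipschitz q x x' : eball r x -> eball r x' ->
  `|wasserstein_class q x - wasserstein_class q x'| <= M * p%:R / (2 * r) * enorm (x - x').
Proof.
move=> Bx Bx'; have -> : forall u v s : R, u - s - (v - s) = u - v by move=> *; ring.
apply: hard_potential_lipschitz => a; apply: truncated_ecost_lipschitz => //.
exact: atomsP.
Qed.

Lemma wasserstein_class_norm q x : `|wasserstein_class q x| <= M.
Proof.
have : 0 <= hard_potential (atoms q) tcost (price q) (base q) x <= M.
  apply: hard_potential_bounds; last exact: baseP.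
    by move=> a; rewrite tcost0 tcostM.
  by move=> a; case/andP: (priceP q a).
rewrite /wasserstein_class => /andP[? ?]; rewrite ler_norml; apply/andP; split; move: M0; lra.
Qed.

Lemma Rint_wasserstein_class_diff q (mu mu' : probability V R) :
  \int[mu]_x wasserstein_class q x - \int[mu']_x wasserstein_class q x =
  \int[mu]_x hard_potential (atoms q) tcost (price q) (base q) x -
  \int[mu']_x hard_potential (atoms q) tcost (price q) (base q) x.
Proof.
have bh := bmfun_hard_potential (atoms q) mtcost tcost0 tcostM (price q) (base q).
rewrite /wasserstein_class.
rewrite (Rint_B mu bh (bmfun_cst _)) (Rint_B mu' bh (bmfun_cst _)) !Rintegral_prob_cst.
by ring.
Qed.

Lemma Wpp_diff (mu mu' : probability V R) (w : simplex R N) (y : 'I_N -> V) (b : R) :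
  mu (eball r) = 1%E -> mu' (eball r) = 1%E -> (forall a, eball r (y a)) ->
  (forall q, `|\int[mu]_x wasserstein_class q x - \int[mu']_x wasserstein_class q x| <= b) ->
  (`|Wpp p mu (discrete_prob w y) - Wpp p mu' (discrete_prob w y)| <= b%:E)%E.
Proof.
move=> muB mu'B By hb.
have local (m : probability V R) : m (eball r) = 1%E ->
    Wpp p m (discrete_prob w y) = ot_cost tcost m (discrete_prob w y).
  move=> mB; apply: (ot_cost_local (measurable_ecost p) mtcost (measurable_eball r) mB).
    exact: discrete_prob_carrier.
  by move=> u v Bu Bv; rewrite /tcost truncatedE // ecost_le.
rewrite !local //; apply: (ot_cost_diff w mtcost tcost0 tcostM) => [|psi j hpsi psij].
  exact: measurable_point_rV.
by have := hb (HardIndex By hpsi psij); rewrite Rint_wasserstein_class_diff.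
Qed.

Section process.
Context {d'} {Omega : measurableType d'}.
Variables (P : probability Omega R) (X : 'I_n -> {RV P >-> V}) (mu : probability V R).
Hypothesis iidX : iid_with_law X mu.
Hypothesis muB : mu (eball r) = 1%E.

Lemma Wpp_process (eta : R) : 0 < eta -> exists Z : Omega -> \bar R,
  [/\ measurable_fun setT Z, (forall w, 0 <= Z w)%E,
    (\int[P]_w Z w <=
       (2 * (9 * M * Num.sqrt ((N * (d + 1))%:R / n%:R)) + eta)%:E)%E &
    forall w (y : 'I_N -> V) (pi : simplex R N), (forall a, eball r (y a)) ->
      (`|Wpp p mu (discrete_prob pi y) -
         Wpp p (empirical R n_gt0 (fun i => X i w)) (discrete_prob pi y)| <= Z w)%E].
Proof.
move=> eta0.
have mF q : measurable_fun setT (wasserstein_class q).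
  have [m _] := bmfun_hard_potential (atoms q) mtcost tcost0 tcostM (price q) (base q).
  exact: measurable_funB.
have q0 := hard_index_exists N_gt0 (ltW M0) (eball0 d r_gt0).
have [Z [mZ Z0 iZ hZ]] := lipschitz_process q0 n_gt0 iidX muB mF wasserstein_class_norm
  wasserstein_class_lipschitz rademacher_wasserstein_class eta0.
exists Z; split => // w y pi By; have [->|[Bx h]] := hZ w; first by rewrite leey.
have [Zoo|Zfin] := eqVneq (Z w) +oo%E; first by rewrite Zoo leey.
have Zf : Z w \is a fin_num by rewrite ge0_fin_numE // ltey.
rewrite -(fineK Zf); apply: Wpp_diff => // [|q].
  exact: discrete_prob_carrier.
by rewrite -lee_fin fineK.
Qed.

End process.
End wasserstein.

(** * Potentials of projected measures *)

Section projections.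
Context {R : realType} (d p N n : nat) (r : R).
Local Notation V := 'rV[R]_d.
Hypothesis d_gt0 : (0 < d)%N.
Hypothesis p_gt0 : (0 < p)%N.
Hypothesis N_gt0 : (0 < N)%N.
Hypothesis n_gt0 : (0 < n)%N.
Hypothesis r_gt0 : 0 < r.
Let M := (2 * r) ^+ p.
Let dist_pow (s t : R) : R := `|s - t| ^+ p.
Let tcost : R -> R -> R := truncated dist_pow M.

Let r20 : 0 < 2 * r. Proof. by rewrite mulr_gt0. Qed.
Let M0 : 0 < M. Proof. by rewrite exprn_gt0. Qed.
Let p1 : 1 <= p%:R :> R. Proof. by rewrite ler1n. Qed.
Let tcost0 x y : 0 <= tcost x y.
Proof. by apply: truncated_ge0 => *; [exact: ltW|rewrite exprn_ge0]. Qed.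
Let tcostM x y : tcost x y <= M. Proof. exact: truncated_le. Qed.
Let mdist_pow : measurable_fun setT (fun z : R * R => dist_pow z.1 z.2).
Proof.
apply: measurable_funX; apply: (measurableT_comp (@normr_measurable R setT)).
exact: measurable_funB.
Qed.
Let mtcost : measurable_fun setT (fun z : R * R => tcost z.1 z.2).
Proof. exact: (measurable_truncated M mdist_pow). Qed.

Let segment01 (s t : R) : `[- r, r]%classic s -> `[- r, r]%classic t -> 0 <= `|s - t| / (2 * r) <= 1.
Proof.
rewrite /= !in_itv /= => /andP[s1 s2] /andP[t1 t2].
rewrite divr_ge0 ?(ltW r20) //= ler_pdivrMr // mul1r ler_norml; apply/andP; split; lra.
Qed.

Let dist_pow_le (s t : R) : `[- r, r]%classic s -> `[- r, r]%classic t -> dist_pow s t <= M.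
Proof.
move=> hs ht; have /andP[_] := segment01 hs ht; rewrite ler_pdivrMr // mul1r => h.
by apply: lerXn2r; rewrite ?nnegrE ?(ltW r20).
Qed.

Let tcostE (s t : R) : `[- r, r]%classic s -> `[- r, r]%classic t ->
  tcost s t / M = (`|s - t| / (2 * r)) ^+ p.
Proof. by move=> hs ht; rewrite /tcost truncatedE ?dist_pow_le // /dist_pow expr_div_n. Qed.

Lemma edot_segment (theta x : V) : enorm theta = 1 -> eball r x ->
  `[- r, r]%classic (edot theta x).
Proof.
move=> t1 Bx; rewrite /= in_itv /= -ler_norml.
by apply: le_trans (norm_edot_le _ _) _; rewrite t1 mul1r.
Qed.

(* Completing the square in [theta . x] makes the projection distance an
   affine function of squared Euclidean distances, as for the full cost. *)
Lemma projection_defect (theta x : V) z : enorm theta = 1 ->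
  (edot theta x - z) / (2 * r) =
  1 - (enorm ((Num.sqrt 2 * r)^-1 *: x - (Num.sqrt 2)^-1 *: theta) ^+ 2 / 2 +
       (1 + z / r) / 2 + (1 - enorm x ^+ 2 / r ^+ 2) / 4).
Proof.
move=> t1; have s2 : Num.sqrt 2 ^+ 2 = 2 :> R by rewrite sqr_sqrtr.
have rn0 : r != 0 by rewrite gt_eqF.
have sn0 : Num.sqrt 2 != 0 :> R by rewrite gt_eqF // sqrtr_gt0.
set c := (Num.sqrt 2)^-1.
have c2 : c ^+ 2 = 2^-1 by rewrite /c exprVn s2.
have -> : (Num.sqrt 2 * r)^-1 *: x - c *: theta = c *: (r^-1 *: x - theta).
  by rewrite scalerBr scalerA -invfM.
rewrite enormZ exprMn real_normK ?num_real // c2 sqr_enormD enormN enormZ exprMn t1.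
rewrite real_normK ?num_real // !edotE (edotC x theta).
by field.
Qed.

(* When [z_j <= 0], a projection at distance nearly [2r] from [z_j] is nearly [r]. *)
Lemma oriented_defect (sigma u zj z : R) : 0 < sigma ->
  `|u| <= r -> - r <= zj <= 0 -> `|z| <= r ->
  sigma <= (`|u - zj| / (2 * r)) ^+ p -> sigma <= (`|u - z| / (2 * r)) ^+ p ->
  1 - (u - z) / (2 * r) <= - ln sigma / p%:R \/ 1 / 2 <= - ln sigma / p%:R.
Proof.
move=> s0 hu hj hz sj sz; set l := - ln sigma / _.
have [?|l2] := leP (1 / 2) l; [by right|left].
have nn (a : R) : 0 <= `|a| / (2 * r) by rewrite divr_ge0 ?(ltW r20).
have := root_defect p_gt0 s0 (nn _) sj; have := root_defect p_gt0 s0 (nn _) sz.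
rewrite -/l; have E (a : R) : `|a| / (2 * r) = `|a / (2 * r)|.
  by rewrite normrM (gtr0_norm (x := (2 * r)^-1)) ?invr_gt0.
rewrite !E !mulrBl.
have bound (a : R) : `|a| <= r -> - (1 / 2) <= a / (2 * r) <= 1 / 2.
  by rewrite ler_norml => /andP[? ?]; rewrite ler_pdivlMr // ler_pdivrMr //; apply/andP; split; lra.
have := bound _ hu; have := bound _ hz.
have zj2 : zj / (2 * r) <= 0 by case/andP: hj => _ h; rewrite pmulr_lle0 ?invr_gt0.
have := bound zj; rewrite ler_norml; case/andP: hj => -> hj0 /=.
move=> /(_ (le_trans hj0 (ltW r_gt0))).
move: (u / _) (z / _) (zj / _) zj2 => a b c c0 /andP[c1 c2] /andP[b1 b2] /andP[a1 a2].
by case: (ger0P (a - b)); case: (ger0P (a - c)); lra.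
Qed.

Definition projection_index :=
  ({theta : V | enorm theta = 1} * hard_index `[- r, r]%classic M N)%type.

Definition projection_class (q : projection_index) (x : V) : R :=
  hard_potential (atoms q.2) tcost (price q.2) (base q.2) (edot (sval q.1) x) - M / 2.

Lemma rademacher_projection_class (x : 'I_n -> V)
    (sel : {ffun 'I_n -> bool} -> projection_index) :
  (forall i, eball r (x i)) ->
  avg_signs (fun s => n%:R^-1 * `|signed_sum (fun i => projection_class (sel s) (x i)) s|) <=
  9 * M * Num.sqrt ((N * (d + 1))%:R / n%:R).
Proof.
move=> Bx; pose k := (Num.sqrt 2 * r)^-1.
pose th v : V := sval (sel v).1; have th1 v : enorm (th v) = 1 := svalP (sel v).1.
pose z v a : R := atoms (sel v).2 a; pose j v := base (sel v).2.
(* Flipping direction and projected atoms together leaves distances unchanged and puts the base atom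
   on the nonpositive side, so that localised sample points project near [+ r]. *)
pose o v : R := if z v (j v) <= 0 then 1 else -1.
have o1 v : `|o v| = 1 by rewrite /o; case: ifP; rewrite ?normr1 ?normrN1.
have oth v : enorm (o v *: th v) = 1 by rewrite enormZ o1 mul1r th1.
have zr v a : `|z v a| <= r.
  by have := atomsP (sel v).2 a; rewrite /= in_itv /= -ler_norml.
have ozr v a : `|o v * z v a| <= r by rewrite normrM o1 mul1r.
have ozj v : - r <= o v * z v (j v) <= 0.
  have := ozr v (j v); rewrite ler_norml => /andP[-> _] /=.
  by rewrite /o; case: (leP (z v (j v)) 0) => h; [rewrite mul1r|rewrite mulN1r oppr_le0 ltW].
have hz v a : `[- r, r]%classic (z v a) := atomsP (sel v).2 a.
have hx v i : `[- r, r]%classic (edot (th v) (x i)) := edot_segment (th1 v) (Bx i).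
have oabs v a i : `|edot (th v) (x i) - z v a| = `|edot (o v *: th v) (x i) - o v * z v a|.
  by rewrite edotZl -mulrBr normrM o1 mul1r.
have def v a i := @projection_defect (o v *: th v) (x i) (o v * z v a) (oth v).
have x1 i : 0 <= 1 - enorm (x i) ^+ 2 / r ^+ 2.
  rewrite subr_ge0 ler_pdivrMr ?exprn_gt0 // mul1r; apply: lerXn2r; rewrite ?nnegrE ?enorm_ge0 ?(ltW r_gt0) //.
  exact: Bx.
have e0 v a : 0 <= (1 + o v * z v a / r) / 2 <= 1.
  have : -1 <= o v * z v a / r <= 1.
    rewrite ler_pdivlMr // ler_pdivrMr // mulN1r mul1r -ler_norml; exact: ozr.
  by move=> /andP[? ?]; apply/andP; split; lra.
(* [beta] is the oriented direction, the same for all atoms, and [e] carries the projected atom: the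
   lattice of the full cost already covers directions. *)
apply: (rademacher_hard_class (p := p%:R) (z := z)
  (x := fun v i => edot (th v) (x i)) (xi := fun i => k *: x i)
  (beta := fun v a => (Num.sqrt 2)^-1 *: (o v *: th v))
  (e := fun v a => (1 + o v * z v a / r) / 2)) => //.
- move=> v a i; rewrite divr_ge0 ?(ltW M0) ?tcost0 //=.
  by rewrite ler_pdivrMr // mul1r tcostM.
- by move=> v a; exact: priceP.
- by move=> v; exact: baseP.
- by move=> v a; case/andP: (e0 v a).
- move=> sigma s0 _ v a i; rewrite !tcostE // !oabs => sj sa.
  have hu : `|edot (o v *: th v) (x i)| <= r.
    by have := edot_segment (oth v) (Bx i); rewrite /= in_itv /= -ler_norml.
  have := oriented_defect s0 hu (ozj v) (ozr v a) sj sa.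
  have := e0 v a; have := x1 i; have := def v a i; rewrite -/k -!(mulrA _ (- ln sigma)).
  set B := (Num.sqrt 2)^-1 *: _.
  have := sqr_ge0 (enorm (k *: x i - B)).
  set l := - ln sigma / _; set A := enorm (_ - B) ^+ 2; set X := enorm (x i) ^+ 2 / _.
  have -> : o v * z v a / r = 2 * (o v * z v a / (2 * r)) by field; rewrite gt_eqF.
  have : - (1 / 2) <= edot (o v *: th v) (x i) / (2 * r).
    by rewrite ler_pdivlMr //; move: hu; rewrite ler_norml => /andP[? _]; lra.
  have X0 : 0 <= X by rewrite divr_ge0 ?sqr_ge0.
  (* When [1/2 <= L / p] both bounds are automatic: the squared distance is at most 2 and [e] at
     most 1. *)
  rewrite mulrBl; move: (_ / (2 * r)) (_ / (2 * r)) => t t' ? ? ? ? /andP[? ?] [?|?]; split; lra.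
- move=> sigma s0 s1 u v a i h.
  have s11 : 1 <= sigma^-1 by rewrite invf_ge1 //; lra.
  have b01 w : 0 <= `|edot (th w) (x i) - z w a| / (2 * r) <= 1 by exact: segment01.
  rewrite !tcostE //; apply: (le_trans (norm_exprn_diff_le p (b01 u) (b01 v))).
  rewrite -[p%:R / sigma * _]mulrA ler_wpM2l ?ler0n //.
  rewrite !oabs; have E (b : R) : `|b| / (2 * r) = `|b / (2 * r)|.
    by rewrite normrM (gtr0_norm (x := (2 * r)^-1)) ?invr_gt0.
  rewrite !E; apply: (le_trans (ler_dist_dist _ _)); rewrite !def -/k.
  set A := enorm _ ^+ 2; set A' := enorm (_ - _ *: (o v *: th v)) ^+ 2.
  set e1 := (1 + _) / 2; set e2 := (1 - _) / 4; set e3 := (1 + _) / 2.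
  have -> : 1 - (A / 2 + e1 + e2) - (1 - (A' / 2 + e3 + e2)) = - (e1 - e3) - (A - A') / 2 by ring.
  apply: (le_trans (ler_normB _ _)).
  rewrite normrN normrM (@ger0_norm _ 2^-1) ?invr_ge0 //.
  by apply: ler_peMl => //; rewrite addr_ge0 // mulr_ge0 // invr_ge0.
Qed.

Lemma projection_class_lipschitz q x x' : eball r x -> eball r x' ->
  `|projection_class q x - projection_class q x'| <= M * p%:R / (2 * r) * enorm (x - x').
Proof.
move=> Bx Bx'; have -> : forall u v s : R, u - s - (v - s) = u - v by move=> *; ring.
apply: hard_potential_lipschitz => a.
have th1 : enorm (sval q.1) = 1 := svalP q.1.
have hz := atomsP q.2 a; have hx := edot_segment th1 Bx; have hx' := edot_segment th1 Bx'.
rewrite -[X in `|X - _|](divfK (lt0r_neq0 M0)) -[X in `|_ - X|](divfK (lt0r_neq0 M0)).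
rewrite !tcostE // -mulrBl normrM (gtr0_norm M0) mulrC -!mulrA ler_pM2l //.
apply: (le_trans (norm_exprn_diff_le p (segment01 hx hz) (segment01 hx' hz))).
rewrite ler_wpM2l ?ler0n // -mulrBl normrM (gtr0_norm (x := (2 * r)^-1)) ?invr_gt0 //.
rewrite mulrC ler_pM2l ?invr_gt0 //.
apply: (le_trans (ler_dist_dist _ _)).
have -> : forall u v s : R, u - s - (v - s) = u - v by move=> *; ring.
rewrite -edotNr -edotDr; apply: le_trans (norm_edot_le _ _) _.
by rewrite th1 mul1r.
Qed.

Lemma projection_class_norm q x : `|projection_class q x| <= M.
Proof.
have : 0 <= hard_potential (atoms q.2) tcost (price q.2) (base q.2) (edot (sval q.1) x) <= M.
  apply: hard_potential_bounds; last exact: baseP.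
    by move=> a; rewrite tcost0 tcostM.
  by move=> a; case/andP: (priceP q.2 a).
rewrite /projection_class => /andP[? ?]; rewrite ler_norml; apply/andP; split; move: M0; lra.
Qed.

End projections.

Section distribution.
Context {R : realType} {dA dB} {A : measurableType dA} {B : measurableType dB}.
Variables (mu : probability A R) (f : {mfun A >-> B}).

Lemma Rint_distribution (g : B -> R) : bmfun g ->
  \int[distribution mu f]_z g z = \int[mu]_x g (f x).
Proof.
move=> [mg [K gK]]; rewrite /Rintegral integral_distribution //; first exact/measurable_EFinP.
have bg : bmfun (g \o f).
  by split; [exact: (measurableT_comp mg (measurable_funPT f))|exists K => x; exact: gK].
exact: (bmfun_integrable mu bg).
Qed.

Lemma distribution_carrier (S : set A) (S' : set B) : measurable S -> measurable S' ->
  mu S = 1%E -> (forall x, S x -> S' (f x)) -> distribution mu f S' = 1%E.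
Proof.
move=> mS mS' S1 h; transitivity (mu (f @^-1` S')) => //.
have mf : measurable (f @^-1` S').
  by rewrite -[X in measurable X]setTI; exact: (measurable_funPT f).
apply/eqP; rewrite eq_le (probability_le1 mu mf) /= -S1.
by apply: le_measure; rewrite ?inE //; exact: h.
Qed.

End distribution.

Section cost_bound.
Context {R : realType} {d} {T : measurableType d}.
Implicit Types (mu nu : probability T R).

Lemma ot_cost_ge0 (c : T -> T -> R) mu nu : (forall x y, 0 <= c x y) ->
  (0 <= ot_cost c mu nu)%E.
Proof.
by move=> c0; apply: le_ereal_inf_tmp => _ [g _ <-]; apply: integral_ge0 => z _; rewrite lee_fin.
Qed.

Lemma ot_cost_le (c : T -> T -> R) M mu nu :
  measurable_fun setT (fun z : T * T => c z.1 z.2) ->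
  (forall x y, 0 <= c x y <= M) -> (ot_cost c mu nu <= M%:E)%E.
Proof.
move=> mc cM; pose g : probability (T * T)%type R := (mu \x nu)%E.
have one (m : probability T R) : m setT = 1%E by exact: probability_setT.
have gc : coupling mu nu g.
  split => A mA.
    transitivity (mu A * nu setT)%E; first exact: product_measure1E.
    by rewrite one mule1.
  transitivity (mu setT * nu A)%E; first exact: product_measure1E.
  by rewrite one mul1e.
apply: le_trans (ereal_inf_lbound _) _; first by exists g; first exact: gc.
have bc : bmfun (fun z : T * T => c z.1 z.2).
  by split => //; exists M => z; have /andP[c0 c1] := cM z.1 z.2; rewrite ger0_norm.
rewrite -Rintegral_EFin // lee_fin -[leRHS](Rintegral_prob_cst g).
apply: (Rint_le (B := setT)) => //; [exact: probability_setT|exact: bmfun_cst|].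
by move=> z _; have /andP[] := cM z.1 z.2.
Qed.

End cost_bound.

Lemma exists_unit_vector (R : realType) d : (0 < d)%N -> exists x : 'rV[R]_d, enorm x = 1.
Proof.
move=> d0; exists (\row_k (k == Ordinal d0)%:R).
rewrite /enorm /edot (bigD1 (Ordinal d0)) //= mxE eqxx mulr1 big1 ?addr0 ?sqrtr1 // => k hk.
by rewrite mxE (negbTE hk) mul0r.
Qed.

Section projected_difference.
Context {R : realType} (d p N n : nat) (r : R).
Local Notation V := 'rV[R]_d.
Hypothesis d_gt0 : (0 < d)%N.
Hypothesis p_gt0 : (0 < p)%N.
Hypothesis N_gt0 : (0 < N)%N.
Hypothesis n_gt0 : (0 < n)%N.
Hypothesis r_gt0 : 0 < r.
Let M := (2 * r) ^+ p.
Let dist_pow (s t : R) : R := `|s - t| ^+ p.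
Let tcost : R -> R -> R := truncated dist_pow M.
Let M0 : 0 < M. Proof. by rewrite exprn_gt0 // mulr_gt0. Qed.
Let tcost0 x y : 0 <= tcost x y.
Proof. by apply: truncated_ge0 => *; [exact: ltW|rewrite exprn_ge0]. Qed.
Let tcostM x y : tcost x y <= M. Proof. exact: truncated_le. Qed.
Let mdist_pow : measurable_fun setT (fun z : R * R => dist_pow z.1 z.2).
Proof.
apply: measurable_funX; apply: (measurableT_comp (@normr_measurable R setT)).
exact: measurable_funB.
Qed.
Let mtcost : measurable_fun setT (fun z : R * R => tcost z.1 z.2).
Proof. exact: (measurable_truncated M mdist_pow). Qed.
Let msegment : measurable `[- r, r]%classic. Proof. exact: measurable_itv. Qed.

Section projected_cost.
Variables (w : simplex R N) (y : 'I_N -> V).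
Hypothesis By : forall a, eball r (y a).
Let nu : probability V R := discrete_prob w y.

Lemma Wpp_projE (mu : probability V R) theta : mu (eball r) = 1%E -> enorm theta = 1 ->
  Wpp_proj p mu nu theta =
  ot_cost tcost (distribution mu (edot theta)) (discrete_prob w (fun a => edot theta (y a))).
Proof.
move=> muB t1; rewrite /Wpp_proj.
transitivity (ot_cost dist_pow (distribution mu (edot theta))
    (discrete_prob w (fun a => edot theta (y a)))).
  by apply: ot_cost_ext.
apply: (ot_cost_local mdist_pow mtcost msegment).
- apply: (distribution_carrier (measurable_eball r) msegment muB) => x.
  exact: edot_segment.
- by apply: discrete_prob_carrier => a; exact: edot_segment.
- move=> u v hu hv; rewrite /tcost truncatedE //.
  move: hu hv; rewrite /= !in_itv /= => /andP[s1 s2] /andP[t1' t2].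
  apply: lerXn2r; rewrite ?nnegrE ?mulr_ge0 ?(ltW r_gt0) //.
  by rewrite ler_norml; apply/andP; split; lra.
Qed.

Lemma Wpp_proj_bounds (mu : probability V R) theta : mu (eball r) = 1%E -> enorm theta = 1 ->
  (0 <= Wpp_proj p mu nu theta <= M%:E)%E.
Proof.
move=> muB t1; rewrite Wpp_projE // ot_cost_ge0 //= ot_cost_le // => u v.
by rewrite tcost0 tcostM.
Qed.

Lemma Wpp_proj_diff (mu mu' : probability V R) (b : R) theta :
  mu (eball r) = 1%E -> mu' (eball r) = 1%E -> enorm theta = 1 ->
  (forall q : projection_index d p N r,
    `|\int[mu]_x projection_class q x - \int[mu']_x projection_class q x| <= b) ->
  (`|Wpp_proj p mu nu theta - Wpp_proj p mu' nu theta| <= b%:E)%E.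
Proof.
move=> muB mu'B t1 hb; rewrite !Wpp_projE //.
apply: (ot_cost_diff w mtcost tcost0 tcostM) => [x|psi j hpsi psij].
  exact: measurable_set1.
have hy a : `[- r, r]%classic (edot theta (y a)) by exact: edot_segment.
pose q : projection_index d p N r := (exist _ theta t1, HardIndex hy hpsi psij).
have bh := bmfun_hard_potential (atoms q.2) mtcost tcost0 tcostM psi j.
rewrite !(Rint_distribution _ _ bh).
have be : bmfun (fun x => hard_potential (atoms q.2) tcost psi j (edot theta x)).
  have [mh [K hK]] := bh; split; last by exists K => x.
  by apply: measurableT_comp => //; exact: measurable_edot.
have := hb q; rewrite /projection_class.
rewrite (Rint_B mu be (bmfun_cst _)) (Rint_B mu' be (bmfun_cst _)) !Rintegral_prob_cst.
by have -> : forall u v s : R, u - s - (v - s) = u - v by move=> *; ring.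
Qed.

End projected_cost.

Section process.
Context {d'} {Omega : measurableType d'}.
Variables (P : probability Omega R) (X : 'I_n -> {RV P >-> V}) (mu : probability V R).
Hypothesis iidX : iid_with_law X mu.
Hypothesis muB : mu (eball r) = 1%E.

Lemma Wpp_proj_process (eta : R) : 0 < eta -> exists Z : Omega -> \bar R,
  [/\ measurable_fun setT Z, (forall w, 0 <= Z w)%E,
    (\int[P]_w Z w <=
       (2 * (9 * M * Num.sqrt ((N * (d + 1))%:R / n%:R)) + eta)%:E)%E &
    forall w, Z w = +oo%E \/ ((forall i, eball r (X i w)) /\
      forall (y : 'I_N -> V) (pi : simplex R N) theta, (forall a, eball r (y a)) ->
      enorm theta = 1 ->
      (`|Wpp_proj p mu (discrete_prob pi y) theta -
         Wpp_proj p (empirical R n_gt0 (fun i => X i w)) (discrete_prob pi y) theta| <= Z w)%E)].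
Proof.
move=> eta0.
have mF (q : projection_index d p N r) : measurable_fun setT (projection_class q).
  have [m _] := bmfun_hard_potential (atoms q.2) mtcost tcost0 tcostM (price q.2) (base q.2).
  by apply: measurable_funB => //; apply: measurableT_comp => //; exact: measurable_edot.
have B0 : `[- r, r]%classic (0 : R) by rewrite /= in_itv /= oppr_le0 ltW ?ltW.
have [th th1] := exists_unit_vector R d_gt0.
have q0 : projection_index d p N r :=
  (exist _ th th1, hard_index_exists N_gt0 (ltW M0) B0).
have [Z [mZ Z0 iZ hZ]] := lipschitz_process q0 n_gt0 iidX muB mF
  (projection_class_norm r_gt0) (projection_class_lipschitz r_gt0)
  (rademacher_projection_class d_gt0 p_gt0 N_gt0 n_gt0 r_gt0) eta0.
exists Z; split => // w; have [->|[Bx h]] := hZ w; first by left.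
have [Zoo|Zfin] := eqVneq (Z w) +oo%E; [by left|right; split => // y pi theta By t1].
have Zf : Z w \is a fin_num by rewrite ge0_fin_numE // ltey.
rewrite -(fineK Zf); apply: Wpp_proj_diff => // [|q].
  exact: discrete_prob_carrier.
by rewrite -lee_fin fineK.
Qed.

End process.
End projected_difference.

(** * Averages and suprema over directions *)

Section lower_integral.
Import HBNNSimple.
Context {R : realType} {d} {T : measurableType d}.
Variable sigma : probability T R.
Implicit Types f g : T -> \bar R.
Local Open Scope ereal_scope.

(** [f] and [g] are arbitrary. For a simple function [h] below [f], the positive part of [h - b] is
    measurable and lies below [g], so additivity is applied to it alone. *)
Lemma ge0_integral_le_addcst f g (b : R) : (0 <= b)%R -> (forall x, 0 <= f x) ->
  (forall x, 0 <= g x) -> (forall x, f x <= g x + b%:E) ->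
  \int[sigma]_x f x <= \int[sigma]_x g x + b%:E.
Proof.
move=> b0 f0 g0 fg; rewrite [leLHS]ge0_integralTE //; apply: ge_ereal_sup => _ [h hf <-].
have mh : measurable_fun setT (fun x : T => Num.max (h x - b) 0)%R.
  by apply: measurable_maxr => //; exact: measurable_funB.
rewrite -integralT_nnsfun.
apply: (@le_trans _ _ (\int[sigma]_x ((Num.max (h x - b) 0)%:E + b%:E))).
  apply: ge0_le_integral_all => x; first by rewrite lee_fin.
  by rewrite -EFinD lee_fin -lerBlDr le_max lexx.
rewrite ge0_integralD //; last 2 first.
- by move=> x _; rewrite lee_fin le_max lexx orbT.
- exact/measurable_EFinP.
rewrite integral_cst // [X in _ * X](_ : _ = 1) ?mule1; last exact: probability_setT.
rewrite leeD2r //; apply: ge0_le_integral_all => x; first by rewrite lee_fin le_max lexx orbT.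
have := le_trans (hf x) (fg x); rewrite EFin_max ge_max g0 andbT EFinB.
by rewrite leeBlDr.
Qed.

End lower_integral.

Section sliced.
Context {R : realType}.
Local Open Scope ereal_scope.

Lemma abse_diff_le (u v : \bar R) (b : R) : u \is a fin_num -> v \is a fin_num ->
  u <= v + b%:E -> v <= u + b%:E -> `|u - v| <= b%:E.
Proof.
move=> /fineK <- /fineK <-; rewrite -!EFinD !lee_fin => h1 h2.
by rewrite ler_norml; apply/andP; split; lra.
Qed.

Lemma abse_diff_ge (u v : \bar R) (b : R) : u \is a fin_num -> v \is a fin_num ->
  `|u - v| <= b%:E -> u <= v + b%:E /\ v <= u + b%:E.
Proof.
move=> /fineK <- /fineK <-; rewrite -!EFinB -!EFinD !lee_fin ler_norml.
by move=> /andP[? ?]; split; lra.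
Qed.

Lemma fin_num_between (u : \bar R) (M : R) : 0 <= u <= M%:E -> u \is a fin_num.
Proof. by move=> /andP[u0 uM]; rewrite ge0_fin_numE // (le_lt_trans uM) // ltry. Qed.

Context (d p : nat).
Local Notation V := 'rV[R]_d.
Variables (mu mu' nu : probability V R) (M b : R).
Let f := Wpp_proj p mu nu.
Let g := Wpp_proj p mu' nu.
Hypothesis f_bounds : forall theta, enorm theta = 1%R -> 0 <= f theta <= M%:E.
Hypothesis g_bounds : forall theta, enorm theta = 1%R -> 0 <= g theta <= M%:E.
Hypothesis b_ge0 : (0 <= b)%R.
Hypothesis fg : forall theta, enorm theta = 1%R -> `|f theta - g theta| <= b%:E.

Let fg_le theta : enorm theta = 1%R -> f theta <= g theta + b%:E /\ g theta <= f theta + b%:E.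
Proof.
by move=> t1; apply: abse_diff_ge (fg t1); [apply: fin_num_between (f_bounds t1)|
  apply: fin_num_between (g_bounds t1)].
Qed.

Let f_le theta (t1 : enorm theta = 1%R) := proj1 (fg_le t1).
Let g_le theta (t1 : enorm theta = 1%R) := proj2 (fg_le t1).

Lemma maxSWpp_diff (theta0 : V) : enorm theta0 = 1%R ->
  `|maxSWpp p mu nu - maxSWpp p mu' nu| <= b%:E.
Proof.
move=> t01.
have fin (m : probability V R) :
    (forall theta : V, enorm theta = 1%R -> 0 <= Wpp_proj p m nu theta <= M%:E) ->
    maxSWpp p m nu \is a fin_num.
  move=> h; apply: (@fin_num_between _ M); apply/andP; split.
    by have /andP[h0 _] := h _ t01; apply: (le_trans h0); apply: ereal_sup_ubound; exists theta0.
  by apply: ge_ereal_sup => _ [t t1 <-]; case/andP: (h _ t1).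
apply: abse_diff_le; [exact: fin|exact: fin| |].
  apply: ge_ereal_sup => _ [t t1 <-]; apply: (le_trans (f_le t1)); rewrite leeD2r //.
  by apply: ereal_sup_ubound; exists t.
apply: ge_ereal_sup => _ [t t1 <-]; apply: (le_trans (g_le t1)); rewrite leeD2r //.
by apply: ereal_sup_ubound; exists t.
Qed.

Lemma SWpp_diff (sigma : probability V R) :
  `|SWpp p sigma mu nu - SWpp p sigma mu' nu| <= b%:E.
Proof.
have M0 : (0 <= Num.max M 0)%R by rewrite le_max lexx orbT.
pose on_sphere (h : V -> \bar R) := h \_ (@esphere R d).
have patch0 h : (forall theta : V, enorm theta = 1%R -> 0 <= h theta) ->
    forall x, 0 <= on_sphere h x.
  move=> h0 x; rewrite /on_sphere patchE; case: ifPn => // /set_mem; exact: h0.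
have f0 := patch0 f (fun t t1 => proj1 (andP (f_bounds t1))).
have g0 := patch0 g (fun t t1 => proj1 (andP (g_bounds t1))).
have patch_le (u v : V -> \bar R) (c : R) : (0 <= c)%R ->
    (forall theta : V, enorm theta = 1%R -> u theta <= v theta + c%:E) ->
    forall x, on_sphere u x <= on_sphere v x + c%:E.
  move=> c0 h x; rewrite /on_sphere !patchE; case: ifPn => [/set_mem /h //|_].
  by rewrite add0e lee_fin.
have fin (h : V -> \bar R) : (forall theta : V, enorm theta = 1%R -> 0 <= h theta <= M%:E) ->
    \int[sigma]_x on_sphere h x \is a fin_num.
  move=> hb; have h0 := patch0 h (fun t t1 => proj1 (andP (hb t t1))).
  apply: (@fin_num_between _ (Num.max M 0)%R); rewrite integral_ge0 //=.
  have := @ge0_integral_le_addcst _ _ _ sigma (on_sphere h) (cst 0) _ M0 h0.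
  rewrite integral0 add0e; apply => // x; rewrite /on_sphere patchE.
  case: ifPn => [/set_mem t1|_]; last by rewrite lee_fin.
  by case/andP: (hb _ t1) => _ /le_trans; apply; rewrite lee_fin le_max lexx.
rewrite /SWpp ![\int[_]_(_ in @esphere R d) _]integral_mkcond.
apply: abse_diff_le; [exact: fin|exact: fin| |].
  by apply: ge0_integral_le_addcst => //; exact: patch_le.
by apply: ge0_integral_le_addcst => //; exact: patch_le.
Qed.

End sliced.

Section tilting.
Context {R : realType} (N : nat) (w : simplex R N) (eps : R) (psi : 'I_N -> R).
Hypothesis eps_gt0 : 0 < eps.

Let w0 a : 0 <= w a. Proof. by case/andP: (weight01 w a). Qed.

Let Z := \sum_a w a * expR (psi a / eps).

Let Z_gt0 : 0 < Z.
Proof.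
have := softmin_sum_gt0 eps_gt0 (fun a => - psi a) w0 (weight_sum1 w).
by under eq_bigr do rewrite mulNr opprK.
Qed.

Let tilt a := w a * expR (psi a / eps) / Z.

Let tilt_ge0 a : 0 <= tilt a.
Proof. by rewrite divr_ge0 ?(ltW Z_gt0) // mulr_ge0 ?expR_ge0. Qed.

Let tilt_sum : \sum_a tilt a = 1.
Proof. by rewrite -mulr_suml divff // gt_eqF. Qed.

Let tilt01 a : 0 <= tilt a <= 1.
Proof. by rewrite tilt_ge0 /= -tilt_sum (bigD1 a) //= lerDl sumr_ge0. Qed.

Definition tilted : simplex R N := Simplex tilt01 tilt_sum.

(** Prices are absorbed into the weights, up to a constant that cancels in differences of integrals:
    the soft class has [N (d + 1)] parameters, not [N (d + 2)]. *)
Lemma softmin_tilted (c : 'I_N -> R) :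
  softmin eps w (fun a => c a - psi a) = softmin eps tilted c - eps * ln Z.
Proof.
rewrite /softmin -opprD -mulrDr; congr (- (_ * _)).
have c0 := softmin_sum_gt0 eps_gt0 c tilt_ge0 tilt_sum.
rewrite -lnM ?posrE //; congr ln; rewrite mulr_suml; apply: eq_bigr => a _.
rewrite /= /tilt mulrAC divfK ?gt_eqF // -mulrA -expRD; congr (_ * expR _).
by rewrite mulrBl; ring.
Qed.

End tilting.

Section entropic.
Context {R : realType} (d p N n : nat) (r eps : R).
Local Notation V := 'rV[R]_d.
Hypothesis d_gt0 : (0 < d)%N.
Hypothesis p_gt0 : (0 < p)%N.
Hypothesis N_gt0 : (0 < N)%N.
Hypothesis n_gt0 : (0 < n)%N.
Hypothesis r_gt0 : 0 < r.
Hypothesis eps_gt0 : 0 < eps.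
Let M := (2 * r) ^+ p.
Let tcost : V -> V -> R := truncated (@ecost R d p) M.

Let M0 : 0 < M. Proof. by rewrite exprn_gt0 // mulr_gt0. Qed.
Let p1 : 1 <= p%:R :> R. Proof. by rewrite ler1n. Qed.
Let tcost0 x y : 0 <= tcost x y.
Proof. by apply: truncated_ge0 => *; [exact: ltW|exact: ecost_ge0]. Qed.
Let tcostM x y : tcost x y <= M. Proof. exact: truncated_le. Qed.
Let mtcost : measurable_fun setT (fun z : V * V => tcost z.1 z.2).
Proof. exact: (measurable_truncated M (measurable_ecost p)). Qed.
Let w0 (w : simplex R N) a : 0 <= w a. Proof. by case/andP: (weight01 w a). Qed.

Definition soft_index :=
  ({y : 'I_N -> V | forall a, eball r (y a)} * simplex R N)%type.

Definition soft_class (q : soft_index) (x : V) : R :=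
  soft_potential q.2 (sval q.1) tcost eps (fun=> 0) x - M / 2.

Let soft_potential0 (w : simplex R N) (y : 'I_N -> V) x :
  soft_potential w y tcost eps (fun=> 0) x =
  M * softmin (eps / M) w (fun a => tcost x (y a) / M).
Proof.
rewrite /soft_potential /softmin mulrN mulrA [M * _]mulrC divfK ?gt_eqF //.
congr (- (_ * ln _)); apply: eq_bigr => a _; congr (_ * expR (- _)).
by rewrite subr0 invf_div mulrA divfK ?gt_eqF.
Qed.

Lemma rademacher_soft_potentials (x : 'I_n -> V) (sel : {ffun 'I_n -> bool} -> soft_index) :
  (forall i, eball r (x i)) ->
  avg_signs (fun s => n%:R^-1 * `|signed_sum (fun i => soft_class (sel s) (x i)) s|) <=
  2 * (4 * p%:R + 1) * M * Num.sqrt ((N * (d + 1))%:R / n%:R).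
Proof.
move=> Bx; pose y v := sval (sel v).1; have By v a : eball r (y v a) := svalP (sel v).1 a.
pose w v : 'I_N -> R := (sel v).2.
pose c v a i := tcost (x i) (y v a) / M.
have c01 v a i : 0 <= c v a i <= 1.
  by rewrite divr_ge0 ?(ltW M0) ?tcost0 //= ler_pdivrMr // mul1r tcostM.
have tcostC (u v : V) : tcost u v = tcost v u by rewrite /tcost /truncated /ecost enorm_distC.
have clip u v a i : `|c u a i - c v a i| <= p%:R * enorm (r^-1 *: y u a - r^-1 *: y v a).
  rewrite /c -mulrBl normrM (gtr0_norm (x := M^-1)) ?invr_gt0 // ler_pdivrMr //.
  rewrite !(tcostC (x i)) -scalerBr enormZ (gtr0_norm (x := r^-1)) ?invr_gt0 //.
  apply: le_trans (truncated_ecost_lipschitz p r_gt0 (By u a) (By v a) (Bx i)) _.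
  rewrite -/M; have := enorm_ge0 (y u a - y v a); set e := enorm _ => e0.
  have -> : M * p%:R / (2 * r) * e = p%:R * (r^-1 * e) * M / 2 by field; rewrite gt_eqF.
  rewrite ler_pdivrMr // ler_peMr ?ler1n //.
  by rewrite !mulr_ge0 ?ler0n ?invr_ge0 ?(ltW r_gt0) ?(ltW M0).
have b1 v a : enorm (r^-1 *: y v a) <= 1.
  by rewrite enormZ (gtr0_norm (x := r^-1)) ?invr_gt0 // mulrC ler_pdivrMr // mul1r; exact: By.
have := @rademacher_soft_class R _ N d n p%:R (eps / M) (fun v a => r^-1 *: y v a) w c
  N_gt0 d_gt0 n_gt0 p1 (divr_gt0 eps_gt0 M0) b1 (fun v a => w0 _ a)
  (fun v => weight_sum1 _) c01 clip id.
rewrite -(ler_pM2l M0) => /le_trans h.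
have -> : avg_signs (fun s => n%:R^-1 * `|signed_sum (fun i => soft_class (sel s) (x i)) s|) =
  M * avg_signs (fun s => n%:R^-1 *
    `|signed_sum (fun i => softmin (eps / M) (w s) (fun a => c s a i) - 1 / 2) s|).
  rewrite -avg_signsZ; congr avg_signs; apply/funext => s.
  rewrite [RHS]mulrCA; congr (_ * _); rewrite -[X in X * `|_|](gtr0_norm M0) -normrM; congr `|_|.
  rewrite /signed_sum mulr_sumr; apply: eq_bigr => i _.
  by rewrite /soft_class soft_potential0 mulrCA; congr (_ * _); rewrite mulrBr div1r.
by apply: h; rewrite le_eqVlt; apply/predU1P; left; ring.
Qed.

Lemma soft_class_lipschitz q x x' : eball r x -> eball r x' ->
  `|soft_class q x - soft_class q x'| <= M * p%:R / (2 * r) * enorm (x - x').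
Proof.
move=> Bx Bx'; have -> : forall u v s : R, u - s - (v - s) = u - v by move=> *; ring.
have lip u u' a : eball r u -> eball r u' ->
    tcost u (sval q.1 a) - 0 <= tcost u' (sval q.1 a) - 0 + M * p%:R / (2 * r) * enorm (u - u').
  move=> Bu Bu'; have := truncated_ecost_lipschitz p r_gt0 Bu Bu' (svalP q.1 a).
  by rewrite -/M -/tcost ler_norml => /andP[_]; lra.
have le_shift u u' : eball r u -> eball r u' ->
    soft_potential q.2 (sval q.1) tcost eps (fun=> 0) u <=
    soft_potential q.2 (sval q.1) tcost eps (fun=> 0) u' + M * p%:R / (2 * r) * enorm (u - u').
  move=> Bu Bu'; apply: softmin_le_shift => //; first exact: weight_sum1.
  by move=> a; exact: lip.
have := le_shift _ _ Bx Bx'; have := le_shift _ _ Bx' Bx; rewrite (enorm_distC x').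
move: (_ * enorm _) (soft_potential _ _ _ _ _ x) (soft_potential _ _ _ _ _ x') => K A B ? ?.
by rewrite ler_norml; apply/andP; split; lra.
Qed.

Lemma soft_class_norm q x : `|soft_class q x| <= M.
Proof.
have h0 : 0 <= soft_potential q.2 (sval q.1) tcost eps (fun=> 0) x.
  apply: softmin_ge0 => //; first exact: weight_sum1.
  by move=> a; rewrite subr0 tcost0.
have h1 : soft_potential q.2 (sval q.1) tcost eps (fun=> 0) x <= M.
  apply: softmin_le => //; first exact: weight_sum1.
  by move=> a; rewrite subr0 tcostM.
rewrite /soft_class; move: (soft_potential _ _ _ _ _ x) h0 h1 M0 => A ? ? ?.
by rewrite ler_norml; apply/andP; split; lra.
Qed.

Lemma Wpp_eps_diff (mu mu' : probability V R) (w : simplex R N) (y : 'I_N -> V) (b : R) :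
  mu (eball r) = 1%E -> mu' (eball r) = 1%E -> (forall a, eball r (y a)) ->
  (forall q, `|\int[mu]_x soft_class q x - \int[mu']_x soft_class q x| <= b) ->
  (`|Wpp_eps p eps mu (discrete_prob w y) - Wpp_eps p eps mu' (discrete_prob w y)| <= b%:E)%E.
Proof.
move=> muB mu'B By hb.
have local (m : probability V R) : m (eball r) = 1%E ->
    Wpp_eps p eps m (discrete_prob w y) = entropic_ot_cost eps tcost m (discrete_prob w y).
  move=> mB; apply: (entropic_ot_cost_local (measurable_ecost p) mtcost (measurable_eball r) mB).
    exact: discrete_prob_carrier.
  by move=> u v Bu Bv; rewrite /tcost truncatedE // ecost_le.
rewrite !local //; apply: (entropic_ot_cost_diff mtcost tcost0 tcostM eps_gt0) => psi.
have := hb (exist _ y By, tilted w psi eps_gt0); rewrite /soft_class /=.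
have bs := bmfun_soft_potential (tilted w psi eps_gt0) y mtcost tcost0 tcostM eps_gt0 (fun=> 0).
rewrite (Rint_B mu bs (bmfun_cst _)) (Rint_B mu' bs (bmfun_cst _)) !Rintegral_prob_cst.
have E (m : probability V R) : \int[m]_x soft_potential w y tcost eps psi x =
    \int[m]_x soft_potential (tilted w psi eps_gt0) y tcost eps (fun=> 0) x -
    eps * ln (\sum_a w a * expR (psi a / eps)).
  rewrite -[X in _ - X](Rintegral_prob_cst m) -(Rint_B m bs (bmfun_cst _)).
  apply: eq_Rintegral => x _; rewrite /soft_potential (softmin_tilted w psi eps_gt0).
  by congr (softmin _ _ _ - _); apply/funext => a; rewrite subr0.
by rewrite !E; do 2!have -> : forall u v s : R, u - s - (v - s) = u - v by move=> *; ring.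
Qed.

Section process.
Context {d'} {Omega : measurableType d'}.
Variables (P : probability Omega R) (X : 'I_n -> {RV P >-> V}) (mu : probability V R).
Hypothesis iidX : iid_with_law X mu.
Hypothesis muB : mu (eball r) = 1%E.

Lemma Wpp_eps_process (eta : R) : 0 < eta -> exists Z : Omega -> \bar R,
  [/\ measurable_fun setT Z, (forall w, 0 <= Z w)%E,
    (\int[P]_w Z w <=
       (2 * (2 * (4 * p%:R + 1) * M * Num.sqrt ((N * (d + 1))%:R / n%:R)) + eta)%:E)%E &
    forall w (y : 'I_N -> V) (pi : simplex R N), (forall a, eball r (y a)) ->
      (`|Wpp_eps p eps mu (discrete_prob pi y) -
         Wpp_eps p eps (empirical R n_gt0 (fun i => X i w)) (discrete_prob pi y)| <= Z w)%E].
Proof.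
move=> eta0.
have mF q : measurable_fun setT (soft_class q).
  have [m _] := bmfun_soft_potential q.2 (sval q.1) mtcost tcost0 tcostM eps_gt0 (fun=> 0).
  exact: measurable_funB.
pose y0 : {y : 'I_N -> V | forall a, eball r (y a)} :=
  exist (fun y => forall a, eball r (y a)) (fun=> 0) (fun=> eball0 d r_gt0).
pose q0 : soft_index := (y0, uniform_weights R N_gt0).
have [Z [mZ Z0 iZ hZ]] := lipschitz_process q0 n_gt0 iidX muB mF soft_class_norm
  soft_class_lipschitz rademacher_soft_potentials eta0.
exists Z; split => // w y pi By; have [->|[Bx h]] := hZ w; first by rewrite leey.
have [Zoo|Zfin] := eqVneq (Z w) +oo%E; first by rewrite Zoo leey.
have Zf : Z w \is a fin_num by rewrite ge0_fin_numE // ltey.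
rewrite -(fineK Zf); apply: Wpp_eps_diff => // [|q].
  exact: discrete_prob_carrier.
by rewrite -lee_fin fineK.
Qed.

End process.
End entropic.

(** * Constants and assembly *)

Section entropy_constant.
Context {R : realType}.
Variables (a M : R).
Hypothesis a_ge0 : 0 <= a.
Hypothesis M_gt0 : 0 < M.
Local Notation f := (fun t : R => Num.sqrt (ln (2 + a / t))).

(** The integrand at [t] is at most a constant times the number of these intervals that contain [t],
    and their lengths are summable. *)
Let dyadic (k : nat) : set R := `[0%R, 2 * M / (2 ^ k.+1)%:R]%classic.

Lemma dyadic_scale (t : R) : 0 < t -> t <= M -> exists m : nat,
  t <= 2 * M / (2 ^ m.+1)%:R /\ M / t <= (2 ^ m.+1)%:R.
Proof.
move=> t0 tM; have Mt : 1 <= M / t by rewrite ler_pdivlMr // mul1r.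
have [|m hm mmin] := @ex_minnP (fun m => M / t <= (2 ^ m)%:R :> R).
  exists (Num.bound (M / t)); apply: ltW; apply: lt_le_trans (archi_boundP _) _.
    exact: le_trans ler01 Mt.
  by rewrite ler_nat ltnW // ltn_expl.
case: m hm mmin => [|m] hm mmin.
  exists 0%N; split; last by apply: (le_trans hm); rewrite ler_nat.
  by rewrite expn1 mulrAC divff ?mul1r ?pnatr_eq0.
exists m; split => //.
rewrite expnS natrM invfM mulrACA divff ?mul1r ?pnatr_eq0 // ler_pdivlMr ?ltr0n ?expn_gt0 //.
have : ~~ (M / t <= (2 ^ m)%:R) by apply/negP => /mmin; rewrite ltnn.
by rewrite -ltNge ltr_pdivlMr // mulrC => /ltW.
Qed.

Lemma entropy_integrand_le (t : R) (m : nat) : 0 <= t -> M / t <= (2 ^ m.+1)%:R ->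
  f t <= (2 + ln (2 + a / M)) * m.+1%:R.
Proof.
move=> t0 hm.
have aM : 0 <= a / M by rewrite divr_ge0 // ltW.
have pow0 : 0 < (2 ^ m.+1)%:R :> R by rewrite ltr0n expn_gt0.
have pow1 : 1 <= (2 ^ m.+1)%:R :> R by rewrite ler1n expn_gt0.
have l0 : 0 <= ln (2 + a / M) by apply: ln_ge0; lra.
have at0 : 0 <= a / t by rewrite divr_ge0.
have at_le : 2 + a / t <= (2 + a / M) * (2 ^ m.+1)%:R.
  rewrite mulrDl; apply: lerD; first by rewrite ler_peMr.
  have -> : a / t = a / M * (M / t) by rewrite mulrA divfK // gt_eqF.
  exact: ler_wpM2l.
have ln_le : ln (2 + a / t) <= ln (2 + a / M) + m.+1%:R * ln 2.
  rewrite natr_ln // -natrX -lnM ?posrE //; last by lra.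
  by rewrite ler_ln ?posrE ?mulr_gt0 //; lra.
have u0 : 0 <= ln (2 + a / t) by apply: ln_ge0; lra.
have m1 : 1 <= m.+1%:R :> R by rewrite ler1n.
have : f t <= 1 + ln (2 + a / t).
  rewrite -(ger0_norm (x := 1 + ln _)) ?addr_ge0 // -sqrtr_sqr ler_sqrt ?sqr_ge0 //.
  set u := ln _ in u0 *; have := sqr_ge0 u; lra.
have : ln (2 + a / M) * 1 <= ln (2 + a / M) * m.+1%:R by rewrite ler_wpM2l.
have : m.+1%:R * ln 2 <= m.+1%:R * 1 :> R.
  by rewrite ler_wpM2l //; have := ln2_le (R := R); lra.
by move: ln_le; lra.
Qed.

Local Open Scope ereal_scope.

Lemma entropy_const_fin : entropy_const a M < +oo.
Proof.
rewrite /entropy_const; set I := (\int[_]_(_ in _) _).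
suff : I < +oo.
  have I0 : 0 <= I by apply: integral_ge0 => t _; rewrite lee_fin sqrtr_ge0.
  by move=> Ioo; rewrite -(fineK (x := I)) ?ge0_fin_numE // -EFinM ltry.
pose C : R := (2 + ln (2 + a / M))%R.
have C0 : (0 <= C)%R.
  have aM : (0 <= a / M)%R by rewrite divr_ge0 // ltW.
  by apply: addr_ge0 => //; apply: ln_ge0; lra.
pose g (k : nat) (t : R) : \bar R := (C * \1_(dyadic k) t)%:E.
have g0 k t : 0 <= g k t by rewrite lee_fin mulr_ge0 // indicE.
have mdyadic k : measurable (dyadic k) by exact: measurable_itv.
have Edyadic k : lebesgue_measure (dyadic k) = (2 * M / (2 ^ k.+1)%:R)%:E.
  rewrite lebesgue_measure_itv /= lte_fin divr_gt0 ?mulr_gt0 ?ltr0n ?expn_gt0 //.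
  by rewrite sube0.
have mi k : measurable_fun setT (fun t : R => (\1_(dyadic k) t : R)%:E).
  by apply/measurable_EFinP; exact: measurable_indic.
have mg k : measurable_fun setT (g k).
  by apply/measurable_EFinP; apply: measurable_funM => //; exact: measurable_indic.
have fg t : t \in `[0%R, M] -> (f t)%:E <= \sum_(k <oo) g k t.
  rewrite in_itv /= => /andP[t0 tM].
  have partial m : (forall k, (k <= m)%N -> dyadic k t) ->
      (C * m.+1%:R)%:E <= \sum_(k <oo) g k t.
    move=> hm; apply: le_trans (nneseries_lim_ge m.+1 (fun k _ _ => g0 k t)).
    rewrite big_mkord (eq_bigr (fun=> C%:E)); last first.
      by move=> k _; rewrite /g indicE mem_set ?mulr1 //; apply: hm; rewrite -ltnS.
    by rewrite sumEFin sumr_const card_ord mulr_natr.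
  have mem m k : (k <= m)%N -> (t <= 2 * M / (2 ^ m.+1)%:R)%R -> dyadic k t.
    move=> km h; rewrite /dyadic /= in_itv /= t0 /=; apply: (le_trans h).
    rewrite ler_pM2l ?mulr_gt0 // lef_pV2 ?posrE ?ltr0n ?expn_gt0 // ler_nat.
    by rewrite leq_pexp2l.
  (* At [t = 0] both quotients are read as 0, so the first interval suffices. *)
  move: t0; rewrite le_eqVlt => /predU1P[t00|t0].
    apply: le_trans (partial 0%N _); last first.
      by move=> k k0; apply: mem (k0) _; rewrite -t00 divr_ge0 ?mulr_ge0 ?(ltW M_gt0).
    by rewrite lee_fin; apply: entropy_integrand_le; rewrite -t00 // invr0 mulr0.
  have [m [h1 h2]] := dyadic_scale t0 tM.
  apply: le_trans (partial m _); last by move=> k km; exact: mem km h1.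
  by rewrite lee_fin; apply: entropy_integrand_le => //; exact: ltW.
apply: (@le_lt_trans _ _ (\int[lebesgue_measure]_t \sum_(k <oo) g k t)).
  rewrite /I integral_mkcond; apply: ge0_le_integral_all => t; rewrite patchE; case: ifPn.
  - by rewrite lee_fin sqrtr_ge0.
  - by [].
  - by move=> /set_mem; exact: fg.
  - by move=> _; apply: nneseries_ge0 => k _ _; exact: g0.
rewrite integral_nneseries //.
apply: (@le_lt_trans _ _ (2 * M * C)%:E); last exact: ltry.
apply: le_trans (epsilon_trick0 xpredT _); last by rewrite !mulr_ge0 // ltW.
apply: lee_nneseries => [k _ _|k _].
  by apply: integral_ge0.
rewrite /g; under eq_integral do rewrite EFinM.
rewrite ge0_integralZl //; last exact: mi.
rewrite [X in _ * X](_ : _ = (2 * M / (2 ^ k.+1)%:R)%:E); last first.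
  rewrite -Edyadic.
  rewrite integral_indic; [|exact: measurableT|exact: mdyadic].
  by congr (lebesgue_measure _); exact: setIT.
by rewrite -EFinM lee_fin le_eqVlt; apply/predU1P; left; rewrite [RHS]mulrAC mulrC.
Qed.

(** The integrand is at least [sqrt (ln 2)], and [128 * 16/25 = 81.92] exceeds [9^2]. *)
Lemma entropy_const_ge : (9 * M)%:E <= entropy_const a M.
Proof.
have Eitv : lebesgue_measure `[0%R, M]%classic = M%:E.
  by rewrite lebesgue_measure_itv /= lte_fin M_gt0 sube0.
apply: (@le_trans _ _ ((8 * Num.sqrt 2)%:E * (Num.sqrt (ln 2) * M)%:E)).
  rewrite -EFinM lee_fin mulrA ler_pM2r // -mulrA -sqrtrM //.
  have -> : (9 = 8 * (9 / 8) :> R)%R by lra.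
  rewrite ler_pM2l // -(ger0_norm (x := 9 / 8)%R) // -sqrtr_sqr ler_sqrt.
    by have := ln2_ge (R := R); lra.
  by have := ln2_ge (R := R); lra.
rewrite lee_pmul2l ?lte_fin ?mulr_gt0 ?sqrtr_gt0 //.
apply: (@le_trans _ _ (\int[lebesgue_measure]_(t in `[0%R, M]) (Num.sqrt (ln 2))%:E)).
  rewrite integral_cst; last exact: measurable_itv.
  by rewrite [X in _ * X](_ : _ = M%:E); [rewrite EFinM|exact: Eitv].
rewrite [leLHS]integral_mkcond [leRHS]integral_mkcond.
apply: ge0_le_integral_all => t; rewrite !patchE; case: ifPn => //.
move=> /set_mem; rewrite /= in_itv /= => /andP[t0 _]; rewrite lee_fin.
have at0 : (0 <= a / t)%R by rewrite divr_ge0.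
have l2 : (0 <= ln (2 + a / t))%R by apply: ln_ge0; lra.
by rewrite ler_sqrt // ler_ln ?posrE //; lra.
Qed.

End entropy_constant.

Section expected_gap.
Context {R : realType} (d L N n : nat) (r : R).
Local Notation V := 'rV[R]_d.
Hypothesis L_gt0 : (0 < L)%N.
Hypothesis n_gt0 : (0 < n)%N.
Context {d'} {Omega : measurableType d'}.
Variables (P : probability Omega R) (mu : 'I_L -> probability V R).
Variables (X : 'I_L -> 'I_n -> {RV P >-> V}).
Variables (D : probability V R -> probability V R -> \bar R) (B : R).
Let mu_n w l : probability V R := empirical R n_gt0 (fun i => X l i w).
Hypothesis D_process : forall eta, 0 < eta -> forall l, exists Z : Omega -> \bar R,
  [/\ measurable_fun setT Z, (forall w, 0 <= Z w)%E, (\int[P]_w Z w <= (B + eta)%:E)%E &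
    forall w (y : 'I_N -> V) (pi : simplex R N), (forall a, eball r (y a)) ->
      (`|D (mu l) (discrete_prob pi y) - D (mu_n w l) (discrete_prob pi y)| <= Z w)%E].
Local Open Scope ereal_scope.

Lemma mean_diff_le (u v z : 'I_L -> \bar R) : (forall l, 0 <= z l) ->
  (forall l, `|u l - v l| <= z l) ->
  `|(L%:R^-1)%:E * \sum_l u l - (L%:R^-1)%:E * \sum_l v l| <= (L%:R^-1)%:E * \sum_l z l.
Proof.
move=> z0 h; have L0 : (0 < L%:R^-1 :> R)%R by rewrite invr_gt0 ltr0n.
have [[l zl]|fin] := pselect (exists l, z l = +oo).
  rewrite [\sum_l z l](bigD1 l) //= zl addye; last first.
    by rewrite gt_eqF // (lt_le_trans ltNy0) // sume_ge0.
  by rewrite mulry gtr0_sg // mul1e leey.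
have zf l : z l \is a fin_num.
  by rewrite ge0_fin_numE // ltey; apply/eqP => zl; apply: fin; exists l.
(* A finite bound on the difference forces both costs to be finite, so the sums can be handled in
   the reals. *)
have uvf l : (u l \is a fin_num) && (v l \is a fin_num).
  by rewrite -fin_numB fin_num_abs (le_lt_trans (h l)) // -ge0_fin_numE.
have uf l : u l = (fine (u l))%:E by rewrite fineK //; case/andP: (uvf l).
have vf l : v l = (fine (v l))%:E by rewrite fineK //; case/andP: (uvf l).
have sumE (t : 'I_L -> \bar R) : (forall l, t l \is a fin_num) ->
    \sum_l t l = (\sum_l fine (t l))%R%:E.
  by move=> tf; rewrite -sumEFin; apply: eq_bigr => l _; rewrite fineK.
rewrite (sumE z zf) (sumE u) => [|l]; last by case/andP: (uvf l).
rewrite (sumE v) => [|l]; last by case/andP: (uvf l).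
rewrite -!EFinM lee_fin -mulrBr normrM (gtr0_norm L0) ler_pM2l // -sumrB.
apply: (le_trans (ler_norm_sum _ _ _)); apply: ler_sum => l _.
by rewrite -lee_fin fineK // -abse_EFin EFinB -uf -vf.
Qed.

Lemma expected_gap_le : \int[P]_w sup_gap D N r mu (mu_n w) <= B%:E.
Proof.
apply/lee_addgt0Pr => eta eta0; have /choice[Z hZ] := D_process eta0.
have mZ l : measurable_fun setT (Z l) by have [] := hZ l.
have Z0 l w : 0 <= Z l w by have [_ h _ _] := hZ l.
have L0 : (0 < L%:R^-1 :> R)%R by rewrite invr_gt0 ltr0n.
apply: (@le_trans _ _ (\int[P]_w ((L%:R^-1)%:E * \sum_l Z l w))).
  (* The supremum over targets is taken pointwise, without measurability; the dominating variables
     do not depend on the target. *)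
  apply: le_integral_all => w; apply: ge_ereal_sup => _ [[y pi] /= By <-].
  by apply: mean_diff_le => l //; have [_ _ _ h] := hZ l; exact: h.
rewrite ge0_integralZl //; last 2 first.
- exact: emeasurable_sum.
- by move=> w _; apply: sume_ge0 => l _.
rewrite ge0_integral_sum //.
apply: (@le_trans _ _ ((L%:R^-1)%:E * \sum_(l < L) (B + eta)%:E)).
  by rewrite lee_pmul2l // lee_sum // => l _; have [] := hZ l.
rewrite sumEFin sumr_const card_ord -EFinM -EFinD lee_fin -[X in (_ * X)%R]mulr_natl mulrA.
rewrite mulVf ?mul1r //.
by rewrite pnatr_eq0 -lt0n.
Qed.

End expected_gap.

Lemma entropy_const_sqrt_ge (R : realType) (a M B : R) (m m' n : nat) : 0 <= a -> 0 < M ->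
  (m <= m')%N -> B <= 9 * M * Num.sqrt (m%:R / n%:R) ->
  (B%:E <= entropy_const a M * (Num.sqrt (m'%:R / n%:R))%:E)%E.
Proof.
move=> a0 M0 mm hB.
have s0 : 0 <= Num.sqrt (m'%:R / n%:R) :> R by exact: sqrtr_ge0.
apply: (@le_trans _ _ ((9 * M)%:E * (Num.sqrt (m'%:R / n%:R))%:E)%E).
  rewrite -EFinM lee_fin; apply: (le_trans hB); rewrite ler_pM2l ?mulr_gt0 //.
  by rewrite ler_sqrt ?divr_ge0 ?ler0n // ler_wpM2r ?invr_ge0 ?ler0n // ler_nat.
by apply: lee_wpmul2r; rewrite ?lee_fin // entropy_const_ge.
Qed.

Section sliced_process.
Context {R : realType} (d p N n : nat) (r : R).
Local Notation V := 'rV[R]_d.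
Hypothesis d_gt0 : (0 < d)%N.
Hypothesis p_gt0 : (0 < p)%N.
Hypothesis N_gt0 : (0 < N)%N.
Hypothesis n_gt0 : (0 < n)%N.
Hypothesis r_gt0 : 0 < r.
Let M := (2 * r) ^+ p.
Context {d'} {Omega : measurableType d'}.
Variables (P : probability Omega R) (X : 'I_n -> {RV P >-> V}) (mu : probability V R).
Hypothesis iidX : iid_with_law X mu.
Hypothesis muB : mu (eball r) = 1%E.
Let mu_n w : probability V R := empirical R n_gt0 (fun i => X i w).

Lemma sliced_process (eta : R) : 0 < eta -> exists Z : Omega -> \bar R,
  [/\ measurable_fun setT Z, (forall w, 0 <= Z w)%E,
    (\int[P]_w Z w <=
       (2 * (9 * M * Num.sqrt ((N * (d + 1))%:R / n%:R)) + eta)%:E)%E &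
    forall w (y : 'I_N -> V) (pi : simplex R N), (forall a, eball r (y a)) ->
      (forall sigma, `|SWpp p sigma mu (discrete_prob pi y) -
         SWpp p sigma (mu_n w) (discrete_prob pi y)| <= Z w)%E /\
      (`|maxSWpp p mu (discrete_prob pi y) -
         maxSWpp p (mu_n w) (discrete_prob pi y)| <= Z w)%E].
Proof.
move=> eta0.
have [Z [mZ Z0 iZ hZ]] := Wpp_proj_process d_gt0 p_gt0 N_gt0 n_gt0 r_gt0 iidX muB eta0.
exists Z; split => // w y pi By.
have [->|[Bx h]] := hZ w; first by split => [sigma|]; exact: leey.
have [Zoo|Zfin] := eqVneq (Z w) +oo%E; first by rewrite Zoo; split => [sigma|]; exact: leey.
have Zf : Z w \is a fin_num by rewrite ge0_fin_numE // ltey.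
have muB' : mu_n w (eball r) = 1%E by exact: discrete_prob_carrier.
have bound (m : probability V R) : m (eball r) = 1%E -> forall theta : V, enorm theta = 1 ->
    (0 <= Wpp_proj p m (discrete_prob pi y) theta <= M%:E)%E.
  by move=> mB theta t1; exact: Wpp_proj_bounds.
have b0 : 0 <= fine (Z w) by exact: fine_ge0.
have diff theta : enorm theta = 1 -> (`|Wpp_proj p mu (discrete_prob pi y) theta -
    Wpp_proj p (mu_n w) (discrete_prob pi y) theta| <= (fine (Z w))%:E)%E.
  by move=> t1; rewrite fineK //; exact: h.
rewrite -(fineK Zf); split => [sigma|].
  exact: (SWpp_diff (bound _ muB) (bound _ muB') b0 diff).
have [theta0 t01] := exists_unit_vector R d_gt0.
exact: (maxSWpp_diff (bound _ muB) (bound _ muB') diff t01).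
Qed.

End sliced_process.

Theorem theorem3p1 (R : realType) (d L N n p : nat) (r : R)
  (hd : (0 < d)%N) (hL : (0 < L)%N) (hN : (0 < N)%N) (hn : (0 < n)%N)
  (hp : (0 < p)%N) (hr : 0 < r)
  (mu : 'I_L -> probability 'rV[R]_d R)
  (hmu : forall l, mu l (eball r) = 1%E)
  (disp : measure_display) (Omega : measurableType disp)
  (P : probability Omega R)
  (X : 'I_L -> 'I_n -> {RV P >-> 'rV[R]_d})
  (hX : forall l, iid_with_law (X l) (mu l)) :
  let mu_n (w : Omega) (l : 'I_L) : probability 'rV[R]_d R :=
    empirical R hn (fun i => X l i w) in
  let expected_gap (D : probability 'rV[R]_d R -> probability 'rV[R]_d R -> \bar R)
      : \bar R :=
    (\int[P]_w sup_gap D N r mu (mu_n w))%E in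
  let C_W := entropy_const (32 * p%:R * r ^+ p) (2 * (2 * r) ^+ p) in
  let C_SW := entropy_const (48 * p%:R * r ^+ p) (2 * (2 * r) ^+ p) in
  let C_eps := entropy_const (64 * p%:R * (2 * r) ^+ p)
                 ((4 * p%:R + 1) * (2 * r) ^+ p) in
  [/\ (C_W < +oo)%E /\
      (expected_gap (@Wpp R d p)
         <= C_W * (Num.sqrt ((N * (d + 1))%:R / n%:R))%:E)%E,
      (C_SW < +oo)%E /\
      (forall sigma : probability 'rV[R]_d R, uniform_on_sphere sigma ->
         expected_gap (SWpp p sigma)
           <= C_SW * (Num.sqrt ((N * (d + 1) + d)%:R / n%:R))%:E)%E,
      (expected_gap (@maxSWpp R d p)
         <= C_SW * (Num.sqrt ((N * (d + 1) + d)%:R / n%:R))%:E)%E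
    & (C_eps < +oo)%E /\
      (forall eps : R, (0 < eps)%R ->
         expected_gap (Wpp_eps p eps)
           <= C_eps * (Num.sqrt ((N * (d + 1))%:R / n%:R))%:E)%E].
Proof.
move=> mu_n expected_gap C_W C_SW C_eps.
have M0 : 0 < (2 * r) ^+ p by rewrite exprn_gt0 // mulr_gt0.
have M20 : 0 < 2 * (2 * r) ^+ p by rewrite mulr_gt0.
have Me0 : 0 < (4 * p%:R + 1) * (2 * r) ^+ p by rewrite mulr_gt0 // ltr_wpDl // mulr_ge0.
have a0 (k : R) : 0 <= k -> 0 <= k * p%:R * r ^+ p.
  by move=> k0; rewrite !mulr_ge0 // exprn_ge0 // ltW.
have ae0 : 0 <= 64 * p%:R * (2 * r) ^+ p by rewrite !mulr_ge0 // ltW.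
have a32 : 0 <= 32 * p%:R * r ^+ p by apply: a0.
have a48 : 0 <= 48 * p%:R * r ^+ p by apply: a0.
have s0 : 0 <= Num.sqrt ((N * (d + 1))%:R / n%:R) :> R by exact: sqrtr_ge0.
(* The 2 of symmetrization is the 2 in the upper limit of integration. *)
have hB : 2 * (9 * (2 * r) ^+ p * Num.sqrt ((N * (d + 1))%:R / n%:R)) <=
    9 * (2 * (2 * r) ^+ p) * Num.sqrt ((N * (d + 1))%:R / n%:R).
  by rewrite le_eqVlt; apply/predU1P; left; ring.
split; first split.
- exact: entropy_const_fin.
- apply: le_trans (entropy_const_sqrt_ge a32 M20 (leqnn _) hB).
  apply: expected_gap_le => // eta eta0 l.
  by apply: Wpp_process => //; exact: hX.
- split=> [|sigma _]; first exact: entropy_const_fin.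
  apply: le_trans (entropy_const_sqrt_ge a48 M20 (leq_addr _ _) hB).
  apply: expected_gap_le => // eta eta0 l.
  have [Z [mZ Z0 iZ hZ]] := sliced_process hd hp hN hn hr (hX l) (hmu l) eta0.
  by exists Z; split => // w y pi By; have [h _] := hZ w y pi By; exact: h.
- apply: le_trans (entropy_const_sqrt_ge a48 M20 (leq_addr _ _) hB).
  apply: expected_gap_le => // eta eta0 l.
  have [Z [mZ Z0 iZ hZ]] := sliced_process hd hp hN hn hr (hX l) (hmu l) eta0.
  by exists Z; split => // w y pi By; have [_ h] := hZ w y pi By.
- split=> [|eps eps0]; first exact: entropy_const_fin.
  (* Here the upper limit already contains [4 p + 1], and the two factors 2 give 4, below 9. *)
  have hBe : 2 * (2 * (4 * p%:R + 1) * (2 * r) ^+ p * Num.sqrt ((N * (d + 1))%:R / n%:R)) <=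
      9 * ((4 * p%:R + 1) * (2 * r) ^+ p) * Num.sqrt ((N * (d + 1))%:R / n%:R).
    have := mulr_ge0 (ltW Me0) s0; set K := (4 * p%:R + 1) * (2 * r) ^+ p.
    set s := Num.sqrt _ => Ks; have -> : 2 * (2 * (4 * p%:R + 1) * (2 * r) ^+ p * s) = 4 * (K * s).
      by rewrite /K; ring.
    have -> : 9 * K * s = 9 * (K * s) by ring.
    lra.
  apply: le_trans (entropy_const_sqrt_ge ae0 Me0 (leqnn _) hBe).
  apply: expected_gap_le => // eta eta0 l.
  by apply: Wpp_eps_process => //; exact: hX.
Qed.
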